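(* Let $\alpha,\beta,\gamma,\kappa>0$ with $0<\alpha<\kappa$, and put $\Delta:=1+\alpha-\kappa$ and $R:=\alpha^\alpha/\kappa^\kappa$. Let $E_{\alpha,\beta}^{\gamma,\kappa}$ be the power series and $K_{\alpha,\beta}^{\gamma,\kappa}$ the kernel defined in the context, and consider the integral $$\mathcal{E}_{\alpha,\beta}^{\gamma,\kappa}(x)=\int_0^\infty e^{-xu}K_{\alpha,\beta}^{\gamma,\kappa}(u)\,\mathrm{d}u .$$ (i) If $\Delta>0$, the integral extends to an entire function of $x$ and equals $E_{\alpha,\beta}^{\gamma,\kappa}(-x)$ for every $x\in\mathbb{C}$. (ii) If $\Delta=0$, the integral is holomorphic on $\{x\in\mathbb{C}:\operatorname{Re}x>-R\}$, agrees with $E_{\alpha,\beta}^{\gamma,\kappa}(-x)$ for $|x|<R$, and therefore analytically continues that germ to the half-plane $\operatorname{Re}x>-R$. (iii) If $\Delta<0$, the integral is holomorphic on $\{x\in\mathbb{C}:\operatorname{Re}x>0\}$, it has finite right derivatives of every order at $x=0$, and it is not analytic at $x=0$.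
   Context: For $\alpha,\beta,\gamma,\kappa>0$, $$E_{\alpha,\beta}^{\gamma,\kappa}(z)=\sum_{n=0}^{\infty}\frac{\Gamma(\gamma+\kappa n)}{\Gamma(\gamma)\,n!\,\Gamma(\beta+\alpha n)}\,z^n$$ is regarded first as a formal power series; it is entire if $\Delta>0$, has radius of convergence $R=\alpha^\alpha/\kappa^\kappa$ if $\Delta=0$, and has radius of convergence zero if $\Delta<0$. For real $\lambda>-1$ and $\nu,z\in\mathbb{C}$ the Wright function is $$W_{\lambda,\nu}(z)=\sum_{n=0}^{\infty}\frac{z^n}{n!\,\Gamma(\lambda n+\nu)},$$ with $1/\Gamma(w)=0$ for $w\in\{0,-1,-2,\dots\}$. For $0<\alpha<\kappa$ and $\mu:=\beta-\alpha\gamma/\kappa$, the kernel is $$K_{\alpha,\beta}^{\gamma,\kappa}(u)=\frac{u^{\gamma/\kappa-1}}{\kappa\,\Gamma(\gamma)}\,W_{-\alpha/\kappa,\,\mu}\bigl(-u^{1/\kappa}\bigr),\qquad u>0,$$ and $\mathcal{E}_{\alpha,\beta}^{\gamma,\kappa}(x)$ is originally defined by the integral for $x\geq 0$. ''Not analytic at $x=0$'' in (iii) means that no function holomorphic in a neighbourhood of $0$ coincides with $\mathcal{E}_{\alpha,\beta}^{\gamma,\kappa}$ on $[0,\varepsilon)$ for some $\varepsilon>0$. *)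

(* Defs.v *)
(* Complex numbers are R[i] over an arbitrary R : realType; limits and
   derivatives are taken in the regular module R[i]^o, which carries the norm
   topology. *)
From HB Require Import structures.
From mathcomp Require Export all_boot all_order all_algebra.
From mathcomp Require Export all_classical all_reals all_analysis.
From mathcomp Require Export complex.

Set Implicit Arguments.
Unset Strict Implicit.
Unset Printing Implicit Defensive.

Export Order.TTheory GRing.Theory Num.Theory.
Export numFieldNormedType.Exports.

Local Open Scope classical_set_scope.
Local Open Scope ring_scope.
Local Open Scope complex_scope.

Definition cexp (R : realType) (z : R[i]) : R[i] :=
  (expR (complex.Re z))%:C * (cos (complex.Im z) +i* sin (complex.Im z)).

Definition cintegrable (R : realType) (D : set R) (f : R -> R[i]) : Prop :=
  (@lebesgue_measure R).-integrable D (fun t => (complex.Re (f t))%:E) /\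
  (@lebesgue_measure R).-integrable D (fun t => (complex.Im (f t))%:E).

(* Meaningful only under [cintegrable D f]: [Rintegral] is total. *)
Definition cintegral (R : realType) (D : set R) (f : R -> R[i]) : R[i] :=
  Rintegral (@lebesgue_measure R) D (fun t => complex.Re (f t)) +i*
  Rintegral (@lebesgue_measure R) D (fun t => complex.Im (f t)).

(* Euler's integral of the second kind, convergent for 0 < Re w. *)
Definition euler_gamma (R : realType) (w : R[i]) : R[i] :=
  cintegral `]0, +oo[ (fun t => cexp ((w - 1) * (ln t)%:C) * (expR (- t))%:C).

(* Continuation of Euler's integral by Gamma (w + n) = w (w + 1) ... (w + n - 1)
   * Gamma w, where n is the least natural number with 0 < Re w + n ([truncn]
   is 0 on negative numbers).  At the poles w = 0, -1, -2, ... the product is 0;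
   as inverses of 0 are 0, both [Gamma w] and [(Gamma w)^-1] are 0 there, so
   that [(Gamma w)^-1] is the entire function 1/Gamma for every w. *)
Definition Gamma (R : realType) (w : R[i]) : R[i] :=
  let n := Num.truncn (1 - complex.Re w) in
  euler_gamma (w + n%:R) / \prod_(j < n) (w + j%:R).

Definition powser (R : realType) (a : nat -> R[i]) (z : R[i]) : nat -> R[i]^o :=
  series (fun n => a n * z ^+ n : R[i]^o).

Definition wright (R : realType) (lambda : R) (nu z : R[i]) : R[i] :=
  limn (powser
    (fun n => (n`!)%:R^-1 * (Gamma ((lambda * n%:R)%:C + nu))^-1) z).

Definition ml_coef (R : realType) (alpha beta gamma kappa : R) (n : nat) : R[i] :=
  Gamma (gamma + kappa * n%:R)%:C /
  (Gamma gamma%:C * (n`!)%:R * Gamma (beta + alpha * n%:R)%:C).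

(* The sum of the series where it converges. *)
Definition ml (R : realType) (alpha beta gamma kappa : R) (z : R[i]) : R[i] :=
  limn (powser (ml_coef alpha beta gamma kappa) z).

Definition kernelK (R : realType) (alpha beta gamma kappa : R) (u : R) : R[i] :=
  (u `^ (gamma / kappa - 1))%:C / (kappa%:C * Gamma gamma%:C) *
  wright (- (alpha / kappa)) (beta - alpha * gamma / kappa)%:C
         (- (u `^ kappa^-1)%:C).

Definition laplace_integrand (R : realType) (alpha beta gamma kappa : R)
    (x : R[i]) (u : R) : R[i] :=
  cexp (- (x * u%:C)) * kernelK alpha beta gamma kappa u.

Definition converges (R : realType) (alpha beta gamma kappa : R) (x : R[i]) :
    Prop :=
  cintegrable `]0, +oo[ (laplace_integrand alpha beta gamma kappa x).

Definition calE (R : realType) (alpha beta gamma kappa : R) (x : R[i]) : R[i] :=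
  cintegral `]0, +oo[ (laplace_integrand alpha beta gamma kappa x).

(* [derivable _ z 1] is over the scalar field R[i], so it is complex
   differentiability. *)
Definition holomorphic_on (R : realType) (U : set R[i]) (f : R[i] -> R[i]) :
    Prop :=
  open (U : set R[i]^o) /\
  forall z, U z -> derivable (f : R[i]^o -> R[i]^o) z 1.

(* [g n] is the n-th derivative of f restricted to [0, +oo[; it is one-sided
   at 0. *)
Definition has_right_derivatives_at0 (R : realType) (f : R -> R[i]) : Prop :=
  exists g : nat -> R -> R[i],
    [/\ forall x : R, 0 <= x -> g 0%N x = f x,
        forall n (x : R), 0 < x ->
          ((g n (x + h) - g n x) / h%:C : R[i]^o) @[h --> (0 : R)^'] -->
            (g n.+1 x : R[i]^o) &
        forall n,
          ((g n h - g n 0) / h%:C : R[i]^o) @[h --> (0 : R)^'+] -->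
            (g n.+1 0 : R[i]^o)].

Definition analytic_at0 (R : realType) (f : R -> R[i]) : Prop :=
  exists (U : set R[i]) (F : R[i] -> R[i]),
    [/\ U 0, holomorphic_on U F &
        exists2 eps : R, 0 < eps &
          forall x : R, 0 <= x < eps -> U x%:C /\ F x%:C = f x].

(* Main.v *)
Require Import Defs.
From mathcomp Require Import measurable_realfun ring lra.

(** Put rho = alpha / kappa, which lies in ]0, 1[, and let k be the kernel, a
    power of u times Wright's function. The whole statement rests on two facts
    about k: its moments, int u^n k(u) du = Gamma(gamma + kappa n) /
    (Gamma(gamma) Gamma(beta + alpha n)), that is n! times the n-th coefficient
    of E, and the exponents c for which e^(c u) k(u) is still integrable against
    every power of u.

    Moments (rwright_moment_ge0, wright_moments). The Wright series cannot be
    integrated term by term, powers of u not being integrable. Instead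
    1/Gamma(nu - rho n) is replaced by Gauss's products of N + 1 factors. The
    series then sums in closed form to e^(-y) times a polynomial in y whose
    coefficients are nonnegative when nu >= 0, because rho < 1, and whose
    moments are, up to a Gamma factor, Gauss's products again. A bound for
    Gauss's products that does not depend on N (gauss_product_le) and Tannery's
    theorem let N tend to infinity under the sum; Fatou's lemma and a tail
    estimate by the next moment do it under the integral. For nu < 0 the
    relation W_nu = nu W_(nu+1) + rho t W_(nu+1-rho), which is 1/Gamma(s) =
    s/Gamma(s+1) term by term, reduces to nonnegative parameters.

    Exponential moments (wright_adm_criterion). For nu >= 0 everything is
    nonnegative, so that the integral with e^(c u) is the sum of c^n/n! times
    moments. Gamma(x + a) ~ Gamma(x) x^a makes the ratio of consecutive terms
    behave like c kappa^kappa alpha^(-alpha) n^(-Delta): every c >= 0 is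
    admissible if Delta > 0, every c < R if Delta = 0, and c = 0 always.

    Holomorphy, derivatives, series. For an admissible c, the second-order
    Taylor remainder of the exponential gives |L_n(x + h) - L_n(x) - h
    L_(n+1)(x)| <= C |h|^2 on Re x >= - c for the transforms L_n of (-u)^n k(u)
    (laplace_quadratic). This is holomorphy inside the half-plane, and for c = 0
    it contains the one-sided derivatives at 0. Dominated convergence of the
    Taylor polynomials of e^(-x u) identifies the transform with the power
    series of its moments for |x| <= c (laplace_series).

    Failure of analyticity (analytic_moment_growth). Let F be holomorphic near 0
    and agree with the transform on [0, eps[. The n-th forward difference of
    step h at 0 is int (e^(-h u) - 1)^n k(u) du; divided by h^n it tends to
    (-1)^n times the n-th moment as h tends to 0. For F, Cauchy's estimate and
    the mean value theorem, iterated n times on discs that shrink by at most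
    rho/(2n) each time (rho now being the radius of the first disc), bound the
    same quotient by (64 n/rho)^n M <= C K^n n!. When Delta < 0 the ratio of
    consecutive coefficients tends to infinity (ml_weight_growth), so the n-th
    moment divided by n! outgrows every C K^n. Cauchy's estimate itself comes
    from Goursat's theorem on rectangles in the logarithmic coordinate w, z = a
    + e^w. *)

Set Implicit Arguments.
Unset Strict Implicit.
Unset Printing Implicit Defensive.

Local Open Scope classical_set_scope.
Local Open Scope ring_scope.
Local Open Scope complex_scope.

Local Notation nc := (@ComplexField.Normc.normc _).
Local Notation normcM := ComplexField.Normc.normcM.
Local Notation Re := (@complex.Re _).
Local Notation Im := (@complex.Im _).
Local Notation mu := (@lebesgue_measure _).

(** * Integrals over the positive half-line *)

Lemma measurable_pos (R : realType) : measurable (`]0, +oo[%classic : set (measurableTypeR R)).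
Proof. exact: measurable_itv. Qed.

Lemma posP (R : realType) (u : R) : `]0, +oo[%classic u -> 0 < u.
Proof. by rewrite /= in_itv/= andbT. Qed.

Lemma cvg_near_eq (T : Type) (U : nbhsType) (F : set_system T) {FF : Filter F}
    (f g : T -> U) (l : set_system U) :
  (\forall x \near F, f x = g x) -> g @ F --> l -> f @ F --> l.
Proof.
move=> fg gl; apply: cvg_trans gl; apply: near_eq_cvg.
by apply: filterS fg => x ->.
Qed.

Section HalfLine.
Variable R : realType.

Definition half_int (f : R -> R) : \bar R :=
  (\int[mu]_(u in `]0%R, +oo[) (f u)%:E)%E.

Lemma continuous_half_measurable (f : R -> R) :
  (forall x : R, 0 < x -> {for x, continuous f}) -> measurable_fun `](0:R), +oo[ f.
Proof.
move=> cf; apply: open_continuous_measurable_fun; first exact: interval_open.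
by move=> x; rewrite inE/= in_itv/= andbT; exact: cf.
Qed.

(** Monotone convergence along segments [a n, b n] that increase to the half-
    line. Substitution, integration by parts and the fundamental theorem need
    only be applied on such segments. *)
Lemma half_int_exhaust (f : R -> R) (a b : nat -> R) :
  (forall x : R, 0 < x -> {for x, continuous f}) ->
  (forall x : R, 0 < x -> 0 <= f x) ->
  (forall n, 0 < a n) -> nonincreasing_seq a -> nondecreasing_seq b ->
  a @ \oo --> 0 -> b @ \oo --> +oo ->
  (\int[mu]_(u in `[a n, b n]) (f u)%:E)%E @[n --> \oo] --> half_int f.
Proof.
move=> cf f0 a0 da ib alim blim.
have -> : half_int f = (\int[mu]_(u in \bigcup_n [set` `[a n, b n]]) (f u)%:E)%E.
  congr integral; apply/seteqP; split=> u /=.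
    rewrite in_itv/= andbT => u0.
    have [N _ aN] : \forall n \near \oo, a n < u by exact: (cvgr_lt _ alim).
    have [M _ bM] : \forall n \near \oo, u <= b n by exact: (cvgry_ge blim).
    exists (maxn N M) => //=; rewrite in_itv/=; apply/andP; split.
      by apply/ltW/aN => /=; rewrite leq_maxl.
    by apply: bM => /=; rewrite leq_maxr.
  move=> [n _ /=]; rewrite in_itv/= => /andP[+ _].
  by rewrite in_itv/= andbT; exact: lt_le_trans.
apply: ge0_nondecreasing_set_cvg_integral => //.
- move=> n m nm; rewrite subsetEset => x /=; rewrite !in_itv/= => /andP[ax xb].
  by rewrite (le_trans (da _ _ nm) ax) (le_trans xb (ib _ _ nm)).
- move=> n; apply/measurable_EFinP.
  apply: (@measurable_funS _ _ _ _ `](0:R), +oo[) => //.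
    by move=> x /=; rewrite !in_itv/= andbT => /andP[+ _]; exact: lt_le_trans.
  exact: continuous_half_measurable.
- move=> n x /=; rewrite in_itv/= lee_fin => /andP[+ _] => /(lt_le_trans (a0 n)).
  exact: f0.
Qed.

Lemma within_cc_continuous (f : R -> R) (a b : R) : 0 < a ->
  (forall x : R, 0 < x -> {for x, continuous f}) -> {within `[a, b], continuous f}.
Proof.
move=> a0 cf; apply: continuous_in_subspaceT => x.
by rewrite inE/= in_itv/= => /andP[+ _] => /(lt_le_trans a0); exact: cf.
Qed.

Lemma continuous_powR (q x : R) : 0 < x -> {for x, continuous (@powR R ^~ q)}.
Proof.
move=> x0; apply/differentiable_continuous/derivable1_diffP/derivable_powR.
by rewrite in_itv/= x0.
Qed.

Lemma is_derive_powR (q x : R) : 0 < x ->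
  is_derive x 1 (@powR R ^~ q) (q * x `^ (q - 1)).
Proof.
move=> x0; have xI : x \in `]0, +oo[%R by rewrite in_itv/= x0.
apply: DeriveDef; first exact: derivable_powR.
by rewrite -derive1E powR_derive1.
Qed.

Lemma invS_nonincreasing : nonincreasing_seq (fun n => n.+1%:R^-1 : R).
Proof. by move=> n m nm; rewrite lef_pV2 ?posrE// ler_nat ltnS. Qed.

Lemma cvgr_natS : (n.+1%:R : R) @[n --> \oo] --> +oo.
Proof.
apply/cvgryPge => A; near=> n; rewrite (@le_trans _ _ n%:R) ?ler_nat//.
near: n; exact: nbhs_infty_ger.
Unshelve. all: by end_near. Qed.

(** Both sides are exhausted by corresponding segments, on which the increasing
    substitution t = c * u ^ q applies. *)
Lemma half_int_powR_subst (c q : R) (G : R -> R) : 0 < c -> 0 < q ->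
  (forall x : R, 0 < x -> {for x, continuous G}) ->
  (forall x : R, 0 < x -> 0 <= G x) ->
  half_int G = half_int (fun u => G (c * u `^ q) * (c * (q * u `^ (q - 1)))).
Proof.
move=> c0 q0 cG G0.
pose F (u : R) := c * u `^ q.
have F0 (u : R) : 0 < u -> 0 < F u by move=> u0; rewrite mulr_gt0// powR_gt0.
have Fincr (u v : R) : 0 < u -> 0 < v -> u < v -> F u < F v.
  move=> u0 v0 uv; rewrite ltr_pM2l//; apply: gt0_ltr_powR => //;
  by rewrite nnegrE ltW.
have dF (u : R) : 0 < u -> is_derive u 1 F (c * (q * u `^ (q - 1))).
  by move=> u0; have ? := is_derive_powR q u0; apply: is_deriveZ.
have F'E (u : R) : 0 < u -> (derive1 F) u = c * (q * u `^ (q - 1)).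
  by move=> u0; have [? <-] := dF _ u0; rewrite derive1E.
have cFF (x : R) : 0 < x -> {for x, continuous F}.
  move=> x0; apply: cvgM; first exact: cvg_cst.
  exact: continuous_powR.
have cF' (u : R) : 0 < u -> {for u, continuous (derive1 F)}.
  move=> u0; have : {for u, continuous (fun u => c * (q * u `^ (q - 1)))}.
    do 2 (apply: cvgM; first exact: cvg_cst); exact: continuous_powR.
  rewrite /prop_for /continuous_at F'E//; apply: cvg_trans.
  apply: near_eq_cvg; near=> z; rewrite F'E//; near: z.
  exact: lt_nbhsr.
pose a n := n.+1%:R^-1 : R; pose b n := n.+1%:R : R.
have a0 n : 0 < a n by rewrite invr_gt0.
have b0 n : 0 < b n by [].
have b1 n : 1 <= b n by rewrite ler1n.
have ab n : a n <= b n by rewrite (le_trans _ (b1 n))// /a invf_le1// ler1n.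
have alim : a @ \oo --> 0 by exact: cvg_harmonic.
have blim : b @ \oo --> +oo by exact: cvgr_natS.
have nia : nonincreasing_seq a by exact: invS_nonincreasing.
have ndb : nondecreasing_seq b by move=> n m nm; rewrite ler_nat ltnS.
have Fle (u v : R) : 0 < u -> u <= v -> F u <= F v.
  move=> u0; rewrite le_eqVlt => /predU1P[->//|uv].
  by apply/ltW/Fincr => //; exact: lt_trans uv.
have LHS : (\int[mu]_(u in `[F (a n), F (b n)]) (G u)%:E)%E @[n --> \oo]
    --> half_int G.
  apply: half_int_exhaust => //.
  - by move=> n; exact: F0.
  - by move=> n m nm; apply: Fle => //; exact: nia.
  - by move=> n m nm; apply: Fle => //; exact: ndb.
  - rewrite -[X in _ --> X](mulr0 c); apply: cvgM; first exact: cvg_cst.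
    apply: (@cvg_comp _ _ _ a (@powR R ^~ q) _ (0^'+)); last exact: powR_cvg0.
    by move=> A A0; have : \forall n \near \oo, 0 < a n -> A (a n) := alim _ A0; apply: filterS => n /(_ (a0 n)).
  - apply/cvgryPge => A; near=> n.
    have : ((`|A| + 1) / c) `^ q^-1 <= b n by near: n; exact: (cvgry_ge blim).
    move=> /(ge0_ler_powR (ltW q0)); rewrite !nnegrE => /(_ (powR_ge0 _ _) (ltW (b0 n))).
    have A0 : 0 <= (`|A| + 1) / c by rewrite divr_ge0 ?addr_ge0// ltW.
    rewrite -powRrM mulVf ?gt_eqF// powRr1// ler_pdivrMr// mulrC; apply: le_trans.
    by rewrite (le_trans (ler_norm A))// lerDl.
have RHS : (\int[mu]_(u in `[a n, b n])
    (G (F u) * (c * (q * u `^ (q - 1))))%:E)%E @[n --> \oo]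
    --> half_int (fun u => G (c * u `^ q) * (c * (q * u `^ (q - 1)))).
  apply: half_int_exhaust => //.
  - move=> x x0; apply: cvgM.
      exact: (continuous_comp (cFF _ x0) (cG _ (F0 _ x0))).
    do 2 (apply: cvgM; first exact: cvg_cst); exact: continuous_powR.
  - move=> x x0; rewrite mulr_ge0//; first exact: G0 (F0 _ x0).
    by rewrite mulr_ge0 ?(ltW c0)// mulr_ge0 ?powR_ge0// ltW.
apply: (cvg_unique (@ereal_hausdorff R) LHS).
apply: cvg_trans RHS; apply: near_eq_cvg; near=> n.
rewrite (@integration_by_substitution_increasing _ F G).
- apply: eq_integral => u; rewrite inE/= in_itv/= => /andP[au _].
  by rewrite fctE /= -F'E// (lt_le_trans _ au).
- exact: ab.
- move=> x y; rewrite !in_itv/= => /andP[ax _] /andP[ay _].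
  by apply: Fincr; [exact: lt_le_trans ax|exact: lt_le_trans ay].
- move=> x; rewrite !in_itv/= => /andP[ax _].
  by apply: cF'; exact: lt_trans ax.
- by apply/cvg_ex; exists ((derive1 F) (a n)); apply: cvg_at_right_filter; exact: cF'.
- by apply/cvg_ex; exists ((derive1 F) (b n)); apply: cvg_at_left_filter; exact: cF'.
- split.
  + move=> x; rewrite !in_itv/= => /andP[ax _].
    by have [|//] := dF x _; exact: lt_trans ax.
  + by apply: cvg_at_right_filter; exact: cFF.
  + by apply: cvg_at_left_filter; exact: cFF.
- by apply: within_cc_continuous => //; exact: F0.
Unshelve. all: by end_near. Qed.

End HalfLine.

(** * Euler's Gamma function on the positive reals *)

Section RealGamma.
Variable R : realType.

Definition gamma_density (s t : R) : R := t `^ (s - 1) * expR (- t).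

Definition rgamma : R -> R :=
  locked (fun s => Rintegral mu `]0, +oo[ (gamma_density s)).

Lemma gamma_density_ge0 (s t : R) : 0 <= gamma_density s t.
Proof. by rewrite mulr_ge0 ?powR_ge0// expR_ge0. Qed.

Lemma continuous_expRN (x : R) : {for x, continuous (fun t : R => expR (- t))}.
Proof. by apply: continuous_comp; [exact: continuousN|exact: continuous_expR]. Qed.

Lemma continuous_gamma_density (s x : R) : 0 < x ->
  {for x, continuous (gamma_density s)}.
Proof.
by move=> x0; apply: cvgM; [exact: continuous_powR|exact: continuous_expRN].
Qed.

Lemma gamma_density_succ (s t : R) : 0 < t ->
  gamma_density (s + 1) t = t * gamma_density s t.
Proof.
move=> t0; rewrite /gamma_density addrK mulrA; congr (_ * _).
rewrite -[in LHS](subrK 1 s) (@powRD _ _ (s - 1) 1) ?(gt_eqF t0) ?implybT//.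
by rewrite powRr1 ?ltW// mulrC.
Qed.

(** Half of the exponent is kept back, so that multiplying by e^(-t) still gives
    decay. *)
Lemma powR_le_expR (s : R) :
  exists2 C : R, 0 < C & forall t, 1 <= t -> t `^ s <= C * expR (t / 2).
Proof.
pose m := (Num.truncn `|s|).+1; exists (2 ^+ m * m`!%:R) => [|t t1].
  by rewrite mulr_gt0// ltr0n fact_gt0.
have t0 : 0 <= t by exact: le_trans t1.
have sm : s <= m%:R.
  by rewrite (le_trans (ler_norm s))// ltW// /m truncnS_gt.
rewrite (le_trans (ler_powR t1 sm))// powR_mulrn//.
have : 1 + (t / 2) ^+ m / m`!%:R <= expR (t / 2) by apply: expR_ge1Dxn; lra.
have : 0 < m`!%:R :> R by rewrite ltr0n fact_gt0.
move: (expR _) => E f0 h.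
have {h} : (t / 2) ^+ m <= E * m`!%:R by rewrite -ler_pdivrMr//; lra.
rewrite expr_div_n ler_pdivrMr ?exprn_gt0// => /le_trans; apply.
by rewrite le_eqVlt; apply/orP; left; apply/eqP; ring.
Qed.

Lemma cvg_powR_expRN (s : R) : t `^ s * expR (- t) @[t --> +oo] --> 0.
Proof.
have [C C0 hC] := powR_le_expR s.
have hlim : C * expR (- (t / 2)) @[t --> +oo] --> 0.
  rewrite -[X in _ --> X](mulr0 C); apply: cvgM; first exact: cvg_cst.
  apply: (@cvg_comp _ _ _ (fun t : R => t / 2) (fun t => expR (- t)) _ +oo);
    last exact: cvgr_expR.
  by apply: gt0_cvgMly => //; exact: cvg_id.
apply: (squeeze_cvgr _ (cvg_cst 0) hlim).
near=> t; rewrite mulr_ge0 ?powR_ge0 ?expR_ge0//=.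
have t1 : 1 <= t by near: t; exact: nbhs_pinfty_ge.
rewrite -ler_pdivlMr ?expR_gt0// -expRN opprK -mulrA -expRD.
rewrite (le_trans (hC t t1))// le_eqVlt; apply/orP; left; apply/eqP.
by congr (_ * expR _); field.
Unshelve. all: by end_near. Qed.

Let a n := n.+1%:R^-1 : R.
Let b n := n.+1%:R : R.
Let a0 n : 0 < a n. Proof. by rewrite invr_gt0. Qed.
Let ab n : a n <= b n.
Proof. by rewrite (@le_trans _ _ 1) ?/b ?ler1n// /a invf_le1// ler1n. Qed.
Let alim : a @ \oo --> 0. Proof. exact: cvg_harmonic. Qed.
Let blim : b @ \oo --> +oo. Proof. exact: cvgr_natS. Qed.

Lemma half_int_nat_exhaust (f : R -> R) :
  (forall x : R, 0 < x -> {for x, continuous f}) ->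
  (forall x : R, 0 < x -> 0 <= f x) ->
  (\int[mu]_(u in `[a n, b n]) (f u)%:E)%E @[n --> \oo] --> half_int f.
Proof.
move=> cf f0; apply: half_int_exhaust => //.
- exact: invS_nonincreasing.
- by move=> n m nm; rewrite ler_nat ltnS.
Qed.

Lemma is_derive_expRN (x : R) :
  is_derive x 1 (fun t : R => expR (- t)) (- expR (- x)).
Proof.
have h : is_derive x (1 : R) (fun t : R => - t) (- 1).
  exact: is_deriveN.
have := @is_derive1_comp R expR (fun t : R => - t) x _ _ (is_derive_expR _) h.
by rewrite mulrN1.
Qed.

Let FTCab (F f : R -> R) n :
  (forall x : R, 0 < x -> is_derive x 1 F (f x)) ->
  (forall x : R, 0 < x -> {for x, continuous f}) ->
  (\int[mu]_(u in `[a n, b n]) (f u)%:E)%E = (F (b n) - F (a n))%:E.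
Proof.
move=> dF cf.
have cF x : 0 < x -> {for x, continuous F}.
  move=> x0; apply/differentiable_continuous/derivable1_diffP.
  by have [] := dF x x0.
have := ab n; rewrite le_eqVlt => /predU1P[->|altb].
  by rewrite set_itv1 integral_set1 subrr.
rewrite (@continuous_FTC2 _ f F) => //.
- exact: within_cc_continuous.
- split.
  + move=> x; rewrite in_itv/= => /andP[ax _].
    by have [] := dF x (lt_trans (a0 n) ax).
  + by apply: cvg_at_right_filter; exact: cF.
  + by apply: cvg_at_left_filter; apply: cF; exact: lt_trans altb.
- move=> x; rewrite in_itv/= => /andP[ax _].
  by have [_ <-] := dF x (lt_trans (a0 n) ax); rewrite derive1E.
Qed.

Lemma half_int_expRN : half_int (fun t : R => expR (- t)) = 1%E.
Proof.
have h := half_int_nat_exhaust (fun x _ => @continuous_expRN x)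
  (fun x _ => expR_ge0 (- x)).
apply: (cvg_unique (@ereal_hausdorff R) h).
have -> : (fun n => \int[mu]_(u in `[a n, b n]) (expR (- u))%:E)%E =
    (fun n => (expR (- a n) - expR (- b n))%:E).
  have dF (x : R) : 0 < x ->
      is_derive x 1 (fun t => - expR (- t)) (expR (- x)).
    move=> x0; rewrite -[X in is_derive _ _ _ X]opprK.
    by apply: is_deriveN; exact: is_derive_expRN.
  apply/funext => n; rewrite (FTCab n dF (fun x _ => @continuous_expRN x)).
  by congr (_%:E); ring.
apply: cvg_EFin; first by apply: nearW.
rewrite [X in _ --> X](_ : _ = expR (- 0) - 0 :> R); last first.
  by rewrite oppr0 expR0 addr0.
apply: cvgB.
  exact: (cvg_comp _ _ alim (@continuous_expRN 0)).
exact: (cvg_comp _ _ blim (@cvgr_expR R)).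
Qed.

(** Integration by parts on [1/(n+1), n+1]; the boundary term t^s e^(-t)
    vanishes at both ends. The identity holds in the extended reals, so it
    carries finiteness from s + 1 down to s. *)
Lemma gamma_integral_rec (s : R) : 0 < s ->
  (s%:E * half_int (gamma_density s) = half_int (gamma_density (s + 1)))%E.
Proof.
move=> s0.
have h1 := half_int_nat_exhaust (@continuous_gamma_density (s + 1))
  (fun x _ => gamma_density_ge0 (s + 1) x).
have h0 := half_int_nat_exhaust (@continuous_gamma_density s)
  (fun x _ => gamma_density_ge0 s x).
have {}h0 := cvgeZl (y := s%:E) isT h0.
apply: (cvg_unique (@ereal_hausdorff R) h0).
pose F (t : R) := t `^ s * expR (- t).
have E n : (s%:E * \int[mu]_(u in `[a n, b n]) (gamma_density s u)%:E =
    \int[mu]_(u in `[a n, b n]) (gamma_density (s + 1) u)%:E +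
    (F (b n) - F (a n))%:E)%E.
  have intd r : mu.-integrable `[a n, b n] (EFin \o gamma_density r).
    apply: continuous_compact_integrable; first exact: segment_compact.
    by apply: within_cc_continuous => //; exact: continuous_gamma_density.
  have dF (x : R) : 0 < x ->
      is_derive x 1 F (s * gamma_density s x - gamma_density (s + 1) x).
    move=> x0; have d1 := is_derive_powR s x0.
    have d2 := is_derive_expRN x.
    have d3 := is_deriveM d1 d2.
    apply: is_derive_eq; rewrite /gamma_density addrK /GRing.scale/=; ring.
  have cf (x : R) : 0 < x ->
      {for x, continuous (fun t => s * gamma_density s t - gamma_density (s + 1) t)}.
    move=> x0; apply: cvgB; last exact: continuous_gamma_density.
    by apply: cvgM; [exact: cvg_cst|exact: continuous_gamma_density].
  rewrite -(FTCab n dF cf).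
  have I2 : mu.-integrable `[a n, b n]
      (fun x => (s * gamma_density s x - gamma_density (s + 1) x)%:E).
    exact: eq_integrable (integrableB _ (integrableZl _ s (intd s)) (intd (s + 1))).
  rewrite -(integralZl _ (intd s))// -(integralD _ (intd (s + 1)) I2)//.
  apply: eq_integral => x _ /=; rewrite -EFinD -EFinM; congr (_%:E).
  by rewrite addrC subrK.
rewrite /=; under eq_cvg do rewrite E.
rewrite -[half_int (gamma_density (s + 1))]adde0; apply: cvgeD => //.
  exact: fin_num_adde_defl.
apply: cvg_EFin; first by apply: nearW.
rewrite -[X in _ --> X](subrr 0); apply: cvgB.
  exact: (cvg_comp _ _ blim (cvg_powR_expRN s)).
rewrite [X in _ --> X](_ : _ = 0 * expR (- 0) :> R); last by rewrite mul0r.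
apply: cvgM.
  apply: (@cvg_comp _ _ _ a (@powR R ^~ s) _ (0^'+)); last exact: powR_cvg0.
  move=> A A0; have : \forall n \near \oo, 0 < a n -> A (a n) := @alim _ A0.
  by apply: filterS => n /(_ (a0 n)).
exact: (cvg_comp _ _ alim (@continuous_expRN 0)).
Qed.
End RealGamma.

Section RealGammaTheory.
Variable R : realType.
Notation gd := (@gamma_density R).
Notation g := (@rgamma R).

Lemma half_int_le (f h : R -> R) :
  measurable_fun `](0:R), +oo[ f -> measurable_fun `](0:R), +oo[ h ->
  (forall x : R, 0 < x -> 0 <= f x) -> (forall x : R, 0 < x -> f x <= h x) ->
  (half_int f <= half_int h)%E.
Proof.
move=> mf mh f0 fh; apply: ge0_le_integral => //.
- by move=> x /=; rewrite in_itv/= andbT lee_fin => /f0.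
- exact/measurable_EFinP.
- exact/measurable_EFinP.
- by move=> x /=; rewrite in_itv/= andbT lee_fin => /fh.
Qed.

Lemma measurable_gamma_density (s : R) : measurable_fun `](0:R), +oo[ (gd s).
Proof.
by apply: continuous_half_measurable => x; exact: continuous_gamma_density.
Qed.

Lemma half_int_ge0 (f : R -> R) : (forall x : R, 0 < x -> 0 <= f x) ->
  (0 <= half_int f)%E.
Proof.
move=> f0; apply: integral_ge0 => x /=.
by rewrite in_itv/= andbT lee_fin => /f0.
Qed.

Lemma half_intZ (k : R) (f : R -> R) : 0 <= k ->
  measurable_fun `](0:R), +oo[ f -> (forall x : R, 0 < x -> 0 <= f x) ->
  half_int (fun t => k * f t) = (k%:E * half_int f)%E.
Proof.
move=> k0 mf f0; rewrite /half_int -ge0_integralZl_EFin//.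
- by move=> x /=; rewrite in_itv/= andbT lee_fin => /f0.
- exact/measurable_EFinP.
Qed.

Lemma half_intD (f h : R -> R) :
  measurable_fun `](0:R), +oo[ f -> measurable_fun `](0:R), +oo[ h ->
  (forall x : R, 0 < x -> 0 <= f x) -> (forall x : R, 0 < x -> 0 <= h x) ->
  half_int (fun t => f t + h t) = (half_int f + half_int h)%E.
Proof.
move=> mf mh f0 h0; rewrite /half_int -ge0_integralD//.
- by move=> x /=; rewrite in_itv/= andbT lee_fin => /f0.
- exact/measurable_EFinP.
- by move=> x /=; rewrite in_itv/= andbT lee_fin => /h0.
- exact/measurable_EFinP.
Qed.

Lemma gamma_integral_nat (n : nat) :
  half_int (gd n.+1%:R) = n`!%:R%:E.
Proof.
elim: n => [|n IH].
  rewrite fact0 -half_int_expRN; apply: eq_integral => x.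
  by rewrite /gamma_density subrr powRr0 mul1r.
rewrite -[n.+2%:R]natr1 -gamma_integral_rec// IH -EFinM factS natrM.
by [].
Qed.

(** For s >= 1 the density is below the sum of two densities with natural
    parameters; the recurrence gives the remaining s. *)
Lemma gamma_integral_lty (s : R) : 0 < s -> (half_int (gd s) < +oo)%E.
Proof.
have big (r : R) : 1 <= r -> (half_int (gd r) < +oo)%E.
  move=> r1; pose m := Num.truncn r.
  have rm : r < m.+1%:R by exact: truncnS_gt.
  apply: (@le_lt_trans _ _ (half_int (fun t => gd 1 t + gd m.+1%:R t))).
    apply: half_int_le.
    - exact: measurable_gamma_density.
    - by apply: measurable_funD; exact: measurable_gamma_density.
    - by move=> x _; exact: gamma_density_ge0.
    - move=> x x0; rewrite /gamma_density -mulrDl ler_pM2r ?expR_gt0//.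
      have [x1|x1] := leP x 1.
        rewrite (@le_trans _ _ (x `^ (1 - 1)))// ?lerDl ?powR_ge0//.
        by apply: ger_powR; rewrite ?x0//; lra.
      rewrite (@le_trans _ _ (x `^ (m.+1%:R - 1)))// ?lerDr ?powR_ge0//.
      by apply: ler_powR; [exact: ltW|lra].
  rewrite half_intD.
  - by rewrite (gamma_integral_nat 0) gamma_integral_nat -EFinD ltry.
  - exact: measurable_gamma_density.
  - exact: measurable_gamma_density.
  - by move=> x _; exact: gamma_density_ge0.
  - by move=> x _; exact: gamma_density_ge0.
move=> s0; have : (half_int (gd (s + 1)) < +oo)%E by apply: big; lra.
rewrite -gamma_integral_rec//.
case: (half_int _) (half_int_ge0 (fun x _ => gamma_density_ge0 s x)) => [r _ _|_|//].
  exact: ltry.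
by rewrite gt0_muley ?lte_fin.
Qed.

Lemma rgammaE (s : R) : 0 < s -> (g s)%:E = half_int (gd s).
Proof.
move=> s0; rewrite /rgamma -lock /Rintegral fineK// ge0_fin_numE.
  exact: gamma_integral_lty.
by apply: half_int_ge0 => x _; exact: gamma_density_ge0.
Qed.

Lemma rgammaS (s : R) : 0 < s -> g (s + 1) = s * g s.
Proof.
move=> s0; apply: EFin_inj; rewrite EFinM !rgammaE ?gamma_integral_rec//.
by rewrite addr_gt0.
Qed.

Lemma rgamma_nat (n : nat) : g n.+1%:R = n`!%:R.
Proof. by apply: EFin_inj; rewrite rgammaE// gamma_integral_nat. Qed.

(** A null integral would make the density, positive on the half-line, vanish
    almost everywhere there. *)
Lemma rgamma_gt0 (s : R) : 0 < s -> 0 < g s.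
Proof.
move=> s0; have : 0 <= g s by rewrite -lee_fin rgammaE// half_int_ge0// => x _;
  exact: gamma_density_ge0.
rewrite le_eqVlt => /predU1P[g0|//].
have := rgammaE s0; rewrite -g0 => /esym h.
have mgd : measurable_fun `](0:R), +oo[ (EFin \o gd s).
  apply/measurable_EFinP; exact: measurable_gamma_density.
have [+ _] := ae_eq_integral_abs mu (measurable_itv _) mgd.
have -> : (\int[mu]_(x in `]0%R, +oo[) `|(EFin \o gd s) x| = 0)%E.
  transitivity (half_int (gd s)); last exact: h.
  apply: eq_integral => x _ /=.
  by rewrite ger0_norm// gamma_density_ge0.
move=> /(_ erefl) [N [mN N0 sN]].
have : (mu `]0%R, +oo[%classic <= mu N)%E.
  apply: le_measure; rewrite ?inE// => x /= xI; apply: sN => /= /(_ xI) /eqP.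
  rewrite eqe mulf_eq0 expR_eq0 orbF powR_eq0.
  by move: xI; rewrite in_itv/= andbT => /gt_eqF ->.
by rewrite N0 lebesgue_measure_itv/= ltry.
Qed.

(** The concave function t^a lies below its tangent at c. *)
Lemma young_powR (a c t : R) : 0 <= a -> a <= 1 -> 0 < c -> 0 < t ->
  t `^ a <= (1 - a) * c `^ a + a * c `^ (a - 1) * t.
Proof.
move=> a0 a1 c0 t0.
have ca : c `^ (a - 1) = c `^ a / c.
  by rewrite powRB ?(gt_eqF c0) ?implybT// powRr1// ltW.
have ta : t `^ a = c `^ a * (t / c) `^ a.
  rewrite -powRM ?(ltW c0) ?divr_ge0 ?ltW//; congr (_ `^ _).
  by rewrite mulrC divfK// gt_eqF.
rewrite ca ta.
have -> : (1 - a) * c `^ a + a * (c `^ a / c) * t =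
  c `^ a * (1 - a + a * (t / c)) by field; rewrite gt_eqF.
rewrite ler_pM2l ?powR_gt0//.
have x0 : 0 < t / c by rewrite divr_gt0.
move: (t / c) x0 => x x0.
have [->|aN0] := eqVneq a 0; first by rewrite powRr0 subr0 mul0r addr0.
have [->|aN1] := eqVneq a 1; first by rewrite powRr1 ?(ltW x0)// subrr add0r mul1r.
have a0' : 0 < a by rewrite lt_neqAle eq_sym aN0.
have a1' : 0 < 1 - a by rewrite subr_gt0 lt_neqAle aN1.
have := @conjugate_powR R (x `^ a) 1 a^-1 (1 - a)^-1 (powR_ge0 _ _) ler01.
rewrite !invr_gt0 => /(_ a0' a1'); rewrite !invrK addrC subrK => /(_ erefl).
rewrite mulr1 -powRrM mulfV// powRr1 ?(ltW x0)// powR1; lra.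
Qed.

(** Wendel's inequality: the tangent bound at c = x, integrated against the
    density of Gamma(x). *)
Lemma rgamma_shift_le (x a : R) : 0 < x -> 0 <= a -> a <= 1 ->
  g (x + a) <= x `^ a * g x.
Proof.
move=> x0 a0 a1; have xa0 : 0 < x + a by rewrite ltr_wpDr.
have x10 : 0 < x + 1 by rewrite addr_gt0.
suff : g (x + a) <= (1 - a) * x `^ a * g x + a * x `^ (a - 1) * g (x + 1).
  rewrite rgammaS// => /le_trans; apply; rewrite le_eqVlt; apply/orP; left.
  rewrite powRB ?(gt_eqF x0) ?implybT// powRr1 ?ltW//; apply/eqP; field.
  by rewrite gt_eqF.
set A : R := (1 - a) * x `^ a; set B : R := a * x `^ (a - 1).
have A0 : 0 <= A by rewrite mulr_ge0 ?powR_ge0// subr_ge0.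
have B0 : 0 <= B by rewrite mulr_ge0 ?powR_ge0.
rewrite -lee_fin rgammaE// EFinD (EFinM A) (EFinM B) !rgammaE//.
have -> : (A%:E * half_int (gd x) + B%:E * half_int (gd (x + 1)) =
    half_int (fun t => (A * gd x t + B * gd (x + 1) t)%R))%E.
  have mgd r := @measurable_gamma_density r.
  have gd0 r (t : R) : 0 < t -> 0 <= gd r t by move=> _; exact: gamma_density_ge0.
  rewrite half_intD ?half_intZ//; try exact: gd0; try exact: measurable_funM.
  - by move=> t t0; rewrite mulr_ge0 ?gd0.
  - by move=> t t0; rewrite mulr_ge0 ?gd0.
apply: half_int_le => //.
- exact: measurable_gamma_density.
- by apply: measurable_funD; apply: measurable_funM => //;
    exact: measurable_gamma_density.
- by move=> t _; exact: gamma_density_ge0.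
- move=> t t0; rewrite gamma_density_succ//.
  have -> : gd (x + a) t = t `^ a * gd x t.
    rewrite /gamma_density mulrA -powRD ?(gt_eqF t0) ?implybT//.
    by rewrite [a + _]addrC addrAC.
  rewrite mulrA -mulrDl ler_wpM2r ?gamma_density_ge0//.
  exact: young_powR.
Qed.

(** Wendel's upper bound from x + a to x + 1. *)
Lemma rgamma_shift_ge (x a : R) : 0 < x -> 0 <= a -> a <= 1 ->
  x * (x + a) `^ (a - 1) * g x <= g (x + a).
Proof.
move=> x0 a0 a1; have xa0 : 0 < x + a by rewrite ltr_wpDr.
have := @rgamma_shift_le (x + a) (1 - a) xa0.
have -> : x + a + (1 - a) = x + 1 by ring.
rewrite rgammaS// subr_ge0 => /(_ a1) h.
have -> : a - 1 = - (1 - a) by ring.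
rewrite powRN mulrAC ler_pdivrMr ?powR_gt0// mulrC [X in _ <= X]mulrC mulrC.
by apply: h; lra.
Qed.

End RealGammaTheory.

(** * The reciprocal Gamma function and Gauss's product *)

Section GaussProduct.
Variable R : realType.
Notation g := (@rgamma R).

Definition gamma_ratio (a x : R) : R := g (x + a) / (g x * x `^ a).

Lemma cvg_inv_pinfty : (x^-1 : R) @[x --> +oo] --> (0 : R).
Proof.
by apply/gtr0_cvgV0; [near=> x; near: x; exact: nbhs_pinfty_gt|exact: cvg_id].
Unshelve. all: by end_near. Qed.

Lemma cvg_shift_ratio (a : R) : ((x + a) / x : R) @[x --> +oo] --> (1 : R).
Proof.
have h : 1 + a * x^-1 @[x --> +oo] --> (1 : R).
  rewrite -[X in _ --> X]addr0; apply: cvgD; first exact: cvg_cst.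
  by rewrite -[X in _ --> X](mulr0 a); apply: cvgM; [exact: cvg_cst|exact: cvg_inv_pinfty].
apply: (cvg_near_eq _ h); near=> x.
have x0 : 0 < x by near: x; exact: nbhs_pinfty_gt.
by field; rewrite gt_eqF.
Unshelve. all: by end_near. Qed.

Lemma cvg_shift_ratioV (a : R) : (((x + a) / x)^-1 : R) @[x --> +oo] --> (1 : R).
Proof.
by rewrite -[1]invr1; apply: cvgV => //; exact: cvg_shift_ratio.
Qed.

Lemma gamma_ratioS (a x : R) : 0 < x -> 0 < x + a ->
  gamma_ratio (a + 1) x = gamma_ratio a x * ((x + a) / x).
Proof.
move=> x0 xa0; rewrite /gamma_ratio addrA rgammaS//.
rewrite (@powRD _ x a 1) ?(gt_eqF x0) ?implybT// powRr1 ?(ltW x0)//.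
have := rgamma_gt0 x0; have := powR_gt0 a x0.
move: (g (x + a)) (g x) (x `^ a) => A B C C0 B0.
by field; rewrite ?mulf_neq0 ?gt_eqF.
Qed.

Lemma cvg_gamma_ratioS (a : R) : gamma_ratio a x @[x --> +oo] --> (1 : R) <->
  gamma_ratio (a + 1) x @[x --> +oo] --> (1 : R).
Proof.
have r := @cvg_shift_ratio a; split=> h.
  have {}h : gamma_ratio a x * ((x + a) / x) @[x --> +oo] --> (1 : R).
    by rewrite -[X in _ --> X]mulr1; exact: cvgM.
  apply: (cvg_near_eq _ h).
  near=> x; rewrite [LHS]/= -gamma_ratioS//.
  by rewrite -ltrBlDr sub0r; near: x; apply: nbhs_pinfty_gt; exact: num_real.
have r' := @cvg_shift_ratioV a.
have {}h : gamma_ratio (a + 1) x * ((x + a) / x)^-1 @[x --> +oo] --> (1 : R).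
  by rewrite -[X in _ --> X]mulr1; exact: cvgM.
apply: (cvg_near_eq _ h).
near=> x.
have x0 : 0 < x by near: x; exact: nbhs_pinfty_gt.
have xa0 : 0 < x + a.
  by rewrite -ltrBlDr sub0r; near: x; apply: nbhs_pinfty_gt; exact: num_real.
by rewrite [LHS]/= gamma_ratioS// mulfK// mulf_neq0// ?invr_eq0 gt_eqF.
Unshelve. all: by end_near. Qed.

Lemma cvg_gamma_ratio01 (a : R) : 0 <= a -> a <= 1 ->
  gamma_ratio a x @[x --> +oo] --> (1 : R).
Proof.
move=> a0 a1.
have h := @cvg_shift_ratioV a.
apply: (squeeze_cvgr _ h (cvg_cst (1 : R))).
near=> x; have x0 : 0 < x by near: x; exact: nbhs_pinfty_gt.
have xa0 : 0 < x + a by rewrite ltr_wpDr.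
have gx := rgamma_gt0 x0; have px := powR_gt0 a x0.
apply/andP; split; last first.
  by rewrite /gamma_ratio ler_pdivrMr ?mulr_gt0// mul1r mulrC rgamma_shift_le.
rewrite [X in X <= _]/= invf_div /gamma_ratio ler_pdivlMr ?mulr_gt0//.
apply: le_trans (rgamma_shift_ge x0 a0 a1).
have key : x `^ a / (x + a) <= (x + a) `^ (a - 1).
  rewrite ler_pdivrMr// -[X in _ * X]powRr1 ?(ltW xa0)//.
  rewrite -powRD ?(gt_eqF xa0) ?implybT// subrK.
  by apply: ge0_ler_powR => //; rewrite ?nnegrE ?(ltW x0) ?(ltW xa0)// lerDl.
have -> : x / (x + a) * (g x * x `^ a) = x * (x `^ a / (x + a)) * g x by ring.
by rewrite ler_pM2r// ler_pM2l.
Unshelve. all: by end_near. Qed.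

(** For 0 <= a <= 1 Wendel's two bounds squeeze the ratio; the functional
    equation moves a by integers in both directions. *)
Theorem cvg_gamma_ratio (a : R) : gamma_ratio a x @[x --> +oo] --> (1 : R).
Proof.
have up (b : R) n : gamma_ratio b x @[x --> +oo] --> (1 : R) <->
    gamma_ratio (b + n%:R) x @[x --> +oo] --> (1 : R).
  elim: n => [|n IH]; first by rewrite addr0.
  by rewrite -natr1 addrA; apply: iff_trans IH _; exact: cvg_gamma_ratioS.
pose n := (Num.truncn `|a|).+1.
have an : `|a| < n%:R by exact: truncnS_gt.
apply: (up a n).2; pose m := Num.truncn (a + n%:R).
have an0 : 0 <= a + n%:R.
  by rewrite -lerBlDl sub0r (le_trans _ (ltW an))// lerNl lerNnormlW.
have /andP[m1 m2] := truncn_itv an0.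
rewrite -(subrK m%:R (a + n%:R)); apply: (up _ m).1; apply: cvg_gamma_ratio01.
  by rewrite subr_ge0.
by rewrite lerBlDl natr1 ltW.
Qed.

(** Reciprocal of the continued Gamma function on the whole real line: n is the
    least natural number making s + n positive, and the product vanishes exactly
    at the poles. *)
Definition rgamma_inv (s : R) : R :=
  let n := Num.truncn (1 - s) in (\prod_(j < n) (s + j%:R)) / g (s + n%:R).

Lemma rgamma_inv_trunc_gt0 (s : R) : 0 < s + (Num.truncn (1 - s))%:R.
Proof.
have := truncnS_gt (1 - s); rewrite -natr1; lra.
Qed.

Let prod_rgamma (s : R) (n k : nat) : 0 < s + n%:R ->
  (\prod_(j < n + k) (s + j%:R)) / g (s + (n + k)%:R) =
  (\prod_(j < n) (s + j%:R)) / g (s + n%:R).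
Proof.
move=> sn; elim: k => [|k IH]; first by rewrite addn0.
rewrite addnS big_ord_recr/= -natr1 addrA rgammaS; last first.
  by rewrite natrD addrA ltr_wpDr.
rewrite -IH; have sk : s + (n + k)%:R != 0.
  by rewrite gt_eqF// natrD addrA ltr_wpDr.
by rewrite invfM mulrA mulfK.
Qed.

(** Any admissible n may replace the least one. *)
Lemma rgamma_invE (n : nat) (s : R) : 0 < s + n%:R ->
  rgamma_inv s = (\prod_(j < n) (s + j%:R)) / g (s + n%:R).
Proof.
move=> sn; rewrite /rgamma_inv; set m := Num.truncn _.
have sm : 0 < s + m%:R by exact: rgamma_inv_trunc_gt0.
by rewrite -(prod_rgamma n sm) addnC prod_rgamma.
Qed.

Lemma rgamma_inv_gt0E (s : R) : 0 < s -> rgamma_inv s = (g s)^-1.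
Proof. by move=> s0; rewrite (@rgamma_invE 0) addr0// big_ord0 mul1r. Qed.

Lemma rgamma_invS (s : R) : rgamma_inv s = s * rgamma_inv (s + 1).
Proof.
pose n := Num.truncn (1 - (s + 1)).
have sn : 0 < s + 1 + n%:R by exact: rgamma_inv_trunc_gt0.
have E (j : nat) : s + j.+1%:R = s + 1 + j%:R by rewrite -addrA nat1r.
rewrite (rgamma_invE sn) (@rgamma_invE n.+1) ?E// big_ord_recl/= addr0.
rewrite mulrA; congr (_ * _ / _).
by apply: eq_bigr => i _; rewrite /bump leq0n add1n E.
Qed.

Definition gauss_product (s : R) (n : nat) : R :=
  n.+1%:R `^ (- s) * (\prod_(j < n.+1) (s + j%:R)) / n`!%:R.

(** For n + 1 > - s the product is exactly 1/Gamma(s) times Gamma(n + 1 + s) /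
    (Gamma(n + 1) (n + 1)^s), and the second factor tends to 1. *)
Theorem cvg_gauss_product (s : R) : gauss_product s n @[n --> \oo] --> rgamma_inv s.
Proof.
have h := cvg_comp _ _ (@cvgr_natS R) (@cvg_gamma_ratio s).
have {}h : rgamma_inv s * gamma_ratio s n.+1%:R @[n --> \oo] --> rgamma_inv s.
  by rewrite -[X in _ --> X]mulr1; apply: cvgM => //; exact: cvg_cst.
apply: (cvg_near_eq _ h); near=> n.
have sn : 0 < s + n.+1%:R.
  rewrite -ltrBlDl sub0r (@lt_le_trans _ _ n%:R) ?ler_nat//.
  near: n; exact: nbhs_infty_gtr.
rewrite [LHS]/= (rgamma_invE sn) /gamma_ratio /gauss_product rgamma_nat powRN.
have gs := rgamma_gt0 sn; rewrite [_ + s]addrC.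
have p0 : 0 < n.+1%:R `^ s by rewrite powR_gt0.
have f0 : 0 < n`!%:R :> R by rewrite ltr0n fact_gt0.
by field; rewrite !gt_eqF.
Unshelve. all: by end_near. Qed.

End GaussProduct.

(** * Bounds for Gauss's product that are uniform in the number of factors *)

Section GaussProductBound.
Variable R : realType.

Definition harmonic_sum (n : nat) : R := \sum_(j < n) j.+1%:R^-1.

Lemma ln_le_harmonic_sum (n : nat) : ln n.+1%:R <= harmonic_sum n.
Proof.
rewrite /harmonic_sum; elim: n => [|n IH]; first by rewrite big_ord0 ln1.
rewrite big_ord_recr/=.
have -> : n.+2%:R = n.+1%:R * (1 + n.+1%:R^-1) :> R.
  by rewrite mulrDr mulr1 mulfV// natr1.
rewrite lnM ?posrE ?addr_gt0 ?invr_gt0// lerD// le_ln1Dx//.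
by rewrite (@lt_trans _ _ 0) ?invr_gt0// ltrN10.
Qed.

Lemma harmonic_sum_le_ln (n : nat) : harmonic_sum n <= 1 + ln n.+1%:R.
Proof.
have H (k : nat) : harmonic_sum k.+1 <= 1 + ln k.+1%:R.
  rewrite /harmonic_sum; elim: k => [|k IH].
    by rewrite big_ord_recr big_ord0/= ln1 invr1 add0r addr0.
  rewrite big_ord_recr/= (le_trans (lerD IH (lexx _)))// -addrA lerD2l.
  have kk : k.+1%:R = k.+2%:R * (1 + - k.+2%:R^-1) :> R.
    by rewrite mulrDr mulr1 mulrN mulfV// -[in RHS]natr1 addrK.
  have h : k.+2%:R^-1 < 1 :> R by rewrite invf_lt1// ltr1n.
  rewrite {1}kk lnM ?posrE//; last by rewrite subr_gt0.
  rewrite -addrA gerDl -lerBrDr sub0r le_ln1Dx// ltrN2//.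
case: n => [|n]; first by rewrite /harmonic_sum big_ord0 ln1 addr0.
by rewrite (le_trans (H n))// lerD2l ler_ln ?posrE// ler_nat.
Qed.

Lemma bin_le_exp2 (n k : nat) : ('C(n, k) <= 2 ^ n)%N.
Proof.
elim: n k => [|n IH] [|k]; rewrite ?bin0 ?expn_gt0//.
by rewrite binS expnS mul2n -addnn leq_add.
Qed.

Lemma prod_binomial (m k : nat) :
  \prod_(j < k) (1 + m%:R / j.+1%:R) = ('C(m + k, k))%:R :> R.
Proof.
elim: k => [|k IH]; first by rewrite big_ord0 bin0.
rewrite big_ord_recr/= IH.
have h : k.+1%:R != 0 :> R by [].
apply: (mulIf h); rewrite -mulrA mulrDl mul1r divfK// -!natrM -natrD -natrM.
congr (_%:R); rewrite addnS mulnC [RHS]mulnC -mul_bin_diag/=.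
by rewrite addnC addnS.
Qed.

Lemma prod_le_of_ge1 (d : nat -> R) (n k : nat) :
  (forall j, 1 <= d j) -> \prod_(j < n) d j <= \prod_(j < n + k) d j.
Proof.
move=> d1; elim: k => [|k IH]; first by rewrite addn0.
rewrite addnS big_ord_recr/= (le_trans IH)// ler_peMr//.
by apply: prodr_ge0 => i _; rewrite (le_trans _ (d1 _)).
Qed.

Lemma gauss_productE (v : R) (n : nat) : gauss_product (- v) n =
  - v * (n.+1%:R `^ v * \prod_(j < n) (1 - v / j.+1%:R)).
Proof.
rewrite /gauss_product opprK big_ord_recl/= addr0.
have -> : \prod_(i < n) (- v + (bump 0 i)%:R) =
    n`!%:R * \prod_(j < n) (1 - v / j.+1%:R).
  elim: n => [|n IH]; first by rewrite !big_ord0 fact0 mulr1.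
  rewrite !big_ord_recr/= IH factS natrM /bump leq0n add1n.
  by field.
have f0 : n`!%:R != 0 :> R by rewrite pnatr_eq0 -lt0n fact_gt0.
by field.
Qed.

Definition gauss_bound (m : nat) : R :=
  m.+1%:R * (4 * expR 2 * m.+1%:R) ^+ m.+1.

(** The power (n + 1)^v is at most e^(m+1) times the product of the e^(v/(j+1)),
    by comparing the logarithm with harmonic sums. Absorbed in the product,
    these turn every factor with j >= m into e^(x) (1 - x) with x = v/(j+1) <=
    1, which lies in [0, 1]. Only the first m factors remain, hence a bound that
    is independent of n. *)
Lemma gauss_product_le (v : R) (m n : nat) : `|v| <= m.+1%:R ->
  `|gauss_product (- v) n| <= gauss_bound m.
Proof.
move=> vm; rewrite gauss_productE normrM normrN.
pose c j : R := (1 + m.+1%:R / j.+1%:R) * expR (m.+1%:R / j.+1%:R).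
(* c j bounds the factors of small index, 1 the others *)
pose d j : R := if (j < m)%N then c j else 1.
have c1 j : 1 <= c j.
  rewrite -[X in X <= _]mulr1; apply: ler_pM => //.
    by rewrite lerDl.
  by rewrite -[X in X <= _]expR0 ler_expR.
have d1 j : 1 <= d j by rewrite /d; case: ifP.
have pow_le : n.+1%:R `^ v <= expR m.+1%:R * \prod_(j < n) expR (v / j.+1%:R).
  rewrite -expR_sum -expRD /powR gt_eqF// ler_expR -mulr_sumr -/(harmonic_sum n).
  have h1 := ln_le_harmonic_sum n; have h2 := harmonic_sum_le_ln n.
  have [v0|v0] := leP 0 v.
    by rewrite (le_trans (ler_wpM2l v0 h1))// lerDr.
  have : v * (1 + ln n.+1%:R) <= v * harmonic_sum n by rewrite ler_wnM2l// ltW.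
  by move: vm; rewrite ltr0_norm// mulrDr mulr1; lra.
have prod_le : (\prod_(j < n) expR (v / j.+1%:R)) *
    `|\prod_(j < n) (1 - v / j.+1%:R)| <= \prod_(j < m) c j.
  rewrite normr_prod -big_split/=.
  apply: (@le_trans _ _ (\prod_(j < n) d j)).
    apply: ler_prod => j _; rewrite mulr_ge0 ?expR_ge0//= /d.
    case: ltnP => jm.
      rewrite /c mulrC; apply: ler_pM; rewrite ?expR_ge0//.
        rewrite (le_trans (ler_normB _ _))// normr1 lerD2l normrM.
        by rewrite normfV normr_nat ler_pM2r ?invr_gt0.
      by rewrite ler_expR ler_pM2r ?invr_gt0// (le_trans (ler_norm _)).
    have vj : v / j.+1%:R <= 1.
      rewrite ler_pdivrMr// mul1r (le_trans (ler_norm _))// (le_trans vm)//.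
      by rewrite ler_nat ltnS.
    rewrite ger0_norm ?subr_ge0// -ler_pdivlMl ?expR_gt0// mulr1 -expRN.
    exact: expR_ge1Dx.
  apply: (@le_trans _ _ (\prod_(j < n + m) d j)); first exact: prod_le_of_ge1.
  rewrite addnC big_split_ord/= [X in _ * X]big1 ?mulr1; last first.
    by move=> i _; rewrite /d ltnNge leq_addr.
  by rewrite le_eqVlt; apply/orP; left; apply/eqP/eq_bigr => i _; rewrite /d ltn_ord.
have c_le : \prod_(j < m) c j <= 4 ^+ m.+1 * (expR m.+1%:R * m.+1%:R ^+ m.+1).
  rewrite big_split/= prod_binomial -expR_sum -mulr_sumr -/(harmonic_sum m).
  apply: ler_pM; rewrite ?expR_ge0//.
    have -> : 4 ^+ m.+1 = (4 ^ m.+1)%N%:R :> R by rewrite natrX.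
    rewrite ler_nat (leq_trans (bin_le_exp2 _ _))// -[4%N]/(2 ^ 2)%N -expnM.
    by rewrite leq_exp2l// mul2n -addnn leq_add2l.
  rewrite -powR_mulrn// /powR gt_eqF// -expRD ler_expR -[X in X + _]mulr1 -mulrDr.
  by rewrite ler_pM2l// harmonic_sum_le_ln.
rewrite /gauss_bound; apply: ler_pM => //.
rewrite normrM (ger0_norm (powR_ge0 _ _)).
apply: (@le_trans _ _ (expR m.+1%:R * (4 ^+ m.+1 * (expR m.+1%:R * m.+1%:R ^+ m.+1)))).
  apply: le_trans (ler_wpM2r (normr_ge0 _) pow_le) _.
  by rewrite -mulrA ler_pM2l ?expR_gt0// (le_trans prod_le).
rewrite !exprMn -expRM_natr.
have -> : expR (2 * m.+1%:R) = expR m.+1%:R * expR m.+1%:R :> R.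
  by rewrite -expRD; congr expR; ring.
by rewrite le_eqVlt; apply/orP; left; apply/eqP; ring.
Qed.

Lemma geometric_dominated_of_eventually (b : nat -> R) :
  (forall n, 0 <= b n) -> (\forall n \near \oo, b n <= 2^-1 ^+ n) ->
  exists2 C, 0 < C & forall n, b n <= C * 2^-1 ^+ n.
Proof.
move=> b0 [N _ bN]; exists (1 + \sum_(k < N) b k * 2 ^+ k).
  by rewrite ltr_pwDl// sumr_ge0// => k _; rewrite mulr_ge0// exprn_ge0.
move=> n; have [Nn|nN] := leqP N n.
  rewrite (le_trans (bN n Nn))// ler_peMl ?exprn_ge0// lerDl.
  by rewrite sumr_ge0// => k _; rewrite mulr_ge0// exprn_ge0.
rewrite exprVn ler_pdivlMr ?exprn_gt0// (bigD1 (Ordinal nN))//=.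
have : 0 <= \sum_(i < N | i != Ordinal nN) b i * 2 ^+ i.
  by rewrite sumr_ge0// => k _; rewrite mulr_ge0// exprn_ge0.
lra.
Qed.

(** An m with |nu - rho * n| < m + 1, so that gauss_product_le applies with this
    m. *)
Definition wright_index (rho nu : R) (n : nat) : nat :=
  Num.truncn (rho * n%:R + `|nu|).

Lemma exp_fact_le (n : nat) : n%:R ^+ n <= n`!%:R * expR n%:R :> R.
Proof.
case: n => [|n]; first by rewrite expr0 fact0 expR0 mulr1.
have := @expR_ge1Dxn R n.+1%:R n (ler0n _ _).
have f0 : 0 < n.+1`!%:R :> R by rewrite ltr0n fact_gt0.
by move=> h; rewrite mulrC -ler_pdivrMr// (le_trans _ h)// lerDr.
Qed.

(** Up to geometric factors gauss_bound grows like n^(s n) for some s < 1,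
    because rho < 1, while n! is n^n up to a geometric factor. *)
Lemma wright_majorant (rho nu t : R) : 0 < rho < 1 -> 0 <= t ->
  exists2 C, 0 < C &
    forall n, t ^+ n / n`!%:R * gauss_bound (wright_index rho nu n)
      <= C * 2^-1 ^+ n.
Proof.
move=> /andP[rho0 rho1] t0; apply: geometric_dominated_of_eventually => [n|].
  by rewrite mulr_ge0// ?divr_ge0 ?exprn_ge0 ?mulr_ge0 ?expR_ge0.
(* strictly between rho and 1: m + 1 <= sg * n eventually, and n^(1 - sg) diverges *)
pose sg : R := (1 + rho) / 2; pose D : R := 4 * expR 2.
have D1 : 1 <= D.
  have : 1 <= expR 2 :> R by rewrite -[X in X <= _]expR0 ler_expR.
  by rewrite /D; lra.
have D0 : 0 < D by exact: lt_le_trans D1.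
have sg1 : 0 < 1 - sg by rewrite /sg; lra.
pose A : R := 4 * (t * expR 1 * D `^ sg).
have A0 : 0 <= A by rewrite !mulr_ge0 ?expR_ge0 ?powR_ge0.
near=> n; set m := wright_index rho nu n.
have n1 : 1 <= n%:R :> R by rewrite ler1n; near: n; exact: nbhs_infty_gt.
have n0 : 0 < n%:R :> R by exact: lt_le_trans n1.
have mn : m.+1%:R <= sg * n%:R.
  have : (`|nu| + 1) / (sg - rho) <= n%:R.
    near: n; exact: nbhs_infty_ger.
  rewrite ler_pdivrMr; last by rewrite /sg; lra.
  have /andP[+ _] : m%:R <= rho * n%:R + `|nu| < m.+1%:R.
    by apply: truncn_itv; rewrite addr_ge0// mulr_ge0 ?ltW.
  by rewrite -natr1; lra.
have An : A <= n%:R `^ (1 - sg).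
  have : A `^ (1 - sg)^-1 <= n%:R by near: n; exact: nbhs_infty_ger.
  move=> /(ge0_ler_powR (ltW sg1)); rewrite !nnegrE => /(_ (powR_ge0 _ _) (ltW n0)).
  by rewrite -powRrM mulVf ?gt_eqF// powRr1.
have sgn : sg * n%:R <= n%:R by rewrite ler_piMl ?(ltW n0)// /sg; lra.
have Dn1 : 1 <= D * n%:R by rewrite -[X in X <= _]mulr1 ler_pM.
have bound : gauss_bound m <= 2 ^+ n * ((D `^ sg) * n%:R `^ sg) ^+ n.
  apply: ler_pM => //.
    rewrite (le_trans mn)// (le_trans sgn)// -natrX ler_nat.
    exact/ltnW/ltn_expl.
  rewrite -/D (@le_trans _ _ ((D * n%:R) ^+ m.+1))//.
    apply: lerXn2r; rewrite ?nnegrE ?mulr_ge0 ?(ltW D0) ?(ltW n0)//.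
    by rewrite ler_pM2l// (le_trans mn).
  rewrite -powR_mulrn ?(le_trans ler01)// -powRM ?(ltW D0) ?(ltW n0)//.
  rewrite -powR_mulrn ?powR_ge0// -powRrM.
  exact: ler_powR.
apply: le_trans (ler_wpM2l _ bound) _.
  by rewrite divr_ge0// exprn_ge0.
have f0 : 0 < n`!%:R :> R by rewrite ltr0n fact_gt0.
have key : (4 * t * ((D `^ sg) * n%:R `^ sg)) ^+ n <= n`!%:R.
  have E : (4 * t * ((D `^ sg) * n%:R `^ sg)) = A * n%:R `^ sg / expR 1.
    by rewrite /A; field; rewrite gt_eqF// expR_gt0.
  have : A * n%:R `^ sg <= n%:R.
    rewrite -ler_pdivlMr ?powR_gt0//.
    by rewrite -[X in X / _]powRr1 ?(ltW n0)// -powRB ?(gt_eqF n0) ?implybT.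
  move=> h; rewrite E expr_div_n ler_pdivrMr ?exprn_gt0 ?expR_gt0//.
  rewrite -expRM_natr mul1r; apply: le_trans (exp_fact_le n).
  by rewrite lerXn2r ?nnegrE ?mulr_ge0 ?powR_ge0 ?(ltW n0).
have E2 : 2^-1 ^+ n = 2 ^+ n * 4^-1 ^+ n :> R.
  by rewrite -exprMn; congr (_ ^+ _); field.
have -> : 2^-1 ^+ n = n`!%:R^-1 * 2 ^+ n * 4^-1 ^+ n * n`!%:R :> R.
  rewrite E2; move: (2 ^+ n) (4^-1 ^+ n) => u v.
  by field; rewrite gt_eqF.
have -> : t ^+ n / n`!%:R * (2 ^+ n * (D `^ sg * n%:R `^ sg) ^+ n) =
   n`!%:R^-1 * 2 ^+ n * 4^-1 ^+ n * (4 * t * ((D `^ sg) * n%:R `^ sg)) ^+ n.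
  rewrite [(4 * t * _) ^+ n]exprMn [(4 * t) ^+ n]exprMn exprVn.
  have : 4 ^+ n != 0 :> R by rewrite expf_neq0.
  move: (t ^+ n) (2 ^+ n) (4 ^+ n) ((_ * _) ^+ n) => u v w z w0.
  by field; rewrite w0 gt_eqF.
by rewrite ler_wpM2l// mulr_ge0 ?exprn_ge0// mulr_ge0 ?exprn_ge0 ?invr_ge0.
Unshelve. all: by end_near. Qed.

End GaussProductBound.

Lemma cvg_sumr (R : realType) (T I : Type) (F : set_system T) {FF : Filter F}
    (r : seq I) (f : I -> T -> R) (l : I -> R) :
  (forall i, f i x @[x --> F] --> l i) ->
  \sum_(i <- r) f i x @[x --> F] --> \sum_(i <- r) l i.
Proof.
move=> fl; apply: cvg_big => // x.
exact: add_continuous.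
Qed.

(** * Wright's function as a limit of exponential polynomials *)

Section Tannery.
Variable R : realType.

Lemma series_tail_le (C : R) (v : nat -> R) (m n : nat) : 0 <= C ->
  (forall k, `|v k| <= C * 2^-1 ^+ k) -> (m <= n)%N ->
  `|series v n - series v m| <= 2 * C * 2^-1 ^+ m.
Proof.
move=> C0 vC mn; rewrite sub_series_geq// (le_trans (ler_norm_sum _ _ _))//.
suff : \sum_(m <= k < n) C * 2^-1 ^+ k <= 2 * C * 2^-1 ^+ m.
  by apply: le_trans; apply: ler_sum => k _.
suff -> : \sum_(m <= k < n) C * 2^-1 ^+ k = 2 * C * (2^-1 ^+ m - 2^-1 ^+ n).
  by rewrite ler_wpM2l ?mulr_ge0// gerBl exprn_ge0// invr_ge0.
elim: n mn => [|n IH]; first by rewrite leqn0 => /eqP ->; rewrite big_geq// subrr mulr0.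
rewrite leq_eqVlt => /predU1P[->|]; first by rewrite big_geq// subrr mulr0.
rewrite ltnS => mn; rewrite big_nat_recr//= IH// exprS.
by field.
Qed.

Lemma dominated_series_cvg (C : R) (v : nat -> R) : 0 <= C ->
  (forall k, `|v k| <= C * 2^-1 ^+ k) -> cvgn (series v).
Proof.
move=> C0 vC; apply: normed_cvg; apply: series_le_cvg vC _ => //.
- by move=> n; rewrite mulr_ge0// exprn_ge0// invr_ge0.
- apply: is_cvg_geometric_series; rewrite ger0_norm ?invr_ge0//.
  by rewrite invf_lt1// ltr1n.
Qed.

Lemma dominated_series_lim_le (C : R) (v : nat -> R) (s : R) (m : nat) : 0 <= C ->
  (forall k, `|v k| <= C * 2^-1 ^+ k) -> series v @ \oo --> s ->
  `|s - series v m| <= 2 * C * 2^-1 ^+ m.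
Proof.
move=> C0 vC vs.
have h : `|series v n - series v m| @[n --> \oo] --> `|s - series v m|.
  by apply: cvg_norm; apply: cvgB => //; exact: cvg_cst.
apply: (cvgr_to_le h); near=> n; apply: series_tail_le => //.
near: n; exact: nbhs_infty_ge.
Unshelve. all: by end_near. Qed.

(** The tails beyond an index m are small for all N at once; the first m terms
    are finitely many limits. *)
Theorem tannery (C : R) (u : nat -> nat -> R) (v : nat -> R) (S : nat -> R)
    (s : R) : 0 <= C ->
  (forall N k, `|u N k| <= C * 2^-1 ^+ k) ->
  (forall k, u N k @[N --> \oo] --> v k) ->
  (forall N, series (u N) @ \oo --> S N) -> series v @ \oo --> s ->
  S @ \oo --> s.
Proof.
move=> C0 uC uv uS vs.
have vC k : `|v k| <= C * 2^-1 ^+ k.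
  have h : `|u N k| @[N --> \oo] --> `|v k| by exact: cvg_norm (uv k).
  by apply: (cvgr_to_le h); apply: nearW => N; exact: uC.
apply/cvgrPdist_le => e e0.
have D0 : 0 < 2 * C + 1 by rewrite ltr_wpDl// mulr_ge0.
have e3 : 0 < e / 3 by rewrite divr_gt0.
have [m _ Hm] : \forall m \near \oo, (2 * C + 1) * 2^-1 ^+ m <= e / 3.
  have h : (2 * C + 1) * 2^-1 ^+ m @[m --> \oo] --> 0.
    have := @cvg_geometric R (2 * C + 1) 2^-1.
    by apply; rewrite ger0_norm ?invr_ge0// invf_lt1// ltr1n.
  exact: (cvgr_le _ h).
have {}Hm : 2 * C * 2^-1 ^+ m <= e / 3.
  by rewrite (le_trans _ (Hm m (leqnn m)))// ler_wpM2r ?exprn_ge0 ?invr_ge0// lerDl.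
have hf : series (u N) m @[N --> \oo] --> series v m.
  by rewrite /series/=; apply: cvg_sumr => i; exact: uv.
have : \forall N \near \oo, `|series v m - series (u N) m| <= e / 3.
  by move/cvgrPdist_le : hf => /(_ _ e3).
apply: filterS => N hN.
have h1 := dominated_series_lim_le m C0 vC vs.
have h2 := dominated_series_lim_le m C0 (uC N) (uS N).
have -> : s - S N = (s - series v m) + (series v m - series (u N) m)
    - (S N - series (u N) m) by ring.
rewrite (le_trans (ler_normB _ _))//.
rewrite (le_trans (lerD (ler_normD _ _) (lexx _)))//.
move: h1 h2 hN Hm; move: `|_ - _| `|_ - _| `|_ - _| => x y z.
lra.
Qed.

End Tannery.

Section Approximants.
Variable R : realType.
Variables rho nu : R.

(** Coordinates of prod_(j < K) (nu - rho * n + j), as a polynomial in n, in the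
    basis (-1)^k n (n - 1) ... (n - k + 1). Multiplying by the next factor gives
    the recurrence. Against this basis the exponential series sums in closed
    form. *)
Fixpoint apx_coef (K k : nat) : R :=
  if K is K'.+1 then
    (nu + K'%:R - rho * k%:R) * apx_coef K' k +
    (if k is k'.+1 then rho * apx_coef K' k' else 0)
  else (k == 0%N)%:R.

Lemma apx_coef_gt (K k : nat) : (K < k)%N -> apx_coef K k = 0.
Proof.
elim: K k => [|K IH] [|k]//= Kk.
by rewrite !IH ?mulr0 ?addr0// ltnW.
Qed.

(** Only indices k <= K occur at stage K, and then nu + K - rho * k >= 0 since
    rho <= 1. *)
Lemma apx_coef_ge0 (K k : nat) : 0 <= rho -> rho <= 1 -> 0 <= nu ->
  0 <= apx_coef K k.
Proof.
move=> rho0 rho1 nu0; elim: K k => [|K IH] k /=; first by rewrite ler0n.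
apply: addr_ge0; last by case: k => [|k]//; rewrite mulr_ge0.
have [kK|Kk] := leqP k K; last by rewrite apx_coef_gt// mulr0.
rewrite mulr_ge0// subr_ge0 (@le_trans _ _ K%:R) ?lerDr//.
by rewrite (le_trans (ler_wpM2l rho0 (_ : k%:R <= K%:R)))// ?ler_nat// ler_piMl.
Qed.

(** Only the recurrence of the basis elements matters. With w_k = (-1)^k n (n -
    1) ... (n - k + 1) and X = - n this is the defining expansion; with w_k =
    Gamma(X + k) it evaluates the moments. *)
Lemma apx_coef_sum (X : R) (w : nat -> R) (K : nat) :
  (forall k, w k.+1 = (X + k%:R) * w k) ->
  \sum_(k < K.+1) apx_coef K k * w k =
  w 0%N * \prod_(j < K) (nu + rho * X + j%:R).
Proof.
move=> wS; elim: K => [|K IH].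
  by rewrite big_ord_recr !big_ord0/= mul1r add0r mulr1.
rewrite [in RHS]big_ord_recr/= mulrA -IH [in RHS]big_distrl/=.
under eq_bigr do rewrite mulrDl.
rewrite big_split/= big_ord_recr/= (apx_coef_gt (ltnSn K)) mulr0 mul0r addr0.
rewrite [X in _ + X]big_ord_recl/= mul0r add0r -big_split/=.
apply: eq_bigr => k _; rewrite /bump leq0n add1n wS; ring.
Qed.

(** The falling factorial shifts the exponential series by k places. *)
Lemma cvg_exp_ffact (y : R) (k : nat) :
  series (fun n => (- y) ^+ n / n`!%:R * ((-1) ^+ k * (n ^_ k)%:R)) @ \oo -->
  expR (- y) * y ^+ k.
Proof.
have h : series (exp_coeff (- y)) @ \oo --> expR (- y).
  exact: is_cvg_series_exp_coeff.
have {}h : y ^+ k * series (exp_coeff (- y)) n @[n --> \oo] --> expR (- y) * y ^+ k.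
  by rewrite [X in _ --> X]mulrC; apply: cvgM => //; exact: cvg_cst.
rewrite -(cvg_shiftn k) /=; apply: cvg_trans h; apply: near_eq_cvg.
apply: nearW => n; rewrite /series/=; apply/esym; rewrite [(n + k)%N]addnC /index_iota !subn0 iotaD big_cat/=.
rewrite big1_seq ?add0r; last first.
  move=> i; rewrite mem_iota add0n => /andP[_ /andP[_ ik]].
  by rewrite ffact_small// !mulr0.
rewrite add0n -[X in iota X]addn0 iotaDl big_map/= big_distrr/=.
apply: eq_bigr => i _.
have -> : (k + i)`!%:R = ((k + i) ^_ k)%:R * i`!%:R :> R.
  by rewrite -natrM -(ffact_fact (leq_addr i k)) addKn.
have f0 : ((k + i) ^_ k)%:R != 0 :> R.
  by rewrite pnatr_eq0 -lt0n ffact_gt0 leq_addr.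
have i0 : i`!%:R != 0 :> R by rewrite pnatr_eq0 -lt0n fact_gt0.
have -> : (- y) ^+ (k + i) = (-1) ^+ k * y ^+ k * (- y) ^+ i.
  by rewrite exprD [in LHS]exprNn.
have s1 : (-1) ^+ k * (-1) ^+ k = 1 :> R by rewrite -exprMn mulrNN mulr1 expr1n.
rewrite /exp_coeff/=.
transitivity ((-1) ^+ k * (-1) ^+ k * (y ^+ k * ((- y) ^+ i / i`!%:R))).
  by field; rewrite f0 i0.
by rewrite s1 mul1r.
Qed.

(** The Wright series with 1/Gamma(nu - rho * n) replaced by Gauss's product of
    N + 1 factors, summed in closed form in terms of y = t * (N + 1)^rho. *)
Definition wright_apx (N : nat) (t : R) : R :=
  N.+1%:R `^ (- nu) / N`!%:R *
  (\sum_(k < N.+2) apx_coef N.+1 k *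
    (expR (- (t * N.+1%:R `^ rho)) * (t * N.+1%:R `^ rho) ^+ k)).

Lemma wright_apx_ge0 (N : nat) (t : R) : 0 <= rho -> rho <= 1 -> 0 <= nu ->
  0 <= t -> 0 <= wright_apx N t.
Proof.
move=> rho0 rho1 nu0 t0; rewrite mulr_ge0 ?divr_ge0 ?powR_ge0//.
apply: sumr_ge0 => k _; rewrite mulr_ge0 ?apx_coef_ge0// mulr_ge0 ?expR_ge0//.
by rewrite exprn_ge0// mulr_ge0// powR_ge0.
Qed.

(** The factor (N + 1)^(rho * n) of Gauss's product turns t^n into y^n; what
    remains is expanded in falling factorials of n. *)
Lemma cvg_wright_apx (N : nat) (t : R) :
  series (fun n => (- t) ^+ n / n`!%:R * gauss_product (nu - rho * n%:R) N)
    @ \oo --> wright_apx N t.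
Proof.
set y := t * N.+1%:R `^ rho; set A := N.+1%:R `^ (- nu) / N`!%:R.
have E : series (fun n => (- t) ^+ n / n`!%:R * gauss_product (nu - rho * n%:R) N)
  = (fun m => A * \sum_(k < N.+2) apx_coef N.+1 k *
      series (fun n => (- y) ^+ n / n`!%:R * ((-1) ^+ k * (n ^_ k)%:R)) m).
  apply/funext => m; rewrite /series/=.
  under [in RHS]eq_bigr do rewrite big_distrr/=.
  rewrite exchange_big/= big_distrr/=; apply: eq_bigr => n _.
  have S := @apx_coef_sum (- n%:R) (fun k => (-1) ^+ k * (n ^_ k)%:R) N.+1.
  transitivity (A * ((- y) ^+ n / n`!%:R *
      \sum_(k < N.+2) apx_coef N.+1 k * ((-1) ^+ k * (n ^_ k)%:R))); last first.
    by congr (_ * _); rewrite big_distrr/=; apply: eq_bigr => k _; ring.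
  rewrite S; last first.
    move=> k; rewrite exprS ffactnSr natrM.
    have [kn|nk] := leqP k n; first by rewrite natrB//; ring.
    by rewrite ffact_small// !(mulr0, mul0r).
  rewrite expr0 ffactn0 !mul1r /gauss_product.
  have -> : - (nu - rho * n%:R) = - nu + rho * n%:R by ring.
  rewrite powRD ?pnatr_eq0 ?implybT// powRrM powR_mulrn ?powR_ge0//.
  rewrite -[- y]mulNr exprMn mulrN /A.
  by move: (\prod_(_ < _) _) => P; ring.
rewrite E /wright_apx -/y -/A; apply: cvgM; first exact: cvg_cst.
apply: cvg_sumr => k; apply: cvgM; first exact: cvg_cst.
exact: cvg_exp_ffact.
Qed.

End Approximants.

Section WrightSeries.
Variable R : realType.

Definition wright_term (rho nu t : R) (n : nat) : R :=
  (- t) ^+ n / n`!%:R * rgamma_inv (nu - rho * n%:R).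

Definition rwright : R -> R -> R -> R :=
  locked (fun rho nu t => limn (series (wright_term rho nu t))).

Variables rho nu : R.
Hypothesis rho01 : 0 < rho < 1.

(** One geometric majorant serves all the Gauss products and hence, in the
    limit, 1/Gamma. *)
Lemma wright_dominated (T : R) : 0 <= T -> exists2 C, 0 < C &
  forall t, 0 <= t <= T ->
  (forall N n, `|(- t) ^+ n / n`!%:R * gauss_product (nu - rho * n%:R) N|
     <= C * 2^-1 ^+ n) /\
  (forall n, `|wright_term rho nu t n| <= C * 2^-1 ^+ n).
Proof.
move=> T0; have [C C0 hC] := wright_majorant nu rho01 T0.
exists C => // t /andP[t0 tT].
have h N n : `|(- t) ^+ n / n`!%:R * gauss_product (nu - rho * n%:R) N|
     <= C * 2^-1 ^+ n.
  apply: le_trans (hC n); rewrite normrM; apply: ler_pM => //.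
    rewrite normrM normfV normr_nat normrX normrN ger0_norm//.
    by rewrite ler_pM2r ?invr_gt0 ?ltr0n ?fact_gt0// lerXn2r.
  rewrite -[X in gauss_product X]opprK opprB; apply: gauss_product_le.
  have /andP[rho0 _] := rho01.
  rewrite (le_trans (ler_normB _ _))// ger0_norm ?mulr_ge0// 1?ltW//.
  by rewrite truncnS_gt.
split=> [//|n].
have hl := cvgM (cvg_cst ((- t) ^+ n / n`!%:R)) (@cvg_gauss_product R (nu - rho * n%:R)).
have {}hl : `|(- t) ^+ n / n`!%:R * gauss_product (nu - rho * n%:R) N|
   @[N --> \oo] --> `|wright_term rho nu t n|.
  by apply: cvg_norm; exact: hl.
by apply: (cvgr_to_le hl); apply: nearW => N.
Qed.

Lemma cvg_rwright (t : R) : 0 <= t ->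
  series (wright_term rho nu t) @ \oo --> rwright rho nu t.
Proof.
move=> t0; have [C C0 /(_ t) []] := wright_dominated t0; first by rewrite t0 lexx.
by move=> _ h; rewrite /rwright -lock; apply: (dominated_series_cvg (ltW C0) h).
Qed.

Theorem cvg_wright_apx_rwright (t : R) : 0 <= t ->
  wright_apx rho nu N t @[N --> \oo] --> rwright rho nu t.
Proof.
move=> t0; have [C C0 /(_ t) []] := wright_dominated t0; first by rewrite t0 lexx.
move=> h1 h2; apply: (tannery (ltW C0) h1 _ _ (cvg_rwright t0)).
  move=> k; apply: cvgM; first exact: cvg_cst.
  exact: cvg_gauss_product.
by move=> N; exact: cvg_wright_apx.
Qed.

Lemma wright_apx_bounded (T : R) : 0 <= T -> exists2 B, 0 < B &
  forall N t, 0 <= t <= T -> `|wright_apx rho nu N t| <= B.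
Proof.
move=> T0; have [C C0 hC] := wright_dominated T0.
exists (2 * C) => [|N t tT]; first by rewrite mulr_gt0.
have [h _] := hC t tT.
have := dominated_series_lim_le 0 (ltW C0) (h N) (@cvg_wright_apx R rho nu N t).
by rewrite /series/= big_geq// subr0 expr0 mulr1.
Qed.

End WrightSeries.

(** * Moments of Wright's function in the positive case *)

Section HalfIntSum.
Variable R : realType.

Lemma half_int_sum (n : nat) (c : nat -> R) (f : nat -> R -> R) (r : nat -> R) :
  (forall k, 0 <= c k) ->
  (forall k, measurable_fun `](0:R), +oo[ (f k)) ->
  (forall k (u : R), 0 < u -> 0 <= f k u) ->
  (forall k, half_int (f k) = (r k)%:E) ->
  half_int (fun u => \sum_(k < n) c k * f k u) = (\sum_(k < n) c k * r k)%:E.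
Proof.
move=> c0 mf f0 fr; elim: n => [|n IH].
  rewrite big_ord0 /half_int; under eq_integral do rewrite big_ord0.
  exact: integral0.
rewrite big_ord_recr/= EFinD -IH EFinM -fr -half_intZ//; last exact: f0.
rewrite -half_intD.
- by rewrite /half_int; apply: eq_integral => u _; rewrite big_ord_recr.
- by apply: measurable_sum => k; apply: measurable_funM.
- exact: measurable_funM.
- by move=> u u0; rewrite sumr_ge0// => k _; rewrite mulr_ge0 ?f0.
- by move=> u u0; rewrite mulr_ge0 ?f0.
Qed.

Lemma eq_half_int (f h : R -> R) : (forall u : R, 0 < u -> f u = h u) ->
  half_int f = half_int h.
Proof.
move=> fh; apply: eq_integral => u; rewrite inE/= in_itv/= andbT => u0.
by rewrite fh.
Qed.

End HalfIntSum.

Lemma measurable_gamma_density_setT (R : realType) (s : R) :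
  measurable_fun [set: R] (gamma_density s).
Proof.
apply: measurable_funM; first exact: measurable_powR.
by apply: measurableT_comp => //; exact: measurable_expR.
Qed.

Section WrightMoments.
Variable R : realType.
Variables (rho nu kap : R).
Hypothesis kap0 : 0 < kap.
Notation q := kap^-1.
Let q0 : 0 < q. Proof. by rewrite invr_gt0. Qed.

(** Euler's integral under the substitution t = c * u ^ q. *)
Lemma stretched_exp_integral (p c : R) : 0 < p -> 0 < c ->
  half_int (fun u => u `^ (p - 1) * expR (- (c * u `^ q))) =
  (kap * c `^ (- (kap * p)) * rgamma (kap * p))%:E.
Proof.
move=> p0 c0; have kp0 : 0 < kap * p by rewrite mulr_gt0.
have S := @half_int_powR_subst R c q (gamma_density (kap * p)) c0 q0
  (@continuous_gamma_density R _) (fun x _ => gamma_density_ge0 _ x).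
rewrite -rgammaE// in S.
rewrite EFinM S -half_intZ.
- apply: eq_half_int => u u0; rewrite /gamma_density.
  rewrite (powRM _ (ltW c0) (powR_ge0 _ _)).
  have -> : (u `^ q) `^ (kap * p - 1) = u `^ (p - q).
    by rewrite -powRrM; congr (_ `^ _); field; rewrite gt_eqF.
  have -> : u `^ (p - 1) = u `^ (p - q) * u `^ (q - 1).
    by rewrite -powRD ?(gt_eqF u0) ?implybT//; congr (_ `^ _); ring.
  have -> : c `^ (kap * p - 1) = c `^ (kap * p) / c.
    by rewrite powRB ?(gt_eqF c0) ?implybT// powRr1 ?(ltW c0).
  rewrite powRN; have cp : 0 < c `^ (kap * p) by rewrite powR_gt0.
  by field; rewrite !gt_eqF.
- by rewrite mulr_ge0 ?powR_ge0 ?ltW.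
- apply: measurable_funM.
    apply: (measurableT_comp (@measurable_gamma_density_setT R _)).
    apply: measurable_funM => //; apply: measurable_funTS; exact: measurable_powR.
  do 2 apply: measurable_funM => //.
  apply: measurable_funTS; exact: measurable_powR.
- move=> u u0; rewrite mulr_ge0 ?gamma_density_ge0// ?mulr_ge0 ?powR_ge0//.
  + exact: ltW.
  + exact: ltW.
Qed.

Lemma measurable_rpow (D : set R) (p : R) :
  measurable_fun D (fun u : R => u `^ p).
Proof. by apply: measurable_funTS; exact: measurable_powR. Qed.

Lemma measurable_wright_apx (D : set R) (N : nat) :
  measurable_fun D (fun u => wright_apx rho nu N (u `^ q)).
Proof.
rewrite /wright_apx; apply: measurable_funM => //.
apply: measurable_sum => k; apply: measurable_funM => //; apply: measurable_funM.
  apply: measurableT_comp => //; apply: measurableT_comp => //.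
  by apply: measurable_funM => //; exact: measurable_rpow.
by apply: measurable_funX; apply: measurable_funM => //; exact: measurable_rpow.
Qed.

Hypothesis rho01 : 0 < rho < 1.

(** Each term is a stretched exponential integral with value proportional to
    Gamma(kap * p + k); apx_coef_sum folds the sum back into a Gauss product. *)
Lemma wright_apx_moment (N : nat) (p : R) : 0 <= nu -> 0 < p ->
  half_int (fun u => u `^ (p - 1) * wright_apx rho nu N (u `^ q)) =
  (kap * rgamma (kap * p) * gauss_product (nu + rho * (kap * p)) N)%:E.
Proof.
move=> nu0 p0; have kp0 : 0 < kap * p by rewrite mulr_gt0.
have /andP[rho0 rho1] := rho01.
pose L : R := N.+1%:R `^ rho; have L0 : 0 < L by rewrite powR_gt0.
pose A : R := N.+1%:R `^ (- nu) / N`!%:R.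
have A0 : 0 <= A by rewrite divr_ge0 ?powR_ge0.
pose f k (u : R) := u `^ (p + k%:R / kap - 1) * expR (- (L * u `^ q)).
pose r k := kap * L `^ (- (kap * (p + k%:R / kap))) * rgamma (kap * (p + k%:R / kap)).
transitivity (half_int (fun u =>
    \sum_(k < N.+2) (A * apx_coef rho nu N.+1 k * L ^+ k) * f k u)).
  apply: eq_half_int => u u0; rewrite /wright_apx -/L -/A mulrCA !big_distrr/=.
  apply: eq_bigr => k _; rewrite /f [u `^ q * L]mulrC exprMn.
  rewrite -[(u `^ q) ^+ k]powR_mulrn ?powR_ge0// -powRrM.
  have -> : u `^ (p + k%:R / kap - 1) = u `^ (p - 1) * u `^ (q * k%:R).
    by rewrite -powRD ?(gt_eqF u0) ?implybT//; congr (_ `^ _); ring.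
  ring.
rewrite (@half_int_sum _ N.+2 (fun k => A * apx_coef rho nu N.+1 k * L ^+ k) f r).
- congr (_%:E).
  have S := @apx_coef_sum R rho nu (kap * p)
    (fun k => rgamma (kap * p + k%:R)) N.+1.
  transitivity (A * kap * L `^ (- (kap * p)) *
    \sum_(k < N.+2) apx_coef rho nu N.+1 k * rgamma (kap * p + k%:R)).
    rewrite big_distrr/=; apply: eq_bigr => k _; rewrite /r.
    have -> : kap * (p + k%:R / kap) = kap * p + k%:R by field; rewrite gt_eqF.
    rewrite opprD powRD ?(gt_eqF L0) ?implybT// powR_invn ?(ltW L0)//.
    have Lk : L ^+ k != 0 by rewrite expf_neq0// gt_eqF.
    by field.
  rewrite S; last first.
    by move=> k; rewrite -natr1 addrA rgammaS// ltr_wpDr.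
  rewrite addr0 /gauss_product opprD powRD ?pnatr_eq0 ?implybT//.
  rewrite /A /L -powRrM mulrN; move: (\prod_(_ < _) _) => P; ring.
- by move=> k; rewrite !mulr_ge0 ?exprn_ge0 ?(ltW L0) ?apx_coef_ge0 ?(ltW rho0) ?(ltW rho1).
- move=> k; apply: measurable_funM; first exact: measurable_rpow.
  apply: measurableT_comp => //; apply: measurableT_comp => //.
  by apply: measurable_funM => //; exact: measurable_rpow.
- by move=> k u u0; rewrite mulr_ge0 ?powR_ge0 ?expR_ge0.
- by move=> k; rewrite stretched_exp_integral// ltr_wpDr// divr_ge0// ltW.
Qed.

Lemma rwright_ge0 (t : R) : 0 <= nu -> 0 <= t -> 0 <= rwright rho nu t.
Proof.
move=> nu0 t0; have h := @cvg_wright_apx_rwright R rho nu rho01 t t0.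
apply: (cvgr_to_ge h); apply: nearW => N.
by case/andP: rho01 => r0 r1; apply: wright_apx_ge0 => //; exact: ltW.
Qed.

Lemma measurable_rwright (D : set R) : measurable D ->
  measurable_fun D (fun u => rwright rho nu (u `^ q)).
Proof.
move=> mD; apply: (measurable_fun_cvg (h := fun N u => wright_apx rho nu N (u `^ q))).
  by move=> N; exact: measurable_wright_apx.
move=> u _; apply: cvg_wright_apx_rwright => //; exact: powR_ge0.
Qed.

Let moment (p : R) : R := kap * rgamma (kap * p) * rgamma_inv (nu + rho * (kap * p)).
Let phi (p u : R) : R := u `^ (p - 1) * rwright rho nu (u `^ q).
Let phiN (p : R) N (u : R) : R := u `^ (p - 1) * wright_apx rho nu N (u `^ q).

Let momentN (p : R) N := kap * rgamma (kap * p) * gauss_product (nu + rho * (kap * p)) N.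

Let cvg_momentN p : momentN p N @[N --> \oo] --> moment p.
Proof. by apply: cvgM; [exact: cvg_cst|exact: cvg_gauss_product]. Qed.

Let cvg_phiN p u : phiN p N u @[N --> \oo] --> phi p u.
Proof.
apply: cvgM; first exact: cvg_cst.
by apply: cvg_wright_apx_rwright => //; exact: powR_ge0.
Qed.

Let mphiN (D : set R) p N : measurable_fun D (phiN p N).
Proof.
by apply: measurable_funM; [exact: measurable_rpow|exact: measurable_wright_apx].
Qed.

Let mphi (D : set R) p : measurable D -> measurable_fun D (phi p).
Proof.
by move=> mD; apply: measurable_funM; [exact: measurable_rpow|exact: measurable_rwright].
Qed.

Let phiN_ge0 p N u : 0 <= nu -> 0 <= phiN p N u.
Proof.
case/andP: rho01 => r0 r1 nu0; rewrite mulr_ge0 ?powR_ge0// wright_apx_ge0 ?powR_ge0//.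
  exact: ltW.
exact: ltW.
Qed.

Let phi_ge0 p u : 0 <= nu -> 0 <= phi p u.
Proof. by move=> nu0; rewrite mulr_ge0 ?powR_ge0// rwright_ge0// powR_ge0. Qed.

(** Fatou's lemma. *)
Let moment_upper p : 0 <= nu -> 0 < p -> (half_int (phi p) <= (moment p)%:E)%E.
Proof.
move=> nu0 p0.
have lim : (momentN p N)%:E @[N --> \oo] --> (moment p)%:E.
  by apply: cvg_EFin; [exact: nearW|exact: cvg_momentN].
have F := @fatou _ _ R mu `]0%R, +oo[ (measurable_itv _)
  (fun N u => (phiN p N u)%:E).
have {}F := F (fun N => (measurable_EFinP _ _).2 (mphiN p N)).
have {}F := F (fun N u _ => phiN_ge0 p N u nu0).
have E1 : (half_int (phi p) = \int[mu]_(x in `]0%R, +oo[)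
    limn_einf (fun N => (phiN p N x)%:E))%E.
  apply: eq_integral => u _.
  have h : (phiN p N u)%:E @[N --> \oo] --> (phi p u)%:E.
    by apply: cvg_EFin; [exact: nearW|exact: cvg_phiN].
  rewrite is_cvg_limn_einfE; first by rewrite (cvg_lim _ h).
  by apply/cvg_ex; exists (phi p u)%:E.
rewrite E1 (le_trans F)//.
have -> : (fun N => \int[mu]_(x in `]0%R, +oo[) (phiN p N x)%:E)%E =
    (fun N => (momentN p N)%:E).
  by apply/funext => N; exact: wright_apx_moment.
rewrite is_cvg_limn_einfE; first by rewrite (cvg_lim _ lim).
by apply/cvg_ex; exists (moment p)%:E.
Qed.

Let integrable_rpow (p T : R) : 0 < p -> 0 < T ->
  mu.-integrable `]0, T] (fun u => (u `^ (p - 1))%:E).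
Proof.
move=> p0 T0.
have I1 : mu.-integrable `]0, +oo[ (EFin \o gamma_density p).
  apply/integrableP; split.
    by apply/measurable_EFinP; exact: measurable_gamma_density.
  apply: le_lt_trans (gamma_integral_lty p0); rewrite le_eqVlt; apply/orP; left.
  by apply/eqP/eq_integral => u _; rewrite /= ger0_norm// gamma_density_ge0.
have I2 : mu.-integrable `]0, T] (EFin \o gamma_density p).
  apply: integrableS I1 => // u /=; rewrite !in_itv/= andbT.
  by case/andP.
have I3 : mu.-integrable `]0, T]
    (fun u => ((expR T)%:E * (gamma_density p u)%:E)%E).
  by apply: integrableZl.
apply: le_integrable I3 => //.
  by apply/measurable_EFinP; exact: measurable_rpow.
move=> u /=; rewrite in_itv/= => /andP[u0 uT]; rewrite lee_fin /gamma_density.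
rewrite !ger0_norm ?mulr_ge0 ?powR_ge0 ?expR_ge0// mulrCA -expRD.
rewrite ler_peMr ?powR_ge0// -[X in X <= _]expR0 ler_expR; lra.
Qed.

(** Dominated convergence holds on ]0, T]. On the rest u / T >= 1, so the tail
    of each approximant is at most its next moment divided by T, uniformly in N. *)
Let moment_lower p (T : R) : 0 <= nu -> 0 < p -> 0 < T ->
  ((moment p)%:E <= half_int (phi p) + (T^-1 * moment (p + 1))%:E)%E.
Proof.
move=> nu0 p0 T0; have p1 : 0 < p + 1 by rewrite addr_gt0.
have sub : `]0, T]%classic `<=` `](0:R), +oo[%classic.
  by move=> u /=; rewrite !in_itv/= andbT => /andP[].
pose J f := (\int[mu]_(u in `]0%R, T]) (f u)%:E)%E.
have splitJ (f : R -> R) : half_int (fun u => f u * \1_(`]0%R, T]%classic) u) = J f.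
  rewrite /J [RHS]integral_mkcond /half_int [LHS]integral_mkcond.
  apply: eq_integral => u _; rewrite /patch /indic.
  case: ifPn => uI; case: ifPn => uJ //=.
    by rewrite mulr1.
  by rewrite mulr0.
  by move: uI uJ; rewrite notin_setE inE => uI /sub.
have stepN N : ((momentN p N)%:E <= J (phiN p N) + (T^-1 * momentN (p + 1) N)%:E)%E.
  have EN r : 0 < r -> (momentN r N)%:E = half_int (phiN r N).
    by move=> r0; rewrite /phiN wright_apx_moment.
  rewrite (EFinM T^-1) !EN// -half_intZ ?invr_ge0 ?(ltW T0)//.
  - rewrite -splitJ -half_intD.
    + apply: half_int_le.
      * exact: mphiN.
      * apply: measurable_funD; last by apply: measurable_funM => //; exact: mphiN.
        by apply: measurable_funM; [exact: mphiN|exact: measurable_indic].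
      * by move=> u _; exact: phiN_ge0.
      * move=> u u0; rewrite -/(phiN p N u) -/(phiN (p + 1) N u).
        have E : phiN (p + 1) N u = u * phiN p N u.
          rewrite /phiN addrK mulrA; congr (_ * _).
          by rewrite mulr_powRB1 ?(ltW u0).
        rewrite E indicE; case: (boolP (u \in _)) => uJ.
          by rewrite mulr1 lerDl mulr_ge0 ?invr_ge0 ?(ltW T0)// mulr_ge0 ?(ltW u0) ?phiN_ge0.
        have uT : T < u.
          move: uJ; rewrite notin_setE/= in_itv/= u0/= => /negP.
          by rewrite -ltNge.
        rewrite mulr0 add0r mulrA ler_peMl ?phiN_ge0//.
        by rewrite ler_pdivlMl// mulr1 ltW.
    + by apply: measurable_funM; [exact: mphiN|exact: measurable_indic].
    + by apply: measurable_funM => //; exact: mphiN.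
    + by move=> u _; rewrite mulr_ge0// phiN_ge0.
    + by move=> u _; rewrite mulr_ge0 ?invr_ge0 ?(ltW T0)// phiN_ge0.
  - by move=> u _; exact: phiN_ge0.
have [B B0 hB] := wright_apx_bounded nu rho01 (powR_ge0 T q).
have DC : J (phiN p N) @[N --> \oo] --> J (phi p).
  have := @dominated_convergence _ _ R mu `]0%R, T] (measurable_itv _)
    (fun N u => (phiN p N u)%:E) (fun u => (phi p u)%:E)
    (fun u => B%:E * (u `^ (p - 1))%:E)%E.
  case.
  - by move=> N; apply/measurable_EFinP; exact: mphiN.
  - by apply/measurable_EFinP; exact: mphi.
  - by apply: aeW => u _; apply: cvg_EFin; [exact: nearW|exact: cvg_phiN].
  - by apply: integrableZl => //; exact: integrable_rpow.
  - apply: aeW => u N /=; rewrite in_itv/= => /andP[u0 uT].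
    rewrite lee_fin normrM mulrC (ger0_norm (powR_ge0 _ _)) ler_wpM2r ?powR_ge0//.
    apply: hB; rewrite powR_ge0/=; apply: ge0_ler_powR => //.
    + exact: ltW.
    + by rewrite nnegrE ltW.
    + by rewrite nnegrE ltW.
  - by move=> _ _; exact.
have lim2 : (J (phiN p N) + (T^-1 * momentN (p + 1) N)%:E)%E @[N --> \oo] -->
    (J (phi p) + (T^-1 * moment (p + 1))%:E)%E.
  apply: cvgeD => //; first exact: fin_num_adde_defl.
  apply: cvg_EFin; first exact: nearW.
  by apply: cvgM; [exact: cvg_cst|exact: cvg_momentN].
have lim1 : (momentN p N)%:E @[N --> \oo] --> (moment p)%:E.
  by apply: cvg_EFin; [exact: nearW|exact: cvg_momentN].
have : ((moment p)%:E <= J (phi p) + (T^-1 * moment (p + 1))%:E)%E.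
  rewrite -(cvg_lim (@ereal_hausdorff R) lim1) -(cvg_lim (@ereal_hausdorff R) lim2).
  apply: lee_lim; [by apply/cvg_ex; eexists; exact: lim1
    |by apply/cvg_ex; eexists; exact: lim2|exact: nearW].
move=> /le_trans; apply; rewrite leeD2r//.
apply: ge0_subset_integral => //.
- by apply/measurable_EFinP; exact: mphi.
- by move=> u _; rewrite lee_fin phi_ge0.
Qed.

(** Fatou's lemma bounds the moment from above; in the bound from below the term
    in T is made small by a large T. *)
Theorem rwright_moment_ge0 (p : R) : 0 <= nu -> 0 < p ->
  half_int (fun u => u `^ (p - 1) * rwright rho nu (u `^ q)) =
  (kap * rgamma (kap * p) * rgamma_inv (nu + rho * (kap * p)))%:E.
Proof.
move=> nu0 p0; rewrite -/(phi p) -/(moment p).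
apply/eqP; rewrite eq_le moment_upper//=.
have h0 : (0 <= half_int (phi p))%E.
  by apply: half_int_ge0 => u _; exact: phi_ge0.
have hy : (half_int (phi p) < +oo)%E.
  by apply: le_lt_trans (moment_upper nu0 p0) _; rewrite ltry.
have fin : half_int (phi p) \is a fin_num by rewrite ge0_fin_numE.
rewrite -(fineK fin) lee_fin; apply/ler_addgt0Pr => e e0.
pose m1 := moment (p + 1).
(* this T makes the tail m1 / T at most e *)
have T0 : 0 < (`|m1| + 1) / e by rewrite divr_gt0// ltr_wpDl.
have := moment_lower nu0 p0 T0; rewrite -(fineK fin) -EFinD lee_fin => /le_trans; apply.
rewrite lerD2l invf_div mulrAC ler_pdivrMr ?ltr_wpDl//.
rewrite ler_pM2l// (le_trans (ler_norm _))// lerDl//.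
Qed.

End WrightMoments.

(** * Contiguity, and the moments for every real parameter *)

Section WrightContiguity.
Variable R : realType.
Variable rho : R.
Hypothesis rho01 : 0 < rho < 1.

(** In 1/Gamma(s) = s / Gamma(s + 1) with s = nu - rho * k, the part - rho * k
    of the factor s cancels one factor of k! and shifts the series by one place. *)
Lemma wright_term_contiguous (nu t : R) (n : nat) :
  series (wright_term rho nu t) n.+1 =
  nu * series (wright_term rho (nu + 1) t) n.+1 +
  rho * t * series (wright_term rho (nu + 1 - rho) t) n.
Proof.
rewrite /series/= !big_distrr/=.
rewrite [X in _ = _ + X](_ : _ = \sum_(0 <= k < n.+1)
    (- rho * k%:R * ((- t) ^+ k / k`!%:R * rgamma_inv (nu + 1 - rho * k%:R)))); last first.
  rewrite [RHS]big_nat_recl//= mulr0 mul0r add0r; apply: eq_bigr => k _.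
  rewrite /wright_term factS natrM exprS.
  have -> : nu + 1 - rho * k.+1%:R = nu + 1 - rho - rho * k%:R.
    by rewrite -natr1; ring.
  have k0 : k`!%:R != 0 :> R by rewrite pnatr_eq0 -lt0n fact_gt0.
  have k1 : k.+1%:R != 0 :> R by [].
  by field; rewrite k0 -[1 + k%:R]addrC natr1.
rewrite -big_split/=; apply: eq_bigr => k _; rewrite /wright_term.
rewrite (@rgamma_invS _ (nu - rho * k%:R)).
have -> : nu - rho * k%:R + 1 = nu + 1 - rho * k%:R by ring.
ring.
Qed.

Theorem rwright_contiguous (nu t : R) : 0 <= t ->
  rwright rho nu t = nu * rwright rho (nu + 1) t +
                     rho * t * rwright rho (nu + 1 - rho) t.
Proof.
move=> t0.
have h (a : R) := @cvg_rwright R rho a rho01 t t0.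
have h1 (a : R) : series (wright_term rho a t) n.+1 @[n --> \oo] --> rwright rho a t.
  have := h a; rewrite -(cvg_shiftS (series (wright_term rho a t))); exact.
have L : series (wright_term rho nu t) n.+1 @[n --> \oo] -->
    nu * rwright rho (nu + 1) t + rho * t * rwright rho (nu + 1 - rho) t.
  under eq_fun do rewrite wright_term_contiguous.
  apply: cvgD; apply: cvgM; (try exact: cvg_cst); [exact: h1|exact: h].
by apply: (cvg_unique _ (h1 nu) L); exact: Rhausdorff.
Qed.

End WrightContiguity.

Section WrightExpMoments.
Variable R : realType.
Variables rho kap : R.
Hypothesis rho01 : 0 < rho < 1.
Hypothesis kap0 : 0 < kap.
Notation q := kap^-1.

Definition wright_moment (nu p : R) : R :=
  kap * rgamma (kap * p) * rgamma_inv (nu + rho * (kap * p)).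

(** The exponential series may be integrated term by term because every term is
    nonnegative. *)
Lemma wright_exp_moment_ge0 (nu p c : R) : 0 <= nu -> 0 < p -> 0 <= c ->
  cvgn (series (fun n => c ^+ n / n`!%:R * wright_moment nu (p + n%:R))) ->
  (half_int (fun u => (u `^ (p - 1) * rwright rho nu (u `^ q) * expR (c * u))%R) < +oo)%E.
Proof.
move=> nu0 p0 c0 hs.
pose f n (u : R) := c ^+ n / n`!%:R *
  (u `^ (p + n%:R - 1) * rwright rho nu (u `^ q)).
have ph (n : nat) : 0 < p + n%:R by rewrite ltr_wpDr.
have cn (n : nat) : 0 <= c ^+ n / n`!%:R by rewrite divr_ge0 ?exprn_ge0.
have w0 (u : R) : 0 <= rwright rho nu (u `^ q) by rewrite rwright_ge0// powR_ge0.
have f0 n u : 0 <= f n u by rewrite mulr_ge0// mulr_ge0// powR_ge0.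
have mw : measurable_fun `](0:R), +oo[ (fun u => rwright rho nu (u `^ q)).
  exact: measurable_rwright.
have mf n : measurable_fun `](0:R), +oo[ (f n).
  apply: measurable_funM => //; apply: measurable_funM => //.
  exact: measurable_rpow.
have fE n : (\int[mu]_(u in `]0%R, +oo[) (f n u)%:E)%E =
    (c ^+ n / n`!%:R * wright_moment nu (p + n%:R))%:E.
  rewrite -/(half_int (f n)) half_intZ//.
  - by rewrite rwright_moment_ge0// -EFinM.
  - by apply: measurable_funM => //; exact: measurable_rpow.
  - by move=> u _; rewrite mulr_ge0// powR_ge0.
have -> : half_int (fun u => u `^ (p - 1) * rwright rho nu (u `^ q) * expR (c * u))
   = (\int[mu]_(u in `]0%R, +oo[) (\sum_(n <oo) (f n u)%:E))%E.
  apply: eq_integral => u; rewrite inE/= in_itv/= andbT => u0.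
  apply/esym/cvg_lim => //.
  have h : series (exp_coeff (c * u)) @ \oo --> expR (c * u).
    exact: is_cvg_series_exp_coeff.
  have {}h : u `^ (p - 1) * rwright rho nu (u `^ q) * series (exp_coeff (c * u)) n
     @[n --> \oo] --> u `^ (p - 1) * rwright rho nu (u `^ q) * expR (c * u).
    by apply: cvgM => //; exact: cvg_cst.
  have {}h : (u `^ (p - 1) * rwright rho nu (u `^ q) *
      series (exp_coeff (c * u)) n)%:E @[n --> \oo] -->
      (u `^ (p - 1) * rwright rho nu (u `^ q) * expR (c * u))%:E.
    by apply: cvg_EFin; [exact: nearW|exact: h].
  apply: (cvg_near_eq _ h); apply: nearW => n.
  rewrite /= sumEFin; congr (_%:E); rewrite /series/= big_distrr/=.
  apply: eq_bigr => k _; rewrite /f /exp_coeff/= exprMn.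
  have -> : u `^ (p + k%:R - 1) = u `^ (p - 1) * u ^+ k.
    rewrite -powR_mulrn ?(ltW u0)// -powRD ?(gt_eqF u0) ?implybT//.
    by congr (_ `^ _); ring.
  ring.
rewrite integral_nneseries//.
- under eq_eseriesr do rewrite fE.
  have {}hs : (series (fun n => c ^+ n / n`!%:R * wright_moment nu (p + n%:R)) m)%:E
     @[m --> \oo] -->
     (limn (series (fun n => c ^+ n / n`!%:R * wright_moment nu (p + n%:R))))%:E.
    by apply: cvg_EFin; [exact: nearW|exact: hs].
  have -> : (\sum_(n <oo) (c ^+ n / n`!%:R * wright_moment nu (p + n%:R))%:E)%E =
     (limn (series (fun n => c ^+ n / n`!%:R * wright_moment nu (p + n%:R))))%:E.
    apply/cvg_lim => //; apply: (cvg_near_eq _ hs); apply: nearW => n.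
    by rewrite /= sumEFin.
  by rewrite ltry.
- by move=> n; apply/measurable_EFinP; exact: mf.
- by move=> n u _; rewrite lee_fin.
Qed.

(** Admissible exponents. The parameter nu is nonnegative here, so that
    finiteness of the integral is integrability. *)
Definition wright_adm (c : R) : Prop :=
  forall nu p, 0 <= nu -> 0 < p ->
  (half_int (fun u => (u `^ (p - 1) * rwright rho nu (u `^ q) * expR (c * u))%R) < +oo)%E.

Lemma wright_adm0 : wright_adm 0.
Proof.
move=> nu p nu0 p0.
have -> : half_int (fun u => u `^ (p - 1) * rwright rho nu (u `^ q) * expR (0 * u)) =
    half_int (fun u => u `^ (p - 1) * rwright rho nu (u `^ q)).
  by apply: eq_half_int => u _; rewrite mul0r expR0 mulr1.
by rewrite rwright_moment_ge0// ltry.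
Qed.

Let good (nu : R) := forall p : R, 0 < p ->
  (forall c, wright_adm c -> mu.-integrable `]0, +oo[
    (fun u => (u `^ (p - 1) * rwright rho nu (u `^ q) * expR (c * u))%:E)) /\
  Rintegral mu `]0, +oo[ (fun u => u `^ (p - 1) * rwright rho nu (u `^ q)) =
    wright_moment nu p.

Let mfun (nu p c : R) : measurable_fun `](0:R), +oo[
  (fun u : R => u `^ (p - 1) * rwright rho nu (u `^ q) * expR (c * u)).
Proof.
apply: measurable_funM.
  by apply: measurable_funM; [exact: measurable_rpow|exact: measurable_rwright].
by apply: measurableT_comp => //; exact: measurable_funM.
Qed.

Let good_ge0 (nu : R) : 0 <= nu -> good nu.
Proof.
move=> nu0 p p0; split.
  move=> c hc; apply/integrableP; split; first by apply/measurable_EFinP; exact: mfun.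
  have := hc nu p nu0 p0; rewrite /half_int; congr (_ < _)%E.
  apply: eq_integral => u _; rewrite /= ger0_norm// mulr_ge0 ?expR_ge0//.
  by rewrite mulr_ge0 ?powR_ge0// rwright_ge0// powR_ge0.
rewrite /Rintegral -/(half_int _).
by rewrite rwright_moment_ge0.
Qed.

Let good_step (nu : R) : good (nu + 1) -> good (nu + 1 - rho) -> good nu.
Proof.
move=> g1 g2 p p0.
have q0 : 0 < q by rewrite invr_gt0.
have pq0 : 0 < p + q by rewrite addr_gt0.
have [i1 m1] := g1 p p0; have [i2 m2] := g2 _ pq0.
have E (u : R) : 0 < u -> u `^ (p - 1) * rwright rho nu (u `^ q) =
    nu * (u `^ (p - 1) * rwright rho (nu + 1) (u `^ q)) +
    rho * (u `^ (p + q - 1) * rwright rho (nu + 1 - rho) (u `^ q)).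
  move=> u0; rewrite (rwright_contiguous rho01 nu (powR_ge0 _ _)).
  have -> : u `^ (p + q - 1) = u `^ (p - 1) * u `^ q.
    by rewrite -powRD ?(gt_eqF u0) ?implybT//; congr (_ `^ _); ring.
  move: (rwright rho (nu + 1) _) (rwright rho (nu + 1 - rho) _) => a b; ring.
have E' (c u : R) : 0 < u ->
    u `^ (p - 1) * rwright rho nu (u `^ q) * expR (c * u) =
    nu * (u `^ (p - 1) * rwright rho (nu + 1) (u `^ q) * expR (c * u)) +
    rho * (u `^ (p + q - 1) * rwright rho (nu + 1 - rho) (u `^ q) * expR (c * u)).
  by move=> u0; rewrite E// mulrDl !mulrA.
have I1 c : wright_adm c -> mu.-integrable `]0, +oo[ (fun u =>
    (nu * (u `^ (p - 1) * rwright rho (nu + 1) (u `^ q) * expR (c * u)))%:E).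
  by move=> hc; apply: (integrableZl _ nu (i1 c hc)).
have I2 c : wright_adm c -> mu.-integrable `]0, +oo[ (fun u =>
    (rho * (u `^ (p + q - 1) * rwright rho (nu + 1 - rho) (u `^ q) * expR (c * u)))%:E).
  by move=> hc; apply: (integrableZl _ rho (i2 c hc)).
have strip (r a : R) : 0 < r -> (fun u : R =>
      (u `^ (r - 1) * rwright rho a (u `^ q) * expR (0 * u))%:E) =
    (fun u : R => (u `^ (r - 1) * rwright rho a (u `^ q))%:E).
  by move=> _; apply/funext => u; rewrite mul0r expR0 mulr1.
split.
  move=> c hc.
  apply: eq_integrable (integrableD _ (I1 c hc) (I2 c hc)) => //.
  move=> u; rewrite inE/= in_itv/= andbT => u0.
  exact: (congr1 EFin (esym (E' c u u0))).
have J1 := i1 0 wright_adm0; have J2 := i2 0 wright_adm0.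
rewrite strip// in J1; rewrite strip// in J2.
transitivity (Rintegral mu `]0, +oo[ (fun u =>
    nu * (u `^ (p - 1) * rwright rho (nu + 1) (u `^ q)) +
    rho * (u `^ (p + q - 1) * rwright rho (nu + 1 - rho) (u `^ q)))).
  by apply: eq_Rintegral => u; rewrite inE/= in_itv/= andbT => u0; exact: E.
rewrite RintegralD//; last 2 first.
- exact: (integrableZl _ nu J1).
- exact: (integrableZl _ rho J2).
rewrite !RintegralZl// m1 m2 /wright_moment.
have -> : kap * (p + q) = kap * p + 1 by field; rewrite gt_eqF.
rewrite rgammaS ?mulr_gt0// (@rgamma_invS _ (nu + rho * (kap * p))).
have -> : nu + 1 - rho + rho * (kap * p + 1) = nu + rho * (kap * p) + 1 by ring.
have -> : nu + 1 + rho * (kap * p) = nu + rho * (kap * p) + 1 by ring.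
by move: (rgamma _) (rgamma_inv _) => a b; ring.
Qed.

(** The contiguity relation passes from nu + 1 and nu + 1 - rho to nu, that is
    down by at least 1 - rho, so finitely many steps reach any nu from
    nonnegative parameters. *)
Theorem wright_moments (nu p : R) : 0 < p ->
  (forall c, wright_adm c -> mu.-integrable `]0, +oo[
    (fun u => (u `^ (p - 1) * rwright rho nu (u `^ q) * expR (c * u))%:E)) /\
  Rintegral mu `]0, +oo[ (fun u => u `^ (p - 1) * rwright rho nu (u `^ q)) =
    wright_moment nu p.
Proof.
have /andP[rho0 rho1] := rho01.
have H (k : nat) : forall a : R, - (k%:R * (1 - rho)) <= a -> good a.
  elim: k => [|k IH] a ha; first by apply: good_ge0; rewrite mul0r oppr0 in ha.
  move: ha; rewrite -natr1 => ha.
  by apply: good_step; apply: IH; move: ha; rewrite mulrDl mul1r; lra.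
apply: (H (Num.truncn (`|nu| / (1 - rho))).+1 nu).
have : `|nu| / (1 - rho) < (Num.truncn (`|nu| / (1 - rho))).+1%:R.
  exact: truncnS_gt.
rewrite ltr_pdivrMr ?subr_gt0// => h.
by rewrite lerNl (le_trans _ (ltW h))// -normrN ler_norm.
Qed.

End WrightExpMoments.

(** * Growth of the coefficients *)

Section RatioTest.
Variable R : realType.

Lemma ratio_test (T : nat -> R) (l : R) : (forall n, 0 < T n) ->
  0 <= l -> l < 1 -> T n.+1 / T n @[n --> \oo] --> l -> cvgn (series T).
Proof.
move=> T0 l0 l1 hl; pose th : R := (1 + l) / 2.
have th0 : 0 < th by rewrite /th; lra.
have th1 : th < 1 by rewrite /th; lra.
have [N _ hN] : \forall n \near \oo, T n.+1 / T n <= th.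
  by apply: (cvgr_le _ hl); rewrite /th; lra.
pose C := \sum_(k < N.+1) T k / th ^+ k.
have C0 : 0 <= C.
  by rewrite sumr_ge0// => k _; rewrite divr_ge0 ?exprn_ge0 ?ltW.
have TC n : T n <= C * th ^+ n.
  have small k : (k <= N)%N -> T k <= C * th ^+ k.
    move=> kN; rewrite -ler_pdivrMr ?exprn_gt0//.
    rewrite /C (bigD1 (Ordinal (kN : (k < N.+1)%N)))//= lerDl.
    by rewrite sumr_ge0// => j _; rewrite divr_ge0 ?exprn_ge0 ?ltW.
  elim: n => [|n IH]; first exact: small.
  have [nN|Nn] := leqP n.+1 N; first exact: small.
  have := hN n Nn; rewrite ler_pdivrMr// => /le_trans; apply.
  by rewrite exprS mulrCA ler_pM2l.
apply: (series_le_cvg _ _ TC).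
- by move=> n; exact: ltW.
- by move=> n; rewrite mulr_ge0 ?exprn_ge0 ?(ltW th0).
- by apply: is_cvg_geometric_series; rewrite ger0_norm// ltW.
Qed.

End RatioTest.

Section MLRatio.
Variable R : realType.
Variables A B alpha kappa : R.
Hypotheses (A0 : 0 < A) (B0 : 0 < B) (alpha0 : 0 < alpha) (kappa0 : 0 < kappa).

Definition ml_weight (n : nat) : R :=
  rgamma (A + kappa * n%:R) / (rgamma (B + alpha * n%:R) * n`!%:R).

Let x n := A + kappa * n%:R.
Let y n := B + alpha * n%:R.
Let x0 n : 0 < x n. Proof. by rewrite ltr_wpDr// mulr_ge0// ltW. Qed.
Let y0 n : 0 < y n. Proof. by rewrite ltr_wpDr// mulr_ge0// ltW. Qed.

Lemma ml_weight_gt0 n : 0 < ml_weight n.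
Proof.
have gx := rgamma_gt0 (x0 n); have gy := rgamma_gt0 (y0 n).
by rewrite divr_gt0 ?mulr_gt0 ?ltr0n ?fact_gt0.
Qed.

Let cvg_affine_pinfty (a b : R) : 0 < b -> a + b * n%:R @[n --> \oo] --> +oo.
Proof.
move=> b0; apply/cvgryPge => M; near=> n.
have : (M - a) / b <= n%:R by near: n; exact: nbhs_infty_ger.
by rewrite ler_pdivrMr//; lra.
Unshelve. all: by end_near. Qed.

Let cvg_affine_ratio (a b : R) : (a + b * n%:R) / n.+1%:R @[n --> \oo] --> b.
Proof.
have h : b + (a - b) * n.+1%:R^-1 @[n --> \oo] --> b.
  rewrite -[X in _ --> X]addr0; apply: cvgD; first exact: cvg_cst.
  rewrite -[X in _ --> X](mulr0 (a - b)); apply: cvgM; first exact: cvg_cst.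
  exact: cvg_harmonic.
apply: (cvg_near_eq _ h); apply: nearW => n.
by rewrite -natr1; field; rewrite natr1.
Qed.

(** The asymptotics Gamma(x + a) ~ Gamma(x) x^a with x = A + kappa * n and with
    x = B + alpha * n. *)
Theorem cvg_ml_weight_ratio :
  ml_weight n.+1 / ml_weight n * n.+1%:R `^ (1 + alpha - kappa)
    @[n --> \oo] --> kappa `^ kappa / alpha `^ alpha.
Proof.
have h1 : gamma_ratio kappa (x n) @[n --> \oo] --> (1 : R).
  exact: cvg_comp _ _ (@cvg_affine_pinfty A kappa kappa0) (@cvg_gamma_ratio R kappa).
have h2 : gamma_ratio alpha (y n) @[n --> \oo] --> (1 : R).
  exact: cvg_comp _ _ (@cvg_affine_pinfty B alpha alpha0) (@cvg_gamma_ratio R alpha).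
have h3 : (x n / n.+1%:R) `^ kappa @[n --> \oo] --> kappa `^ kappa.
  exact: cvg_comp _ _ (@cvg_affine_ratio A kappa) (@continuous_powR R kappa kappa kappa0).
have h4 : (y n / n.+1%:R) `^ alpha @[n --> \oo] --> alpha `^ alpha.
  exact: cvg_comp _ _ (@cvg_affine_ratio B alpha) (@continuous_powR R alpha alpha alpha0).
have h5 : (gamma_ratio kappa (x n) * (x n / n.+1%:R) `^ kappa) /
    (gamma_ratio alpha (y n) * (y n / n.+1%:R) `^ alpha)
   @[n --> \oo] --> (1 * kappa `^ kappa) / (1 * alpha `^ alpha).
  apply: cvgM; first exact: cvgM.
  apply: cvgV; first by rewrite mul1r gt_eqF// powR_gt0.
  exact: cvgM.
rewrite !mul1r in h5.
apply: (cvg_near_eq _ h5); apply: nearW => n.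
have EX : A + kappa * n.+1%:R = x n + kappa by rewrite /x -natr1; ring.
have EY : B + alpha * n.+1%:R = y n + alpha by rewrite /y -natr1; ring.
rewrite /ml_weight EX EY /gamma_ratio -/(x n) -/(y n).
have n0 : 0 < n.+1%:R :> R by [].
rewrite !(powRM _ (ltW (x0 n))) ?invr_ge0// !(powRM _ (ltW (y0 n))) ?invr_ge0//.
have -> : n.+1%:R^-1 `^ kappa = (n.+1%:R `^ kappa)^-1 :> R.
  by rewrite -[n.+1%:R^-1]powR_inv1// -powRrM mulN1r powRN.
have -> : n.+1%:R^-1 `^ alpha = (n.+1%:R `^ alpha)^-1 :> R.
  by rewrite -[n.+1%:R^-1]powR_inv1// -powRrM mulN1r powRN.
have -> : n.+1%:R `^ (1 + alpha - kappa) =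
    n.+1%:R * n.+1%:R `^ alpha / n.+1%:R `^ kappa :> R.
  rewrite powRD ?(gt_eqF n0) ?implybT// powRN powRD ?(gt_eqF n0) ?implybT//.
  by rewrite powRr1.
rewrite factS natrM.
have gx := rgamma_gt0 (x0 n); have gy := rgamma_gt0 (y0 n).
have ya0 : 0 < y n + alpha by rewrite addr_gt0.
have gya := rgamma_gt0 ya0.
have px := powR_gt0 kappa (x0 n); have py := powR_gt0 alpha (y0 n).
have pk := powR_gt0 kappa n0; have pa := powR_gt0 alpha n0.
have f0 : 0 < n`!%:R :> R by rewrite ltr0n fact_gt0.
move: (rgamma (x n + kappa)) (rgamma (x n)) (rgamma (y n)) (rgamma (y n + alpha))
  (x n `^ kappa) (y n `^ alpha) (n.+1%:R `^ kappa) (n.+1%:R `^ alpha) (n`!%:R)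
  (n.+1%:R) gx gy gya px py pk pa f0 n0 => a1 a2 a3 a4 a5 a6 a7 a8 a9 a10.
by move=> *; field; rewrite !gt_eqF.
Qed.

End MLRatio.

Section Admissible.
Variable R : realType.
Variables alpha kappa : R.
Hypotheses (alpha0 : 0 < alpha) (kappa0 : 0 < kappa) (ak : alpha < kappa).
Let Delta : R := 1 + alpha - kappa.

Lemma cvg_natS_powR_lt0 (d : R) : 0 < d -> n.+1%:R `^ (- d) @[n --> \oo] --> (0 : R).
Proof.
move=> d0.
have h : (n.+1%:R^-1 : R) `^ d @[n --> \oo] --> (0 : R).
  apply: (@cvg_comp _ _ _ (fun n => n.+1%:R^-1 : R) (@powR R ^~ d) _ (0^'+));
    last exact: powR_cvg0.
  move=> P P0; have : \forall n \near \oo, 0 < (n.+1%:R^-1 : R) -> P n.+1%:R^-1.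
    exact: (@cvg_harmonic R _ P0).
  by apply: filterS => n; apply; rewrite invr_gt0.
apply: (cvg_near_eq _ h); apply: nearW => n.
by rewrite -[n.+1%:R^-1]powR_inv1// -powRrM mulN1r.
Qed.

(** Ratio test for the series of wright_exp_moment_ge0: its ratio behaves like c
    kappa^kappa alpha^(-alpha) n^(-Delta). *)
Theorem wright_adm_criterion (c : R) : 0 <= c ->
  0 < Delta \/ (Delta = 0 /\ c < alpha `^ alpha / kappa `^ kappa) ->
  wright_adm (alpha / kappa) kappa c.
Proof.
move=> c0 hD.
have rho01 : 0 < alpha / kappa < 1.
  by rewrite divr_gt0// ltr_pdivrMr// mul1r.
move: c0; rewrite le_eqVlt => /predU1P[<-|c0]; first exact: wright_adm0.
move=> nu p nu0 p0; apply: wright_exp_moment_ge0 => //; first exact: ltW.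
have A0 : 0 < kappa * p by rewrite mulr_gt0.
have B0 : 0 < nu + alpha * p by rewrite ltr_wpDl// mulr_gt0.
pose w := ml_weight (kappa * p) (nu + alpha * p) alpha kappa.
have w0 n : 0 < w n by exact: ml_weight_gt0.
have -> : (fun n => c ^+ n / n`!%:R * wright_moment (alpha / kappa) kappa nu (p + n%:R))
    = (fun n => kappa * (c ^+ n * w n)).
  apply/funext => n; rewrite /w /ml_weight /wright_moment.
  have -> : nu + alpha / kappa * (kappa * (p + n%:R)) = nu + alpha * p + alpha * n%:R.
    by field; rewrite gt_eqF.
  have y0 : 0 < nu + alpha * p + alpha * n%:R by rewrite ltr_wpDr// mulr_ge0// ltW.
  rewrite rgamma_inv_gt0E// mulrDr.
  have gy := rgamma_gt0 y0.
  have f0 : 0 < n`!%:R :> R by rewrite ltr0n fact_gt0.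
  by field; rewrite !gt_eqF.
have T0 n : 0 < kappa * (c ^+ n * w n).
  by rewrite mulr_gt0// mulr_gt0 ?exprn_gt0.
have L := @cvg_ml_weight_ratio R _ _ alpha kappa A0 B0 alpha0 kappa0.
pose l := if Delta == 0 then c * (kappa `^ kappa / alpha `^ alpha) else 0.
have pk : 0 < kappa `^ kappa by exact: powR_gt0.
have pa : 0 < alpha `^ alpha by exact: powR_gt0.
apply: (@ratio_test _ _ l T0).
- by rewrite /l; case: ifP => // _; rewrite mulr_ge0 ?divr_ge0 ?(ltW c0) ?(ltW pk) ?(ltW pa).
- rewrite /l; case: eqP => [D0|//]; case: hD => [|[_ cR]].
    by rewrite D0 ltxx.
  by rewrite -ltr_pdivlMr ?divr_gt0// invf_div mul1r.
- have lim : n.+1%:R `^ (- Delta) @[n --> \oo] --> (if Delta == 0 then 1 else 0 : R).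
    case: eqP => [->|D0].
      by rewrite oppr0; under eq_fun do rewrite powRr0; exact: cvg_cst.
    by case: hD => [D1|[/D0//]]; exact: cvg_natS_powR_lt0.
  have LL := cvgM (cvg_cst c) (cvgM L lim).
  have {LL}L2 : c * (w n.+1 / w n * n.+1%:R `^ Delta * n.+1%:R `^ (- Delta))
      @[n --> \oo] --> l.
    rewrite [X in _ --> X](_ : _ =
       c * (kappa `^ kappa / alpha `^ alpha * (if Delta == 0 then 1 else 0 : R))).
      by apply: cvgM; [exact: cvg_cst|apply: cvgM].
    by rewrite /l; case: ifP => _; rewrite ?mulr1 ?mulr0.
  apply: (cvg_near_eq _ L2); apply: nearW => n.
  have -> : n.+1%:R `^ (- Delta) = (n.+1%:R `^ Delta)^-1 :> R by rewrite powRN.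
  have p1 : 0 < n.+1%:R `^ Delta :> R by rewrite powR_gt0.
  have := w0 n; have : c ^+ n != 0 by rewrite expf_neq0// gt_eqF.
  rewrite exprS; move: (w n.+1) (w n) (c ^+ n) => W1 W2 cn cn0 W20.
  by field; rewrite cn0 !gt_eqF.
Qed.

(** For Delta < 0 the ratio of consecutive weights tends to infinity. *)
Theorem ml_weight_growth (A B b : R) : 0 < A -> 0 < B -> 0 < b -> Delta < 0 ->
  \forall n \near \oo, b * ml_weight A B alpha kappa n <= ml_weight A B alpha kappa n.+1.
Proof.
move=> A0 B0 b0 D0.
have L := @cvg_ml_weight_ratio R A B alpha kappa A0 B0 alpha0 kappa0.
pose w := ml_weight A B alpha kappa.
have w0 n : 0 < w n by exact: ml_weight_gt0.
have pk : 0 < kappa `^ kappa by exact: powR_gt0.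
have pa : 0 < alpha `^ alpha by exact: powR_gt0.
pose l := kappa `^ kappa / alpha `^ alpha.
have l0 : 0 < l by rewrite divr_gt0.
have h1 : \forall n \near \oo, l / 2 <= w n.+1 / w n * n.+1%:R `^ Delta.
  by apply: (cvgr_ge _ L); rewrite -/l; lra.
have D0' : 0 < - Delta by rewrite oppr_gt0.
have h2 : \forall n \near \oo, n.+1%:R `^ Delta <= l / 2 / b.
  have := @cvg_natS_powR_lt0 _ D0'; rewrite opprK => h.
  by apply: (cvgr_le _ h); rewrite !divr_gt0.
near=> n.
have H1 : l / 2 <= w n.+1 / w n * n.+1%:R `^ Delta by near: n.
have H2 : n.+1%:R `^ Delta <= l / 2 / b by near: n.
have p1 : 0 < n.+1%:R `^ Delta :> R by rewrite powR_gt0.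
rewrite -/(w n) -/(w n.+1) -ler_pdivlMr//.
have r0 : 0 < w n.+1 / w n by rewrite divr_gt0.
have l20 : 0 < l / 2 by rewrite divr_gt0.
have H3 : b * (l / 2) <= w n.+1 / w n * (l / 2).
  rewrite mulrC -ler_pdivlMr// -[_ / b]mulrA.
  exact: le_trans H1 (ler_wpM2l (ltW r0) H2).
by rewrite ler_pM2r in H3.
Unshelve. all: by end_near. Qed.

End Admissible.

(** * Complex norm and exponential *)

Lemma cvg_dist0 (R : realType) (T : Type) (F : set_system T) {FF : Filter F}
    (f : T -> R) (l : R) :
  f x @[x --> F] --> l -> `|f x - l| @[x --> F] --> (0 : R).
Proof.
move=> h; rewrite -[X in _ --> X](@normr0 _ R) -(subrr l); apply: cvg_norm.
by apply: cvgB => //; exact: cvg_cst.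
Qed.

Section ComplexNorm.
Variable R : realType.
Implicit Types (z w : R[i]).

Lemma ReD z w : Re (z + w) = Re z + Re w. Proof. by case: z; case: w. Qed.
Lemma ImD z w : Im (z + w) = Im z + Im w. Proof. by case: z; case: w. Qed.
Lemma ReB z w : Re (z - w) = Re z - Re w. Proof. by case: z; case: w. Qed.
Lemma ImB z w : Im (z - w) = Im z - Im w. Proof. by case: z; case: w. Qed.

Lemma normcE_real z : `|z| = (nc z)%:C. Proof. by case: z. Qed.

Lemma nc_triangle z w : nc (z + w) <= nc z + nc w.
Proof. by rewrite -lecR rmorphD -!normcE_real ler_normD. Qed.

Lemma nc_ge0 z : 0 <= nc z. Proof. by case: z => a b; rewrite sqrtr_ge0. Qed.

Lemma ncN z : nc (- z) = nc z.
Proof. by case: z => a b /=; rewrite !sqrrN. Qed.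

Lemma nc_real (x : R) : nc x%:C = `|x|.
Proof. by rewrite /= expr0n addr0 sqrtr_sqr. Qed.

Lemma Re_le_nc z : `|Re z| <= nc z.
Proof. by rewrite -lecR -normcE_real normc_ge_Re. Qed.

Lemma nc_conj_i z : nc (- 'i * z) = nc z.
Proof.
rewrite normcM -[RHS]mul1r.
by congr (_ * _); rewrite /= oppr0 expr0n add0r sqrrN expr1n sqrtr1.
Qed.

Lemma Re_conj_i z : Re (- 'i * z) = Im z.
Proof. by case: z => a b /=; rewrite oppr0 mul0r sub0r mulN1r opprK. Qed.

Lemma Im_le_nc z : `|Im z| <= nc z.
Proof. by rewrite -Re_conj_i -[leRHS]nc_conj_i Re_le_nc. Qed.

Lemma nc_le_sum z : nc z <= `|Re z| + `|Im z|.
Proof.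
case: z => a b.
have {1}-> : a +i* b = a%:C + 'i * b%:C :> R[i] by simpc.
rewrite (le_trans (nc_triangle _ _))//.
rewrite normcM !nc_real lerD2l -[leRHS]mul1r ler_wpM2r//.
by rewrite /= expr0n add0r expr1n sqrtr1.
Qed.

Lemma nc_le_bound z (b : R) : `|Re z| <= b -> `|Im z| <= b -> nc z <= 2 * b.
Proof. by move=> h1 h2; rewrite (le_trans (nc_le_sum z))// mulr2n mulrDl mul1r lerD. Qed.

(** The norm of R[i]^o takes values in R[i]; limits are computed with the real-
    valued one. *)
Lemma complex_cvg (T : Type) (F : set_system T) {FF : Filter F}
    (f : T -> R[i]) (l : R[i]) :
  nc (f x - l) @[x --> F] --> (0 : R) -> (f x : R[i]^o) @[x --> F] --> (l : R[i]^o).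
Proof.
move=> h; apply/cvgrPdist_le => e; rewrite ltcE/= => /andP[/eqP ei er].
have he : e = (Re e)%:C by case: e ei er => a b /= -> _.
move/cvgrPdist_le : h => /(_ _ er); apply: filterS => x.
rewrite sub0r normrN (ger0_norm (nc_ge0 _)) => hx.
by rewrite he distrC normcE_real lecR.
Qed.

Lemma complex_cvg_nc (T : Type) (F : set_system T) {FF : Filter F}
    (f : T -> R[i]) (l : R[i]) :
  (f x : R[i]^o) @[x --> F] --> (l : R[i]^o) -> nc (f x - l) @[x --> F] --> (0 : R).
Proof.
move=> /cvgrPdist_le h; apply/cvgrPdist_le => e e0.
have e0' : 0 < (e%:C : R[i]) by rewrite ltcR.
move: (h _ e0'); apply: filterS => x.
by move=> hx; rewrite sub0r normrN (ger0_norm (nc_ge0 _)) -lecR -normcE_real distrC.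
Qed.

Lemma complex_cvgR (T : Type) (F : set_system T) {FF : Filter F}
    (f : T -> R) (l : R) :
  f x @[x --> F] --> l -> ((f x)%:C : R[i]^o) @[x --> F] --> (l%:C : R[i]^o).
Proof.
move=> h; apply: complex_cvg.
by apply: (cvg_near_eq _ (cvg_dist0 h)); apply: nearW => x; rewrite -rmorphB nc_real.
Qed.

End ComplexNorm.

Section ComplexExp.
Variable R : realType.
Implicit Types (z w : R[i]).

Lemma cexpD z w : cexp (z + w) = cexp z * cexp w.
Proof.
case: z => a b; case: w => c d; rewrite /cexp /= expRD cosD sinD.
by apply/eqP; rewrite eq_complex/=; apply/andP; split; apply/eqP; ring.
Qed.

Lemma cexp0 : cexp (0 : R[i]) = 1.
Proof. by rewrite /cexp /= expR0 cos0 sin0 mul1r. Qed.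

Lemma nc_cexp z : nc (cexp z) = expR (Re z).
Proof.
rewrite /cexp normcM nc_real ger0_norm ?expR_ge0//.
by rewrite /= cos2Dsin2 sqrtr1 mulr1.
Qed.

Definition exp_taylor (N : nat) z : R[i] := \sum_(n < N) z ^+ n / (n`!)%:R.

Let cexp_re (a b p q s : R) : R := expR (s * a) * (p * cos (s * b) - q * sin (s * b)).

Let is_derive_cexp_re (a b p q s : R) :
  is_derive s 1 (cexp_re a b p q) (cexp_re a b (p * a - q * b) (p * b + q * a) s).
Proof.
have dm (c : R) : is_derive s 1 (fun t : R => t * c) c.
  have h : is_derive s 1 (@id R) 1 by exact: is_derive_id.
  have := @is_deriveM _ _ id (cst c) s 1 _ _ h (is_derive_cst c s 1).
  move=> h2; apply: is_derive_eq.
  by rewrite scaler0 add0r /GRing.scale/= mulr1.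
have d1 := @is_derive1_comp R expR (fun t => t * a) s _ _ (is_derive_expR _) (dm a).
have d2 := @is_derive1_comp R cos (fun t => t * b) s _ _ (is_derive_cos _) (dm b).
have d3 := @is_derive1_comp R sin (fun t => t * b) s _ _ (is_derive_sin _) (dm b).
have d4 := is_deriveB (is_deriveZ p d2) (is_deriveZ q d3).
have d5 := is_deriveM d1 d4.
apply: is_derive_eq; rewrite /cexp_re /GRing.scale/= !fctE/= /GRing.scale/=; ring.
Qed.

Let Re_cexp (a b p q s : R) :
  Re ((p +i* q) * cexp (s%:C * (a +i* b))) = cexp_re a b p q s.
Proof. by rewrite /cexp /cexp_re /=; rewrite !mul0r !subr0 !addr0; ring. Qed.

Lemma ge0_of_derive_ge0 (f f' : R -> R) (s : R) : 0 <= s ->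
  (forall t : R, is_derive t 1 f (f' t)) ->
  (forall t : R, 0 <= t <= s -> 0 <= f' t) -> f 0 <= f s.
Proof.
move=> s0 df f'0; move: s0; rewrite le_eqVlt => /predU1P[<-//|s0].
have cf : {within `[0, s], continuous f}.
  apply: continuous_subspaceT => t.
  by apply/differentiable_continuous/derivable1_diffP; have [] := df t.
have [t] := MVT s0 (fun t _ => df t) cf.
rewrite in_itv/= subr0 => /andP[t0 ts] E.
by rewrite -subr_ge0 E mulr_ge0 ?(ltW s0)// f'0// (ltW t0) (ltW ts).
Qed.

Let taylor_re (z w : R[i]) (N : nat) (s : R) : R :=
  \sum_(n < N) Re (z * w ^+ n) * (s ^+ n / n`!%:R).

Let is_derive_taylor_re (z w : R[i]) (N : nat) (s : R) :
  is_derive s 1 (taylor_re z w N.+1) (taylor_re (z * w) w N s).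
Proof.
elim: N => [|N IH].
  rewrite /taylor_re big_ord0.
  have -> : (fun s : R => \sum_(n < 1) Re (z * w ^+ n) * (s ^+ n / n`!%:R)) =
    cst (Re (z * w ^+ 0) * (1 / 1)).
    by apply/funext => t; rewrite big_ord_recr big_ord0/= add0r.
  exact: is_derive_cst.
have -> : taylor_re z w N.+2 = taylor_re z w N.+1 \+
    (fun s : R => Re (z * w ^+ N.+1) * (s ^+ N.+1 / N.+1`!%:R)).
  by apply/funext => t; rewrite /taylor_re big_ord_recr.
have -> : taylor_re (z * w) w N.+1 s = taylor_re (z * w) w N s +
    Re (z * w ^+ N.+1) * (s ^+ N / N`!%:R).
  by rewrite /taylor_re big_ord_recr/= (exprS w N) (mulrA z w).
apply: is_deriveD.
have h : is_derive s 1 (@id R) 1 by exact: is_derive_id.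
have h1 := is_deriveX N.+1 h.
have h2 := is_deriveZ (Re (z * w ^+ N.+1) / N.+1`!%:R) h1.
have -> : (fun s0 : R => Re (z * w ^+ N.+1) * (s0 ^+ N.+1 / N.+1`!%:R)) =
  (Re (z * w ^+ N.+1) / N.+1`!%:R) \*: ((@id R) ^+ N.+1).
  apply/funext => t /=; rewrite /GRing.scale/= exprfctE/=.
  by rewrite [t ^+ _ / _]mulrC mulrA.
apply: is_derive_eq; rewrite /GRing.scale/= mulr1 factS natrM.
have f0 : N`!%:R != 0 :> R by rewrite pnatr_eq0 -lt0n fact_gt0.
have n0 : N.+1%:R != 0 :> R by [].
by move: (Re _) (N.+1%:R) (N`!%:R) n0 f0 => r u v u0 v0; field; rewrite u0 v0.
Qed.

(** Induction on N along the segment from 0 to w: the derivative in s of the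
    N-th remainder for z is the remainder of order N - 1 for z * w, and a bound
    for the derivative is a bound for the function. *)
Let taylor_re_bound (w : R[i]) (N : nat) : forall (z : R[i]) (s : R), 0 <= s <= 1 ->
  `|Re (z * cexp (s%:C * w)) - taylor_re z w N s| <=
  nc z * nc w ^+ N * (s ^+ N / N`!%:R) * expR (Num.max 0 (Re w)).
Proof.
set E := expR _; have E0 : 0 < E by exact: expR_gt0.
elim: N => [|N IH] z s /andP[s0 s1].
  rewrite /taylor_re big_ord0 subr0 (le_trans (Re_le_nc _))//.
  rewrite normcM nc_cexp !expr0 fact0 divr1 !mulr1.
  rewrite ler_wpM2l ?nc_ge0// ler_expR.
  have -> : Re (s%:C * w) = s * Re w by case: (w) => a b /=; rewrite mul0r subr0.
  have [w0|w0] := leP (Re w) 0.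
    by rewrite mulr_ge0_le0.
  by rewrite ler_piMl// ltW.
pose K : R := nc (z * w) * nc w ^+ N * E.
have K0 : 0 <= K by rewrite !mulr_ge0 ?exprn_ge0 ?nc_ge0 ?ltW.
pose d (t : R) : R := Re (z * cexp (t%:C * w)) - taylor_re z w N.+1 t.
pose d' (t : R) : R := Re (z * w * cexp (t%:C * w)) - taylor_re (z * w) w N t.
have dd (t : R) : is_derive t 1 d (d' t).
  apply: is_deriveB; last exact: is_derive_taylor_re.
  case: (z) (w) => p q [a b].
  have -> : (fun t : R => Re ((p +i* q) * cexp (t%:C * (a +i* b)))) = cexp_re a b p q.
    by apply/funext => u; exact: Re_cexp.
  rewrite (_ : (p +i* q) * (a +i* b) = (p * a - q * b) +i* (p * b + q * a))//.
  by rewrite Re_cexp; exact: is_derive_cexp_re.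
have dK (t : R) : is_derive t 1 (fun t : R => K * (t ^+ N.+1 / N.+1`!%:R))
    (K * (t ^+ N / N`!%:R)).
  have h := @is_derive_taylor_re 1 1 N.+1 t.
  have h1 := @is_derive_taylor_re 1 1 N t.
  have h2 := is_deriveZ K (is_deriveB h h1).
  have S2 n (v : R) : taylor_re 1 1 n.+1 v = taylor_re 1 1 n v + v ^+ n / n`!%:R.
    by rewrite /taylor_re big_ord_recr/= expr1n mul1r mul1r.
  have -> : (fun t : R => K * (t ^+ N.+1 / N.+1`!%:R)) =
      K \*: (taylor_re 1 1 N.+2 - taylor_re 1 1 N.+1).
    by apply/funext => u; rewrite !fctE [RHS]/GRing.scale/= S2 addrAC subrr add0r.
  by apply: is_derive_eq; rewrite mul1r S2 addrAC subrr add0r.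
have d0 : d 0 = 0.
  rewrite /d mul0r cexp0 mulr1 /taylor_re big_ord_recl/= expr0 mulr1 divr1 mulr1.
  rewrite big1 ?addr0 ?subrr// => i _.
  by rewrite expr0n/= mul0r mulr0.
have hd (t : R) : 0 <= t <= s -> `|d' t| <= K * (t ^+ N / N`!%:R).
  move=> /andP[t0 ts]; rewrite /K mulrAC; apply: IH.
  by rewrite t0 (le_trans ts).
have g1 : K * (0 ^+ N.+1 / N.+1`!%:R) - d 0 <= K * (s ^+ N.+1 / N.+1`!%:R) - d s.
  apply: (@ge0_of_derive_ge0 (fun t => K * (t ^+ N.+1 / N.+1`!%:R) - d t)
    _ _ s0 (fun t => is_deriveB (dK t) (dd t))) => t ts.
  by rewrite subr_ge0 (le_trans (ler_norm _))// hd.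
have g2 : K * (0 ^+ N.+1 / N.+1`!%:R) + d 0 <= K * (s ^+ N.+1 / N.+1`!%:R) + d s.
  apply: (@ge0_of_derive_ge0 (fun t => K * (t ^+ N.+1 / N.+1`!%:R) + d t)
    _ _ s0 (fun t => is_deriveD (dK t) (dd t))) => t ts.
  by have := hd t ts; rewrite ler_norml => /andP[h _]; rewrite -lerBlDl sub0r.
move: g1 g2; rewrite d0 exprS !mul0r mulr0 subr0 addr0 => g1 g2.
have -> : nc z * nc w ^+ N.+1 * (s ^+ N.+1 / N.+1`!%:R) * E =
    K * (s ^+ N.+1 / N.+1`!%:R).
  by rewrite /K normcM [nc w ^+ N.+1]exprS; ring.
by rewrite -/(d s) ler_norml; apply/andP; split; lra.
Qed.

(** The imaginary part of the remainder is the real part after a rotation by -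
    i, so the real bound serves both; the exponential bounds |cexp (s w)| for 0
    <= s <= 1. *)
Theorem cexp_taylor_bound w (N : nat) :
  nc (cexp w - exp_taylor N w) <=
  2 * (nc w ^+ N / N`!%:R * expR (Num.max 0 (Re w))).
Proof.
have key z : nc z = 1 -> `|Re (z * (cexp w - exp_taylor N w))| <=
    nc w ^+ N / N`!%:R * expR (Num.max 0 (Re w)).
  move=> z1; have := @taylor_re_bound w N z 1.
  rewrite ler01 lexx mul1r z1 mul1r expr1n mul1r => /(_ isT).
  congr (`|_| <= _); rewrite mulrBr raddfB/=; congr (_ - _).
  rewrite /taylor_re /exp_taylor big_distrr/= raddf_sum/=; apply: eq_bigr => n _.
  rewrite expr1n mul1r mulrA.
  have -> : (n`!%:R)^-1 = (n`!%:R^-1)%:C :> R[i] by rewrite fmorphV rmorph_nat.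
  by case: (z * w ^+ n) => a b /=; rewrite mulr0 subr0.
apply: nc_le_bound.
  have := key 1; rewrite mul1r; apply.
  by rewrite -[1]/(1%:C) nc_real normr1.
rewrite -Re_conj_i; apply: key.
by rewrite -[- 'i]mulr1 nc_conj_i -[1]/(1%:C) nc_real normr1.
Qed.

Lemma nc_exp_taylor w (N : nat) : nc (exp_taylor N w) <= expR (nc w).
Proof.
apply: (@le_trans _ _ (\sum_(n < N) nc w ^+ n / n`!%:R)).
  rewrite /exp_taylor; elim: N => [|N IH].
    by rewrite !big_ord0 -[0]/(0%:C) nc_real normr0.
  rewrite !big_ord_recr/= (le_trans (nc_triangle _ _))// lerD//.
  rewrite normcM ComplexField.Normc.normcV.
  have -> : N`!%:R = (N`!%:R)%:C :> R[i] by rewrite rmorph_nat.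
  rewrite nc_real normr_nat ler_wpM2r ?invr_ge0//.
  elim: (N) => [|n IHn]; first by rewrite !expr0 -[1]/(1%:C) nc_real normr1.
  by rewrite !exprS normcM ler_wpM2l ?nc_ge0.
have h : series (exp_coeff (nc w)) @ \oo --> expR (nc w).
  exact: is_cvg_series_exp_coeff.
apply: (cvgr_to_ge h); near=> m.
rewrite /series/= big_mkord.
have Nm : (N <= m)%N by near: m; exact: nbhs_infty_ge.
rewrite -(subnKC Nm) big_split_ord/= lerDl sumr_ge0// => i _.
by rewrite divr_ge0 ?exprn_ge0 ?nc_ge0.
Unshelve. all: by end_near. Qed.

End ComplexExp.

(** * Laplace transforms of weights with exponential moments *)

Section ComplexIntegral.
Variable R : realType.
Variable D : set R.
Hypothesis mD : measurable (D : set (measurableTypeR R)).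
Implicit Types (f g : R -> R[i]).

Lemma cintegrableD f g : cintegrable D f -> cintegrable D g ->
  cintegrable D (fun u => f u + g u).
Proof.
move=> [f1 f2] [g1 g2]; split.
  apply: eq_integrable (integrableD mD f1 g1) => // u _ /=.
  by rewrite -EFinD ReD.
apply: eq_integrable (integrableD mD f2 g2) => // u _ /=.
by rewrite -EFinD ImD.
Qed.

Lemma cintegralD f g : cintegrable D f -> cintegrable D g ->
  cintegral D (fun u => f u + g u) = cintegral D f + cintegral D g.
Proof.
move=> [f1 f2] [g1 g2]; rewrite /cintegral.
apply/eqP; rewrite eq_complex/=; apply/andP; split; apply/eqP.
  by rewrite -RintegralD//; apply: eq_Rintegral => u _; rewrite ReD.
by rewrite -RintegralD//; apply: eq_Rintegral => u _; rewrite ImD.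
Qed.

Let ReM (z w : R[i]) : Re (z * w) = Re z * Re w - Im z * Im w.
Proof. by case: z; case: w. Qed.

Let ImM (z w : R[i]) : Im (z * w) = Re z * Im w + Im z * Re w.
Proof. by case: z; case: w. Qed.

Lemma cintegrableZ (z : R[i]) f : cintegrable D f ->
  cintegrable D (fun u => z * f u).
Proof.
move=> [f1 f2]; split.
  apply: eq_integrable (integrableB mD (integrableZl mD (Re z) f1)
    (integrableZl mD (Im z) f2)) => // u _ /=.
  by rewrite -!EFinM -EFinB ReM.
apply: eq_integrable (integrableD mD (integrableZl mD (Re z) f2)
  (integrableZl mD (Im z) f1)) => // u _ /=.
by rewrite -!EFinM -EFinD ImM.
Qed.

Lemma cintegralZ (z : R[i]) f : cintegrable D f ->
  cintegral D (fun u => z * f u) = z * cintegral D f.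
Proof.
move=> [f1 f2]; rewrite /cintegral.
have i1 r := integrableZl mD r f1; have i2 r := integrableZl mD r f2.
apply/eqP; rewrite eq_complex; apply/andP; split; apply/eqP.
  rewrite ReM [Re (_ +i* _)]/= [Im (_ +i* _)]/= -!RintegralZl//.
  rewrite -(RintegralB mD (i1 _) (i2 _)).
  by apply: eq_Rintegral => u _; rewrite ReM.
rewrite ImM [Re (_ +i* _)]/= [Im (_ +i* _)]/= -!RintegralZl//.
rewrite -(RintegralD mD (i2 _) (i1 _)).
by apply: eq_Rintegral => u _; rewrite ImM.
Qed.

Lemma cintegralB f g : cintegrable D f -> cintegrable D g ->
  cintegral D (fun u => f u - g u) = cintegral D f - cintegral D g.
Proof.
move=> hf hg; rewrite -mulN1r -cintegralZ// -cintegralD//; last exact: cintegrableZ.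
by congr cintegral; apply/funext => u; rewrite mulN1r.
Qed.

Lemma cintegrableR (r : R -> R) : mu.-integrable D (fun u => (r u)%:E) ->
  cintegrable D (fun u => (r u)%:C).
Proof. by move=> h; split => //=; exact: integrable0. Qed.

Lemma cintegralR (r : R -> R) :
  cintegral D (fun u => (r u)%:C) = (Rintegral mu D r)%:C.
Proof. by rewrite /cintegral /=; congr (_ +i* _); rewrite Rintegral_cst ?mul0r. Qed.

Lemma eq_cintegral f g : {in D, f =1 g} -> cintegral D f = cintegral D g.
Proof.
move=> fg; rewrite /cintegral; congr (_ +i* _);
by apply: eq_Rintegral => u uD; rewrite fg.
Qed.

Lemma nc_cintegral_le f (b : R -> R) : cintegrable D f ->
  mu.-integrable D (fun u => (b u)%:E) ->
  (forall u, D u -> nc (f u) <= b u) ->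
  nc (cintegral D f) <= 2 * Rintegral mu D b.
Proof.
move=> [f1 f2] ib fb; apply: nc_le_bound => /=.
  rewrite (le_trans (le_normr_Rintegral mD f1))//.
  apply: le_Rintegral => //; first exact: integrable_norm f1.
  by move=> u /fb; apply: le_trans; exact: Re_le_nc.
rewrite (le_trans (le_normr_Rintegral mD f2))//.
apply: le_Rintegral => //; first exact: integrable_norm f2.
by move=> u /fb; apply: le_trans; exact: Im_le_nc.
Qed.

End ComplexIntegral.

Section Laplace.
Variable R : realType.
Variable k : R -> R.
Notation pos := (`](0:R), +oo[%classic).
Hypothesis mk : measurable_fun pos k.

Definition laplace_weight (c : R) : Prop := forall n : nat,
  mu.-integrable pos (fun u => (u ^+ n * k u * expR (c * u))%:E).

(** The factor (- u) ^ n is the effect of n differentiations with respect to x. *)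
Definition laplace_fun (n : nat) (x : R[i]) (u : R) : R[i] :=
  cexp (- (x * u%:C)) * ((- u) ^+ n * k u)%:C.

Definition laplace (n : nat) (x : R[i]) : R[i] := cintegral pos (laplace_fun n x).

Lemma laplace_weight_abs (c : R) (n : nat) : laplace_weight c ->
  mu.-integrable pos (fun u => (u ^+ n * `|k u| * expR (c * u))%:E).
Proof.
move=> hc; apply: eq_integrable (integrable_norm (hc n)) => // u.
rewrite inE/= in_itv/= andbT => u0.
by rewrite !normrM normrX (ger0_norm (ltW u0)) (ger0_norm (expR_ge0 _)).
Qed.

Let Re_lap (n : nat) (x : R[i]) (u : R) : Re (laplace_fun n x u) =
  expR (- (Re x * u)) * cos (Im x * u) * ((- u) ^+ n * k u).
Proof.
rewrite /laplace_fun /cexp; case: x => a b /=.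
by rewrite !mulr0 !mul0r ?subr0 ?add0r ?addr0 cosN; ring.
Qed.

Let Im_lap (n : nat) (x : R[i]) (u : R) : Im (laplace_fun n x u) =
  - (expR (- (Re x * u)) * sin (Im x * u) * ((- u) ^+ n * k u)).
Proof.
rewrite /laplace_fun /cexp; case: x => a b /=.
by rewrite !mulr0 !mul0r ?subr0 ?add0r ?addr0 sinN; ring.
Qed.

Lemma nc_laplace_fun (n : nat) (x : R[i]) (u : R) : 0 < u ->
  nc (laplace_fun n x u) = expR (- (Re x * u)) * (u ^+ n * `|k u|).
Proof.
move=> u0; rewrite /laplace_fun normcM nc_cexp nc_real.
rewrite normrM normrX normrN (gtr0_norm u0); congr (expR _ * _).
by case: (x) => a b /=; rewrite mulr0 subr0.
Qed.

Lemma laplace_integrable (n : nat) (x : R[i]) (c : R) : laplace_weight c ->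
  - c <= Re x -> cintegrable pos (laplace_fun n x).
Proof.
move=> hc cx.
have B (u : R) : 0 < u -> nc (laplace_fun n x u) <= u ^+ n * `|k u| * expR (c * u).
  move=> u0; rewrite nc_laplace_fun// mulrC ler_wpM2l ?mulr_ge0 ?exprn_ge0 ?(ltW u0)//.
  by rewrite ler_expR -mulNr ler_pM2r// lerNl.
have mexp : measurable_fun pos (fun u : R => expR (- (Re x * u))).
  by apply: measurableT_comp => //; apply: measurableT_comp => //; exact: measurable_funM.
have mcs (f : R -> R) : continuous f -> measurable_fun pos (fun u : R => f (Im x * u)).
  move=> cf; apply: (measurableT_comp (continuous_measurable_fun cf)).
  exact: measurable_funM.
have mp : measurable_fun pos (fun u : R => (- u) ^+ n * k u).
  by apply: measurable_funM => //; apply: measurable_funX; exact: oppr_measurable.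
split; apply: le_integrable (laplace_weight_abs n hc) => //.
- apply/measurable_EFinP.
  apply: (eq_measurable_fun (fun u =>
    expR (- (Re x * u)) * cos (Im x * u) * ((- u) ^+ n * k u))).
    by move=> u _; rewrite Re_lap.
  by do 2 apply: measurable_funM => //; exact: (mcs _ (@continuous_cos R)).
- move=> u /posP u0; rewrite !abse_EFin lee_fin.
  by rewrite (le_trans (Re_le_nc _))// (le_trans (B u u0))// ler_norm.
- apply/measurable_EFinP.
  apply: (eq_measurable_fun (fun u =>
    - (expR (- (Re x * u)) * sin (Im x * u) * ((- u) ^+ n * k u)))).
    by move=> u _; rewrite Im_lap.
  apply: measurableT_comp => //.
  by do 2 apply: measurable_funM => //; exact: (mcs _ (@continuous_sin R)).
- move=> u /posP u0; rewrite !abse_EFin lee_fin.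
  by rewrite (le_trans (Im_le_nc _))// (le_trans (B u u0))// ler_norm.
Qed.

(** The integrand is cexp (- x u) times the second-order Taylor remainder of
    cexp (- h u), and the weight u^(n+2) |k u| e^(c u) absorbs it uniformly in
    x. Boundary points of the half-plane are included, which yields one-sided
    derivatives. *)
Theorem laplace_quadratic (n : nat) (c : R) : laplace_weight c ->
  exists2 C, 0 <= C & forall x h : R[i], - c <= Re x -> - c <= Re (x + h) ->
  nc (laplace n (x + h) - laplace n x - h * laplace n.+1 x) <= C * nc h ^+ 2.
Proof.
move=> hc; have iw := laplace_weight_abs n.+2 hc.
exists (2 * Rintegral mu pos (fun u => u ^+ n.+2 * `|k u| * expR (c * u))).
  rewrite mulr_ge0//; apply: Rintegral_ge0 => u /posP u0.
  by rewrite mulr_ge0 ?expR_ge0// mulr_ge0// exprn_ge0// ltW.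
move=> x h cx cxh.
have i1 := laplace_integrable n hc cxh.
have i2 := laplace_integrable n hc cx.
have i3 := cintegrableZ (@measurable_pos R) h (laplace_integrable n.+1 hc cx).
have i2N := cintegrableZ (@measurable_pos R) (-1) i2; have i3N := cintegrableZ (@measurable_pos R) (-1) i3.
have i12 : cintegrable pos (fun u => laplace_fun n (x + h) u - laplace_fun n x u).
  have := cintegrableD (@measurable_pos R) i1 i2N; congr (cintegrable _ _).
  by apply/funext => u; rewrite mulN1r.
have i123 : cintegrable pos (fun u => laplace_fun n (x + h) u - laplace_fun n x u -
     h * laplace_fun n.+1 x u).
  have := cintegrableD (@measurable_pos R) i12 i3N; congr (cintegrable _ _).
  by apply/funext => u; rewrite mulN1r.
rewrite /laplace -cintegralZ//; last exact: laplace_integrable hc cx.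
rewrite -cintegralB// -cintegralB//.
rewrite -mulrA -RintegralZr//.
apply: nc_cintegral_le => //.
  exact: eq_integrable (integrableZr (@measurable_pos R) (nc h ^+ 2) iw).
move=> u /posP u0.
pose z : R[i] := - (h * u%:C).
have -> : laplace_fun n (x + h) u - laplace_fun n x u - h * laplace_fun n.+1 x u =
    cexp (- (x * u%:C)) * (cexp z - exp_taylor 2 z) * ((- u) ^+ n * k u)%:C.
  have E2 : exp_taylor 2 z = 1 + z.
    rewrite /exp_taylor !big_ord_recr big_ord0/= add0r expr0 expr1.
    by rewrite fact0 divr1 -[1`!]/1%N divr1.
  have E3 : ((- u) ^+ n.+1 * k u)%:C = - u%:C * ((- u) ^+ n * k u)%:C.
    by rewrite exprS -mulrA rmorphM rmorphN.
  rewrite /laplace_fun E2 E3 [(x + h) * _]mulrDl opprD cexpD -/z /z.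
  move: (u%:C) (((- u) ^+ n * k u)%:C) (cexp _) (cexp _) => v r e1 e2; ring.
rewrite 2!normcM nc_cexp nc_real.
have Rx : Re (- (x * u%:C)) = - (Re x * u).
  by case: (x) => a b /=; rewrite mulr0 subr0.
have Rz : Re z = - (Re h * u).
  by rewrite /z; case: (h) => a b /=; rewrite mulr0 subr0.
have ncz : nc z = nc h * u.
  by rewrite /z ncN normcM nc_real gtr0_norm.
have T := cexp_taylor_bound z 2; rewrite ncz Rz in T.
have E : expR (- (Re x * u)) * expR (Num.max 0 (- (Re h * u))) <= expR (c * u).
  rewrite -expRD ler_expR; have [h0|h0] := leP 0 (- (Re h * u)).
    have : - c * u <= Re (x + h) * u by rewrite ler_pM2r.
    by rewrite ReD mulrDl mulNr; lra.
  have : - c * u <= Re x * u by rewrite ler_pM2r.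
  by rewrite mulNr; lra.
rewrite Rx normrM normrX normrN (gtr0_norm u0).
have k0 : 0 <= u ^+ n * `|k u| by rewrite mulr_ge0// exprn_ge0// ltW.
apply: le_trans (ler_wpM2r k0 (ler_wpM2l (expR_ge0 _) T)) _.
have -> : expR (- (Re x * u)) *
  (2 * ((nc h * u) ^+ 2 / 2`!%:R * expR (Num.max 0 (- (Re h * u))))) * (u ^+ n * `|k u|) =
  (u ^+ n.+2 * `|k u| * (expR (- (Re x * u)) * expR (Num.max 0 (- (Re h * u))))) * nc h ^+ 2.
  rewrite -[2`!]/2%N !exprS expr0; move: (expR _) (expR _) => e1 e2.
  by field.
rewrite ler_wpM2r ?exprn_ge0 ?nc_ge0// ler_wpM2l//.
by rewrite mulr_ge0// exprn_ge0// ltW.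
Qed.

Definition laplace_moment (n : nat) : R := Rintegral mu pos (fun u => u ^+ n * k u).

Lemma laplace_weight0_moment (c : R) (n : nat) : laplace_weight c -> 0 <= c ->
  mu.-integrable pos (fun u => (u ^+ n * k u)%:E).
Proof.
move=> hc c0; apply: le_integrable (hc n) => //.
  by apply/measurable_EFinP; apply: measurable_funM.
move=> u /posP u0; rewrite !abse_EFin lee_fin [leRHS]normrM.
by rewrite ler_peMr// ger0_norm ?expR_ge0// -[leLHS]expR0 ler_expR mulr_ge0// ltW.
Qed.

(** The Taylor polynomials of cexp (- x u) are dominated by e^(c u) when |x| <=
    c. *)
Theorem laplace_series (x : R[i]) (c : R) : laplace_weight c -> nc x <= c ->
  (powser (fun n => (laplace_moment n / n`!%:R)%:C) (- x) N : R[i]^o)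
    @[N --> \oo] --> (laplace 0 x : R[i]^o).
Proof.
move=> hc xc; have c0 : 0 <= c by rewrite (le_trans (nc_ge0 x)).
have cx : - c <= Re x.
  rewrite lerNl (le_trans _ xc)// (le_trans _ (Re_le_nc x))//.
  by rewrite -normrN ler_norm.
have i0 := laplace_integrable 0 hc cx.
pose T N (u : R) : R[i] := exp_taylor N (- (x * u%:C)) * (k u)%:C.
have TE N : cintegrable pos (T N) /\
    cintegral pos (T N) = powser (fun n => (laplace_moment n / n`!%:R)%:C) (- x) N.
  have E : T N = fun u => \sum_(n < N) (n`!%:R^-1 * (- x) ^+ n) * (u ^+ n * k u)%:C.
    apply/funext => u; rewrite /T /exp_taylor big_distrl/=; apply: eq_bigr => n _.
    rewrite -mulNr exprMn rmorphM rmorphXn/=.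
    by move: ((- x) ^+ n) (u%:C ^+ n) ((n`!)%:R^-1) => a b d; ring.
  rewrite E /powser /series/= big_mkord; elim: N {E} => [|N [IH1 IH2]].
    under [X in cintegrable _ X]eq_fun do rewrite big_ord0.
    under [X in cintegral _ X]eq_fun do rewrite big_ord0.
    have h0 : cintegrable pos (fun _ : R => (0 : R)%:C).
      by apply: cintegrableR => //; exact: integrable0.
    rewrite big_ord0; split; first exact: h0.
    rewrite -[RHS]/((0 : R)%:C) -[in RHS](mul0r (fine (mu pos))).
    by rewrite -(Rintegral_cst mu (@measurable_pos R) 0); exact: (cintegralR (@measurable_pos R) (fun=> 0)).
  under [X in cintegrable _ X]eq_fun do rewrite big_ord_recr/=.
  under [X in cintegral _ X]eq_fun do rewrite big_ord_recr/=.
  have iN := cintegrableR (laplace_weight0_moment N hc c0).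
  have iN' := cintegrableZ (@measurable_pos R) (N`!%:R^-1 * (- x) ^+ N) iN.
  split; first exact: cintegrableD.
  rewrite big_ord_recr/= cintegralD// IH2; congr (_ + _).
  rewrite cintegralZ// cintegralR//= -/(laplace_moment N) rmorphM fmorphV rmorph_nat.
  by rewrite mulrC mulrA.
apply: complex_cvg.
have conv (P : R[i] -> R) (hP : forall z w, P (z - w) = P z - P w)
    (hb : forall z, `|P z| <= nc z)
    (hI : forall f, P (cintegral pos f) = Rintegral mu pos (fun u => P (f u)))
    (mP : forall f, cintegrable pos f -> mu.-integrable pos (fun u => (P (f u))%:E)) :
    P (cintegral pos (T N)) @[N --> \oo] --> P (laplace 0 x).
  rewrite hI; under eq_fun do rewrite hI.
  have := @dominated_convergence _ _ R mu pos (@measurable_pos R)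
    (fun N u => (P (T N u))%:E) (fun u => (P (laplace_fun 0 x u))%:E)
    (fun u => (u ^+ 0 * `|k u| * expR (c * u))%:E).
  case.
  - by move=> N; have [iT _] := TE N; exact: (measurable_int _ (mP _ iT)).
  - exact: (measurable_int _ (mP _ i0)).
  - apply: aeW => u /posP u0.
    apply: cvg_EFin; first exact: nearW.
    apply/cvgrPdist_le => e e0.
    pose w := - (x * u%:C).
    have h : 2 * (nc w ^+ N / N`!%:R * expR (Num.max 0 (Re w))) * `|k u|
        @[N --> \oo] --> (0 : R).
      rewrite -[X in _ --> X](mul0r `|k u|); apply: cvgM; last exact: cvg_cst.
      rewrite -[X in _ --> X](mulr0 2); apply: cvgM; first exact: cvg_cst.
      rewrite -[X in _ --> X](mul0r (expR (Num.max 0 (Re w)))).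
      apply: cvgM; last exact: cvg_cst.
      exact: (@cvg_exp_coeff R (nc w)).
    have : \forall N \near \oo, 2 * (nc w ^+ N / N`!%:R * expR (Num.max 0 (Re w))) * `|k u| <= e.
      by apply: (cvgr_le _ h).
    apply: filterS => N; apply: le_trans.
    rewrite -hP (le_trans (hb _))// /laplace_fun /T expr0 mul1r -/w -mulrBl.
    rewrite normcM nc_real ler_wpM2r//.
    exact: cexp_taylor_bound.
  - exact: laplace_weight_abs.
  - apply: aeW => u N /posP u0; rewrite abse_EFin lee_fin expr0 mul1r.
    rewrite (le_trans (hb _))// /T normcM nc_real mulrC ler_wpM2l//.
    rewrite (le_trans (nc_exp_taylor _ _))// ler_expR ncN.
    by rewrite normcM nc_real gtr0_norm// ler_pM2r.
  - move=> iP _ h; rewrite /Rintegral; apply: fine_cvg.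
    rewrite fineK; last exact: integrable_fin_num (mP _ i0).
    exact: h.
have cRe := conv Re (@ReB R) (@Re_le_nc R) (fun f => erefl) (fun f h => h.1).
have cIm := conv Im (@ImB R) (@Im_le_nc R) (fun f => erefl) (fun f h => h.2).
have lim : `|Re (cintegral pos (T N)) - Re (laplace 0 x)| +
    `|Im (cintegral pos (T N)) - Im (laplace 0 x)| @[N --> \oo] --> (0 : R).
  by rewrite -[X in _ --> X]addr0; apply: cvgD; exact: cvg_dist0.
apply: (squeeze_cvgr _ (cvg_cst (0 : R)) lim); apply: nearW => N.
rewrite nc_ge0/=; have [_ <-] := TE N.
by rewrite (le_trans (nc_le_sum _))// ReB ImB.
Qed.

End Laplace.

(** * Complex derivatives *)

Section ComplexDerivative.
Variable R : realType.
Implicit Types (F G : R[i] -> R[i]) (z w d h : R[i]).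

(** Derivative without quotients, with the real-valued norm, which makes the
    algebra of derivatives elementary; cderiv_of_derivable and
    derivable_of_cderiv relate it to derivability in R[i]^o. *)
Definition cderiv_at F z d : Prop := forall e : R, 0 < e ->
  exists2 de : R, 0 < de & forall h, nc h < de ->
    nc (F (z + h) - F z - h * d) <= e * nc h.

Lemma nc0 : nc (0 : R[i]) = 0. Proof. by rewrite -[0]/(0%:C) nc_real normr0. Qed.

Lemma cderiv_lip F z d : cderiv_at F z d ->
  exists2 de : R, 0 < de & forall h, nc h < de ->
    nc (F (z + h) - F z) <= (nc d + 1) * nc h.
Proof.
move=> /(_ 1 ltr01) [de de0 H]; exists de => // h hd.
have := H h hd; rewrite mul1r => H1.
have -> : F (z + h) - F z = (F (z + h) - F z - h * d) + h * d by rewrite subrK.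
rewrite (le_trans (nc_triangle _ _))// normcM mulrDl mul1r addrC.
by rewrite [nc d * _]mulrC lerD2l.
Qed.

Lemma cderiv_opp z : cderiv_at (fun w => - w) z (-1).
Proof.
move=> e e0; exists 1 => // h _.
by rewrite [X in nc X](_ : _ = 0) ?nc0 ?mulr_ge0 ?nc_ge0 ?ltW//; ring.
Qed.

Lemma cderiv_addc F z d c : cderiv_at F z d -> cderiv_at (fun w => F w + c) z d.
Proof.
move=> H e /H [de de0 h]; exists de => // k /h; congr (nc _ <= _); ring.
Qed.

Lemma cderiv_shift F z d c : cderiv_at F (z + c) d ->
  cderiv_at (fun w => F (w + c)) z d.
Proof.
by move=> H e /H [de de0 h]; exists de => // k /h; rewrite [z + k + c]addrAC.
Qed.

Lemma cderivB F G z d d' : cderiv_at F z d -> cderiv_at G z d' ->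
  cderiv_at (fun w => F w - G w) z (d - d').
Proof.
move=> HF HG e e0; have e2 : 0 < e / 2 by rewrite divr_gt0.
have [d1 d10 h1] := HF _ e2; have [d2 d20 h2] := HG _ e2.
exists (Num.min d1 d2) => [|h]; first by rewrite lt_min d10 d20.
rewrite lt_min => /andP[hd1 hd2].
have -> : F (z + h) - G (z + h) - (F z - G z) - h * (d - d') =
  (F (z + h) - F z - h * d) + - (G (z + h) - G z - h * d') by ring.
rewrite (le_trans (nc_triangle _ _))// ncN.
have := h1 h hd1; have := h2 h hd2; lra.
Qed.

Lemma cderivM F G z d d' : cderiv_at F z d -> cderiv_at G z d' ->
  cderiv_at (fun w => F w * G w) z (d * G z + F z * d').
Proof.
move=> HF HG e e0.
pose K := nc (F z) + nc (G z) + (nc d + 1) * (nc d' + 1) + 1.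
have K1 : 1 <= K.
  by rewrite lerDr addr_ge0 ?addr_ge0 ?nc_ge0// mulr_ge0// addr_ge0 ?nc_ge0.
have K0 : 0 < K by exact: lt_le_trans K1.
have eK : 0 < e / K by rewrite divr_gt0.
have [d1 d10 h1] := HF _ eK; have [d2 d20 h2] := HG _ eK.
have [d3 d30 h3] := cderiv_lip HF; have [d4 d40 h4] := cderiv_lip HG.
exists (Num.min (Num.min d1 d2) (Num.min (Num.min d3 d4) (e / K))) => [|h].
  by rewrite !lt_min d10 d20 d30 d40 eK.
rewrite !lt_min => /andP[/andP[hd1 hd2] /andP[/andP[hd3 hd4] hd5]].
have -> : F (z + h) * G (z + h) - F z * G z - h * (d * G z + F z * d') =
  (F (z + h) - F z - h * d) * G z + F z * (G (z + h) - G z - h * d') +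
  (F (z + h) - F z) * (G (z + h) - G z) by ring.
rewrite (le_trans (nc_triangle _ _))//.
rewrite (le_trans (lerD (nc_triangle _ _) (lexx _)))// !normcM.
have A1 := ler_wpM2r (nc_ge0 (G z)) (h1 h hd1).
have A2 := ler_wpM2l (nc_ge0 (F z)) (h2 h hd2).
have A3 := ler_pM (nc_ge0 _) (nc_ge0 _) (h3 h hd3) (h4 h hd4).
have hn := nc_ge0 h.
have A4 : (nc d + 1) * nc h * ((nc d' + 1) * nc h) <=
    (nc d + 1) * (nc d' + 1) * (e / K * nc h).
  rewrite mulrACA ler_wpM2l ?mulr_ge0 ?addr_ge0 ?nc_ge0//.
  by rewrite ler_wpM2r// ltW.
have E : e * nc h = K * (e / K * nc h) by field; rewrite gt_eqF.
rewrite E {1}/K.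
have X0 : 0 <= e / K * nc h by rewrite mulr_ge0// ltW.
move: A1 A2 A3 A4 X0; move: (e / K * nc h) => X A1 A2 A3 A4 X0.
by lra.
Qed.

Lemma cderiv_comp F G z d d' : cderiv_at G z d' -> cderiv_at F (G z) d ->
  cderiv_at (fun w => F (G w)) z (d * d').
Proof.
move=> HG HF e e0.
pose K := nc d' + 1 + nc d + 1.
have nd := nc_ge0 d; have nd' := nc_ge0 d'.
have K0 : 0 < K by rewrite /K; lra.
have eK : 0 < e / K by rewrite divr_gt0.
have [d1 d10 h1] := HF _ eK; have [d2 d20 h2] := HG _ eK.
have [d3 d30 h3] := cderiv_lip HG.
exists (Num.min (Num.min d2 d3) (d1 / (nc d' + 1))) => [|h].
  by rewrite !lt_min d20 d30 divr_gt0//; lra.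
rewrite !lt_min => /andP[/andP[hd2 hd3] hd1].
pose k := G (z + h) - G z.
have kh : nc k <= (nc d' + 1) * nc h by exact: h3.
have kd : nc k < d1.
  rewrite (le_lt_trans kh)// mulrC -ltr_pdivlMr//; lra.
have Gk : G z + k = G (z + h) by rewrite /k addrC subrK.
have := h1 k kd; rewrite Gk => H1.
have -> : F (G (z + h)) - F (G z) - h * (d * d') =
  (F (G (z + h)) - F (G z) - k * d) + (G (z + h) - G z - h * d') * d.
  by rewrite /k; ring.
rewrite (le_trans (nc_triangle _ _))// normcM.
have H2 := ler_wpM2r nd (h2 h hd2).
have H3 := ler_wpM2l (ltW eK) kh.
have E : e * nc h = K * (e / K * nc h) by field; rewrite gt_eqF.
rewrite E {1}/K.
have H4 : e / K * ((nc d' + 1) * nc h) = (nc d' + 1) * (e / K * nc h) by ring.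
rewrite H4 in H3.
have X0 : 0 <= e / K * nc h by rewrite mulr_ge0 ?nc_ge0// ltW.
move: H1 H2 H3 X0; move: (e / K * nc h) (e / K * nc k) => X Y H1 H2 H3 X0.
by lra.
Qed.

Lemma cderiv_cexp z : cderiv_at (@cexp R) z (cexp z).
Proof.
move=> e e0; pose K := nc (cexp z) * expR 1.
have K0 : 0 <= K by rewrite mulr_ge0 ?nc_ge0 ?expR_ge0.
have K1 : 0 < K + 1 by lra.
exists (Num.min 1 (e / (K + 1))) => [|h]; first by rewrite lt_min ltr01 divr_gt0.
rewrite lt_min => /andP[h1 he].
have E2 : exp_taylor 2 h = 1 + h.
  rewrite /exp_taylor !big_ord_recr big_ord0/= add0r expr0 expr1.
  by rewrite fact0 divr1 -[1`!]/1%N divr1.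
have -> : cexp (z + h) - cexp z - h * cexp z = cexp z * (cexp h - exp_taylor 2 h).
  by rewrite E2 cexpD; move: (cexp z) (cexp h) => a b; ring.
rewrite normcM.
have T : nc (cexp h - exp_taylor 2 h) <= nc h ^+ 2 * expR 1.
  rewrite (le_trans (cexp_taylor_bound h 2))// -[2`!]/2%N.
  rewrite mulrA [2 * _]mulrC divfK// ler_wpM2l ?exprn_ge0 ?nc_ge0// ler_expR.
  rewrite ge_max ler01/= (le_trans (ler_norm _))// (le_trans (Re_le_nc _))//.
  exact: ltW.
rewrite (le_trans (ler_wpM2l (nc_ge0 _) T))//.
have -> : nc (cexp z) * (nc h ^+ 2 * expR 1) = (nc h * K) * nc h by rewrite /K; ring.
rewrite ler_wpM2r ?nc_ge0//.
have : nc h * (K + 1) <= e by rewrite -ler_pdivlMr// ltW.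
have := nc_ge0 h; lra.
Qed.

Lemma cderiv_of_derivable F z : derivable (F : R[i]^o -> R[i]^o) z 1 ->
  exists d, cderiv_at F z d.
Proof.
move=> /cvg_ex[/= d hd]; exists d => e e0.
have h1 : nc (h^-1 *: (F (h *: (1 : R[i]^o) + z) - F z) - d)
    @[h --> (0 : R[i]^o)^'] --> (0 : R) by exact: (complex_cvg_nc hd).
move/cvgrPdist_le : h1 => /(_ _ e0).
rewrite near_withinE => /nbhs_ballP[r r0 hr].
have [r' r'0 rr'] : exists2 r' : R, 0 < r' & r'%:C <= r.
  move: r0; rewrite /= ltcE/= => /andP[/eqP ri r0]; exists (Re r) => //.
  by case: (r) ri r0 => a b /= -> _; rewrite lexx.
exists r' => // h hr'.
have [->|h0] := eqVneq h 0.
  by rewrite addr0 subrr mul0r subr0 nc0 mulr0.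
have hb : ball (0 : R[i]^o) r h.
  rewrite -ball_normE /= sub0r normrN normcE_real (lt_le_trans _ rr')//.
  by rewrite ltcR.
have := hr h hb h0; rewrite sub0r normrN ger0_norm ?nc_ge0//.
have nh : 0 < nc h.
  rewrite lt_neqAle nc_ge0 andbT eq_sym; apply: contraNneq h0 => /eqP.
  by move=> /eqP/ComplexField.Normc.eq0_normc ->.
rewrite -(ler_pM2r nh) -normcM; congr (nc _ <= _).
rewrite mulrBl [d * h]mulrC; congr (_ - _).
rewrite /= /GRing.scale/= mulr1 [h + z]addrC.
by move: (F _ - F _) => A; field.
Qed.

Lemma derivable_of_cderiv F z d : cderiv_at F z d ->
  derivable (F : R[i]^o -> R[i]^o) z 1.
Proof.
move=> H; apply/cvg_ex; exists d; apply: complex_cvg.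
apply/cvgrPdist_le => e e0; have [r r0 hr] := H e e0.
rewrite near_withinE; apply/nbhs_ballP; exists (r%:C) => /=.
  by rewrite ltcR.
move=> h; rewrite -ball_normE /= sub0r normrN normcE_real ltcR => hh h0.
rewrite sub0r normrN ger0_norm ?nc_ge0//.
have nh : 0 < nc h.
  rewrite lt_neqAle nc_ge0 andbT eq_sym; apply: contraNneq h0 => /eqP.
  by move=> /eqP/ComplexField.Normc.eq0_normc ->.
rewrite -(ler_pM2r nh) -normcM.
have := hr h hh; congr (nc _ <= _).
rewrite mulrBl [d * h]mulrC; congr (_ - _).
rewrite /= /GRing.scale/= mulr1 [h + z]addrC.
by move: (F _ - F _) => A; field.
Qed.

End ComplexDerivative.

(** * Goursat's theorem for rectangles *)

Section Goursat.
Variable R : realType.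
Implicit Types (f : R -> R[i]) (Phi : R[i] -> R[i]).

(** The continuity that a derivative provides directly; it is stable under
    restriction to horizontal and vertical lines. *)
Definition lip_at f (t : R) : Prop := exists L, exists2 r : R, 0 < r &
  forall h, `|h| < r -> nc (f (t + h) - f t) <= L * `|h|.

Let lip_continuous (f : R -> R[i]) (P : R[i] -> R) (t : R) : lip_at f t ->
  (forall z w, P (z - w) = P z - P w) -> (forall z, `|P z| <= nc z) ->
  {for t, continuous (fun s => P (f s))}.
Proof.
move=> [L [r r0 H]] PB Pb; apply/cvgrPdist_le => e e0; near=> s.
have L1 : 0 < `|L| + 1 by rewrite ltr_wpDl.
have d1 : `|s - t| < r.
  by rewrite distrC; near: s; exact: cvgr_dist_lt.
have d2 : `|s - t| <= e / (`|L| + 1).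
  rewrite distrC; near: s; apply: cvgr_dist_le => //.
  by rewrite divr_gt0.
rewrite distrC -PB (le_trans (Pb _))//.
have ts : t + (s - t) = s by rewrite addrC subrK.
have := H _ d1; rewrite ts => /le_trans; apply.
rewrite (@le_trans _ _ ((`|L| + 1) * `|s - t|))//.
  by rewrite ler_wpM2r// (le_trans (ler_norm L))// lerDl.
by rewrite mulrC -ler_pdivlMr.
Unshelve. all: by end_near. Qed.

Lemma lip_cintegrable (f : R -> R[i]) (a b : R) :
  (forall t, a <= t <= b -> lip_at f t) -> cintegrable `[a, b] f.
Proof.
move=> H; split; apply: continuous_compact_integrable;
  (try exact: segment_compact); apply: continuous_in_subspaceT => t;
  rewrite inE/= in_itv/= => /H /lip_continuous; apply.
- exact: ReB.
- exact: Re_le_nc.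
- exact: ImB.
- exact: Im_le_nc.
Qed.

Lemma lip_atB f g t : lip_at f t -> lip_at g t -> lip_at (fun s => f s - g s) t.
Proof.
move=> [L [r r0 H]] [L' [r' r'0 H']]; exists (L + L'), (Num.min r r').
  by rewrite lt_min r0.
move=> h; rewrite lt_min => /andP[h1 h2].
have -> : f (t + h) - g (t + h) - (f t - g t) =
  (f (t + h) - f t) + - (g (t + h) - g t) by ring.
by rewrite (le_trans (nc_triangle _ _))// ncN mulrDl lerD ?H ?H'.
Qed.

Definition cdiff_at Phi (z : R[i]) := exists d, cderiv_at Phi z d.

Lemma lip_horizontal Phi (t y : R) : cdiff_at Phi (t +i* y) ->
  lip_at (fun s => Phi (s +i* y)) t.
Proof.
move=> [d /cderiv_lip[r r0 H]]; exists (nc d + 1), r => // h hr.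
have -> : (t + h) +i* y = (t +i* y) + h%:C :> R[i] by simpc.
by rewrite -nc_real; apply: H; rewrite nc_real.
Qed.

Lemma lip_vertical Phi (x t : R) : cdiff_at Phi (x +i* t) ->
  lip_at (fun s => Phi (x +i* s)) t.
Proof.
move=> [d /cderiv_lip[r r0 H]]; exists (nc d + 1), r => // h hr.
have -> : x +i* (t + h) = (x +i* t) + 'i * h%:C :> R[i] by simpc.
have E : nc ('i * h%:C) = `|h|.
  by rewrite -nc_conj_i mulrA mulNr -expr2 sqr_i opprK mul1r nc_real.
by rewrite -E; apply: H; rewrite E.
Qed.

Let mseg (a b : R) : measurable (`[a, b] : set (measurableTypeR R)).
Proof. exact: measurable_itv. Qed.

Lemma cintegral_split f (a b c : R) : a <= b -> b <= c ->
  cintegrable `[a, c] f ->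
  cintegral `[a, c] f = cintegral `[a, b] f + cintegral `[b, c] f.
Proof.
move=> ab bc [h1 h2].
have key (g : R -> R) : mu.-integrable `[a, c] (EFin \o g) ->
    Rintegral mu `[a, c] g = Rintegral mu `[a, b] g + Rintegral mu `[b, c] g.
  move=> ig.
  have ig' : mu.-integrable `]b, c] (EFin \o g).
    apply: integrableS ig => // t /=; rewrite !in_itv/= => /andP[bt ->].
    by rewrite (le_trans ab (ltW bt)).
  have E := @Rintegral_itvB R g (BLeft a) (BRight c) b ig.
  rewrite -(@Rintegral_itv_obnd_cbnd R b (BRight c) g ig') -E ?bnd_simp//.
  by rewrite addrC subrK.
by rewrite /cintegral !key//; simpc.
Qed.

Lemma cintegral_cst (a b : R) (c : R[i]) : a <= b ->
  cintegral `[a, b] (fun=> c) = (b - a)%:C * c.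
Proof.
move=> ab; rewrite /cintegral !Rintegral_cst//= lebesgue_measure_itv/=.
rewrite lte_fin; case: ltgtP ab => [ab _|//|-> _]/=; last first.
  by rewrite subrr mul0r !mulr0.
by case: c => u v /=; simpc; rewrite ![_ * (b - a)]mulrC.
Qed.

Lemma cintegrable_cst (a b : R) (c : R[i]) : cintegrable `[a, b] (fun=> c).
Proof.
apply: lip_cintegrable => t _; exists 0, 1 => // h _.
by rewrite subrr nc0 mul0r.
Qed.

Lemma nc_cintegral_segment_le f (a b B : R) : a <= b -> cintegrable `[a, b] f ->
  (forall t, a <= t <= b -> nc (f t) <= B) ->
  nc (cintegral `[a, b] f) <= 2 * ((b - a) * B).
Proof.
move=> ab hf fB; have [cB _] := cintegrable_cst a b B%:C.
apply: le_trans (nc_cintegral_le (b := fun=> B) (mseg _ _) hf cB _) _.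
  by move=> t /=; rewrite in_itv/=; exact: fB.
have := @cintegral_cst a b B%:C ab.
by rewrite cintegralR// -rmorphM/= => /complexI ->.
Qed.

(** Contour integral over the boundary of [x, x + a] * [y, y + b], with opposite
    sides paired. *)
Definition rect_int Phi (x y a b : R) : R[i] :=
  cintegral `[x, x + a] (fun t => Phi (t +i* y) - Phi (t +i* (y + b))) +
  'i * cintegral `[y, y + b] (fun t => Phi ((x + a) +i* t) - Phi (x +i* t)).

Definition cdiff_rect Phi (x y a b : R) : Prop :=
  forall s t, x <= s <= x + a -> y <= t <= y + b -> cdiff_at Phi (s +i* t).

Let hor_int Phi x y a b c d : 0 <= a -> 0 <= b -> y <= c <= y + b -> y <= d <= y + b ->
  cdiff_rect Phi x y a b ->
  cintegrable `[x, x + a] (fun t => Phi (t +i* c) - Phi (t +i* d)).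
Proof.
move=> a0 b0 hc hd H; apply: lip_cintegrable => t ht.
by apply: lip_atB; apply: lip_horizontal; exact: H.
Qed.

Let ver_int Phi x y a b c d : 0 <= a -> 0 <= b -> x <= c <= x + a -> x <= d <= x + a ->
  cdiff_rect Phi x y a b ->
  cintegrable `[y, y + b] (fun t => Phi (c +i* t) - Phi (d +i* t)).
Proof.
move=> a0 b0 hc hd H; apply: lip_cintegrable => t ht.
by apply: lip_atB; apply: lip_vertical; exact: H.
Qed.

Lemma rect_int_split Phi (x y a b : R) : 0 <= a -> 0 <= b ->
  cdiff_rect Phi x y (a + a) (b + b) ->
  rect_int Phi x y (a + a) (b + b) =
  rect_int Phi x y a b + rect_int Phi (x + a) y a b +
  (rect_int Phi x (y + b) a b + rect_int Phi (x + a) (y + b) a b).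
Proof.
move=> a0 b0 H.
have aa : 0 <= a + a by rewrite addr_ge0.
have bb : 0 <= b + b by rewrite addr_ge0.
have hy0 : y <= y <= y + (b + b) by rewrite lexx lerDl.
have hy1 : y <= y + b <= y + (b + b) by rewrite lerDl b0 lerD2l lerDl.
have hy2 : y <= y + (b + b) <= y + (b + b) by rewrite lexx lerDl bb.
have hx0 : x <= x <= x + (a + a) by rewrite lexx lerDl.
have hx1 : x <= x + a <= x + (a + a) by rewrite lerDl a0 lerD2l lerDl.
have hx2 : x <= x + (a + a) <= x + (a + a) by rewrite lexx lerDl aa.
have xaa : x + a + a = x + (a + a) by rewrite addrA.
have ybb : y + b + b = y + (b + b) by rewrite addrA.
have xa1 : x <= x + a by rewrite lerDl.
have xa2 : x + a <= x + (a + a) by rewrite lerD2l lerDl.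
have yb1 : y <= y + b by rewrite lerDl.
have yb2 : y + b <= y + (b + b) by rewrite lerD2l lerDl.
have HI c d := @hor_int Phi x y (a + a) (b + b) c d aa bb.
have VI c d := @ver_int Phi x y (a + a) (b + b) c d aa bb.
have h01 := HI _ _ hy0 hy1 H; have h12 := HI _ _ hy1 hy2 H.
have v21 := VI _ _ hx2 hx1 H; have v10 := VI _ _ hx1 hx0 H.
rewrite /rect_int xaa ybb.
have -> : cintegral `[x, x + (a + a)]
    (fun t => Phi (t +i* y) - Phi (t +i* (y + (b + b)))) =
    cintegral `[x, x + (a + a)] (fun t => Phi (t +i* y) - Phi (t +i* (y + b))) +
    cintegral `[x, x + (a + a)]
      (fun t => Phi (t +i* (y + b)) - Phi (t +i* (y + (b + b)))).
  rewrite -cintegralD//; apply: eq_cintegral => t _.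
  by rewrite [RHS]addrA subrK.
have -> : cintegral `[y, y + (b + b)]
    (fun t => Phi ((x + (a + a)) +i* t) - Phi (x +i* t)) =
    cintegral `[y, y + (b + b)] (fun t => Phi ((x + (a + a)) +i* t) - Phi ((x + a) +i* t)) +
    cintegral `[y, y + (b + b)] (fun t => Phi ((x + a) +i* t) - Phi (x +i* t)).
  rewrite -cintegralD//; apply: eq_cintegral => t _.
  by rewrite [RHS]addrA subrK.
rewrite (cintegral_split xa1 xa2 h01) (cintegral_split xa1 xa2 h12).
rewrite (cintegral_split yb1 yb2 v21) (cintegral_split yb1 yb2 v10).
move: (cintegral _ _) (cintegral _ _) (cintegral _ _) (cintegral _ _)
  (cintegral _ _) (cintegral _ _) (cintegral _ _) (cintegral _ _) => *.
ring.
Qed.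

(** Affine functions have contour integral 0, so only the error of the affine
    approximation contributes. *)
Lemma rect_int_small Phi (x y a b p q e : R) (d : R[i]) : 0 <= a -> 0 <= b -> 0 <= e ->
  x <= p <= x + a -> y <= q <= y + b -> cdiff_rect Phi x y a b ->
  (forall s t, x <= s <= x + a -> y <= t <= y + b ->
    nc (Phi (s +i* t) - Phi (p +i* q) - ((s +i* t) - (p +i* q)) * d) <=
    e * nc ((s +i* t) - (p +i* q))) ->
  nc (rect_int Phi x y a b) <= 4 * e * (a + b) ^+ 2.
Proof.
move=> a0 b0 e0 hp hq H he.
have hy0 : y <= y <= y + b by rewrite lexx lerDl.
have hy1 : y <= y + b <= y + b by rewrite lexx lerDl b0.
have hx0 : x <= x <= x + a by rewrite lexx lerDl.
have hx1 : x <= x + a <= x + a by rewrite lexx lerDl a0.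
have xa : x <= x + a by rewrite lerDl.
have yb : y <= y + b by rewrite lerDl.
pose M := e * (a + b).
have M0 : 0 <= M by rewrite mulr_ge0// addr_ge0.
pose err s t := Phi (s +i* t) - Phi (p +i* q) - ((s +i* t) - (p +i* q)) * d.
have errM s t : x <= s <= x + a -> y <= t <= y + b -> nc (err s t) <= M.
  move=> hs ht; rewrite (le_trans (he s t hs ht))// ler_wpM2l//.
  rewrite (le_trans (nc_le_sum _))//=; apply: lerD; rewrite ler_norml;
    apply/andP; split; lra.
have I1 := hor_int a0 b0 hy0 hy1 H; have I2 := ver_int a0 b0 hx1 hx0 H.
have J1 : cintegrable `[x, x + a] (fun t => err t y - err t (y + b)).
  have := cintegrableD (mseg _ _) I1 (cintegrable_cst x (x + a) ('i * b%:C * d)).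
  congr (cintegrable _ _); apply/funext => t.
  rewrite /err; have -> : t +i* (y + b) = (t +i* y) + 'i * b%:C :> R[i] by simpc.
  by ring.
have J2 : cintegrable `[y, y + b] (fun t => err (x + a) t - err x t).
  have := cintegrableD (mseg _ _) I2 (cintegrable_cst y (y + b) (- (a%:C * d))).
  congr (cintegrable _ _); apply/funext => t.
  rewrite /err; have -> : (x + a) +i* t = (x +i* t) + a%:C :> R[i] by simpc.
  by ring.
have E1 : cintegral `[x, x + a] (fun t => Phi (t +i* y) - Phi (t +i* (y + b))) =
   cintegral `[x, x + a] (fun t => err t y - err t (y + b)) - a%:C * ('i * b%:C * d).
  rewrite -[a in a%:C](_ : x + a - x = a); last by rewrite addrC addKr.
  rewrite -cintegral_cst// -(cintegralB (mseg _ _) J1 (cintegrable_cst _ _ _)).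
  apply: eq_cintegral => t _; rewrite /err.
  have -> : t +i* (y + b) = (t +i* y) + 'i * b%:C :> R[i] by simpc.
  by ring.
have E2 : cintegral `[y, y + b] (fun t => Phi ((x + a) +i* t) - Phi (x +i* t)) =
   cintegral `[y, y + b] (fun t => err (x + a) t - err x t) + b%:C * (a%:C * d).
  rewrite -[b in b%:C](_ : y + b - y = b); last by rewrite addrC addKr.
  rewrite -cintegral_cst// -(cintegralD (mseg _ _) J2 (cintegrable_cst _ _ _)).
  apply: eq_cintegral => t _; rewrite /err.
  have -> : (x + a) +i* t = (x +i* t) + a%:C :> R[i] by simpc.
  by ring.
have -> : rect_int Phi x y a b =
   cintegral `[x, x + a] (fun t => err t y - err t (y + b)) +
   'i * cintegral `[y, y + b] (fun t => err (x + a) t - err x t).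
  rewrite /rect_int E1 E2; move: (cintegral _ _) (cintegral _ _) => A B.
  ring.
have err2 s t s' t' : x <= s <= x + a -> y <= t <= y + b -> x <= s' <= x + a ->
    y <= t' <= y + b -> nc (err s t - err s' t') <= 2 * M.
  move=> hs ht hs' ht'; rewrite (le_trans (nc_triangle _ _))// ncN mulrDl mul1r.
  by apply: lerD; exact: errM.
have B1 : nc (cintegral `[x, x + a] (fun t => err t y - err t (y + b))) <= 4 * M * a.
  apply: le_trans (nc_cintegral_segment_le (B := 2 * M) xa J1 _) _.
    by move=> t ht; exact: err2.
  by rewrite [x + a - x]addrC addKr; lra.
have B2 : nc (cintegral `[y, y + b] (fun t => err (x + a) t - err x t)) <= 4 * M * b.
  apply: le_trans (nc_cintegral_segment_le (B := 2 * M) yb J2 _) _.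
    by move=> t ht; exact: err2.
  by rewrite [y + b - y]addrC addKr; lra.
rewrite (le_trans (nc_triangle _ _))//.
have -> : nc ('i * cintegral `[y, y + b] (fun t => err (x + a) t - err x t)) =
    nc (cintegral `[y, y + b] (fun t => err (x + a) t - err x t)).
  by rewrite -nc_conj_i mulrA mulNr -expr2 sqr_i opprK mul1r.
rewrite (le_trans (lerD B1 B2))// /M expr2 le_eqVlt; apply/orP; left; apply/eqP; ring.
Qed.

Lemma nested_intervals (x c : nat -> R) : (forall n, 0 <= c n) ->
  (forall n, x n <= x n.+1 /\ x n.+1 + c n.+1 <= x n + c n) ->
  exists p, forall n, x n <= p <= x n + c n.
Proof.
move=> c0 H.
have mono n m : x n <= x (n + m)%N.
  elim: m => [|m IH]; first by rewrite addn0.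
  by rewrite addnS (le_trans IH)//; case: (H (n + m)%N).
have anti n m : x (n + m)%N + c (n + m)%N <= x n + c n.
  elim: m => [|m IH]; first by rewrite addn0.
  by rewrite addnS (le_trans _ IH)//; case: (H (n + m)%N).
have ub n : ubound (range x) (x n + c n).
  move=> _ [m _ <-]; have [nm|mn] := leqP n m.
    by have := anti n (m - n)%N; rewrite subnKC//; apply: le_trans; rewrite lerDl.
  by have := mono m (n - m)%N; rewrite subnKC ?(ltnW mn)// => /le_trans; apply; rewrite lerDl.
exists (sup (range x)) => n; apply/andP; split.
  by apply: ub_le_sup; [exists (x 0%N + c 0%N); exact: ub|exists n].
by apply: ge_sup; [exists (x 0%N), 0%N|exact: ub].
Qed.

(** Bisection: at each step one of the four quarters carries at least a quarter
    of the integral. At the common point of the nested rectangles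
    differentiability bounds the integral over the n-th one by an arbitrarily
    small multiple of 4^(-n). *)
Theorem goursat_rectangle Phi (x y a b : R) : 0 <= a -> 0 <= b ->
  cdiff_rect Phi x y a b -> rect_int Phi x y a b = 0.
Proof.
move=> a0 b0 H0.
pose sz (c : R) n := c / 2 ^+ n.
have sz0 c n : 0 <= c -> 0 <= sz c n by move=> ?; rewrite divr_ge0// exprn_ge0.
have szS c n : sz c n = sz c n.+1 + sz c n.+1.
  rewrite /sz exprS; have : 2 ^+ n != 0 :> R by rewrite expf_neq0.
  by move: (2 ^+ n) => u u0; field; rewrite u0.
pose inside n (z z' : R * R) :=
  [/\ z.1 <= z'.1, z'.1 + sz a n.+1 <= z.1 + sz a n,
      z.2 <= z'.2 & z'.2 + sz b n.+1 <= z.2 + sz b n].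
have step (nz : nat * (R * R)) : exists z' : R * R,
    cdiff_rect Phi nz.2.1 nz.2.2 (sz a nz.1) (sz b nz.1) ->
    inside nz.1 nz.2 z' /\
    nc (rect_int Phi nz.2.1 nz.2.2 (sz a nz.1) (sz b nz.1)) <=
    4 * nc (rect_int Phi z'.1 z'.2 (sz a nz.1.+1) (sz b nz.1.+1)).
  case: nz => n [u v] /=.
  have [Hd|nHd] := pselect (cdiff_rect Phi u v (sz a n) (sz b n)); last first.
    by exists (u, v).
  set A := sz a n.+1; set B := sz b n.+1.
  have A0 : 0 <= A by exact: sz0.
  have B0 : 0 <= B by exact: sz0.
  have := @rect_int_split Phi u v A B A0 B0; rewrite -!szS => /(_ Hd) E.
  have [h1|h1] := leP (nc (rect_int Phi u v (sz a n) (sz b n)))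
     (4 * nc (rect_int Phi u v A B)).
    exists (u, v) => _; split=> //; rewrite /inside/= (szS a n) (szS b n).
    by split; rewrite ?lexx// -/A -/B; lra.
  have [h2|h2] := leP (nc (rect_int Phi u v (sz a n) (sz b n)))
     (4 * nc (rect_int Phi (u + A) v A B)).
    exists (u + A, v) => _; split=> //; rewrite /inside/= (szS a n) (szS b n).
    by split; rewrite ?lexx// -/A -/B; lra.
  have [h3|h3] := leP (nc (rect_int Phi u v (sz a n) (sz b n)))
     (4 * nc (rect_int Phi u (v + B) A B)).
    exists (u, v + B) => _; split=> //; rewrite /inside/= (szS a n) (szS b n).
    by split; rewrite ?lexx// -/A -/B; lra.
  exists (u + A, v + B) => _; split.
    by rewrite /inside/= (szS a n) (szS b n); split; rewrite -/A -/B; lra.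
  suff fin : nc (rect_int Phi u v (sz a n) (sz b n)) <=
      4 * nc (rect_int Phi (u + A) (v + B) A B) by exact: fin.
  have T := nc_triangle
    (rect_int Phi u v A B + rect_int Phi (u + A) v A B)
    (rect_int Phi u (v + B) A B + rect_int Phi (u + A) (v + B) A B).
  rewrite -E in T.
  have T1 := nc_triangle (rect_int Phi u v A B) (rect_int Phi (u + A) v A B).
  have T2 := nc_triangle (rect_int Phi u (v + B) A B) (rect_int Phi (u + A) (v + B) A B).
  by lra.
have [nx hnx] := choice step.
pose z := fix z n := if n is m.+1 then nx (m, z m) else (x, y).
have Z n : cdiff_rect Phi (z n).1 (z n).2 (sz a n) (sz b n) /\
   nc (rect_int Phi x y a b) <=
   4 ^+ n * nc (rect_int Phi (z n).1 (z n).2 (sz a n) (sz b n)).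
  elim: n => [|n [IH1 IH2]].
    by rewrite /sz !expr0 !divr1 mul1r; split.
  have [[i1 i2 i3 i4] h] := hnx (n, z n) IH1; rewrite /= in i1 i2 i3 i4 h.
  split.
    move=> s t /andP[s1 s2] /andP[t1 t2]; apply: IH1.
      by rewrite (le_trans i1 s1) (le_trans s2 i2).
    by rewrite (le_trans i3 t1) (le_trans t2 i4).
  rewrite (le_trans IH2)// exprSr -mulrA ler_wpM2l// exprn_ge0//.
have IN n : inside n (z n) (z n.+1) by have [] := hnx (n, z n) (Z n).1.
have [p hp] : exists p, forall n, (z n).1 <= p <= (z n).1 + sz a n.
  by apply: nested_intervals => n; [exact: sz0|case: (IN n)].
have [q hq] : exists q, forall n, (z n).2 <= q <= (z n).2 + sz b n.
  by apply: nested_intervals => n; [exact: sz0|case: (IN n)].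
have [d hd] : cdiff_at Phi (p +i* q).
  apply: H0; first by have := hp 0%N; rewrite /sz expr0 divr1.
  by have := hq 0%N; rewrite /sz expr0 divr1.
have bound e : 0 < e -> nc (rect_int Phi x y a b) <= 4 * e * (a + b) ^+ 2.
  move=> e0; have [de de0 hde] := hd e e0.
  have [n hn] : exists n, (a + b) / 2 ^+ n < de.
    have h : (a + b) * 2^-1 ^+ n @[n --> \oo] --> (0 : R).
      have := @cvg_geometric R (a + b) 2^-1.
      by apply; rewrite ger0_norm ?invr_ge0// invf_lt1// ltr1n.
    have [N _ hN] : \forall n \near \oo, (a + b) * 2^-1 ^+ n < de.
      by apply: (cvgr_lt _ h).
    by exists N; have := hN N (leqnn N); rewrite exprVn.
  have [D B] := Z n; rewrite (le_trans B)//.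
  have small := @rect_int_small Phi (z n).1 (z n).2 (sz a n) (sz b n) p q e d
    (sz0 a n a0) (sz0 b n b0) (ltW e0) (hp n) (hq n) D.
  have nsmall : nc (rect_int Phi (z n).1 (z n).2 (sz a n) (sz b n)) <=
      4 * e * (sz a n + sz b n) ^+ 2.
    apply: small => s t hs ht; pose h := (s +i* t) - (p +i* q).
    have hh : nc h < de.
      apply: le_lt_trans hn; rewrite mulrDl -/(sz a n) -/(sz b n).
      rewrite (le_trans (nc_le_sum _))//=; have hpn := hp n; have hqn := hq n.
      apply: lerD; rewrite ler_norml; apply/andP; split; lra.
    have wh : (p +i* q) + h = s +i* t by rewrite /h [LHS]addrC subrK.
    by have := hde h hh; rewrite wh.
  rewrite (le_trans (ler_wpM2l _ nsmall))// ?exprn_ge0//.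
  have E4 : 4 ^+ n = (2 ^+ n) ^+ 2 :> R.
    by rewrite -exprM mulnC exprM expr2 -natrM.
  have n0 : 2 ^+ n != 0 :> R by rewrite expf_neq0.
  rewrite /sz E4 le_eqVlt; apply/orP; left; apply/eqP.
  by move: (2 ^+ n) n0 => u u0; field; rewrite u0.
apply: ComplexField.Normc.eq0_normc; apply/eqP; rewrite eq_le nc_ge0 andbT.
apply/ler_addgt0Pr => e e0; rewrite add0r.
pose K := 4 * (a + b) ^+ 2.
have K0 : 0 <= K by rewrite mulr_ge0// exprn_ge0// addr_ge0.
have K1 : 0 < K + 1 by lra.
have := bound (e / (K + 1)); rewrite divr_gt0// => /(_ isT) /le_trans; apply.
have -> : 4 * (e / (K + 1)) * (a + b) ^+ 2 = e * (K / (K + 1)).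
  by rewrite /K; field; rewrite gt_eqF.
by rewrite ler_piMr ?(ltW e0)// ler_pdivrMr// mul1r lerDl.
Qed.

End Goursat.

(** * Cauchy's estimate and iterated differences *)

Section CauchyEstimate.
Variable R : realType.
Notation twopi := (pi *+ 2 : R).
Implicit Types (F G : R[i] -> R[i]) (z w d : R[i]).

Let twopi_gt0 : 0 < twopi. Proof. by rewrite mulrn_wgt0// pi_gt0. Qed.

Lemma cexpN (w : R[i]) : cexp w * cexp (- w) = 1.
Proof. by rewrite -cexpD subrr cexp0. Qed.

Lemma cexp_periodic (t : R) : cexp (t +i* twopi) = cexp (t +i* 0).
Proof. by rewrite /cexp /= cos2pi sin2pi cos0 sin0. Qed.

Let mI : measurable (`[0%R, twopi] : set (measurableTypeR R)).
Proof. exact: measurable_itv. Qed.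

Let bounded_integral (f : R -> R[i]) (b : R) : cintegrable `[0, twopi] f ->
  (forall t, nc (f t) <= b) -> nc (cintegral `[0, twopi] f) <= 2 * (twopi * b).
Proof.
move=> hf fb; have := nc_cintegral_segment_le (ltW twopi_gt0) hf (fun t _ => fb t).
by rewrite subr0.
Qed.

(** The function Phi(w) = (F(a + e^w) - F(a)) e^(-w) has period 2 pi i, so
    Goursat's theorem makes its integral over a vertical period independent of
    Re w. At Re w = ln s this integral is at most 4 pi * 2 M / s, the norm of an
    integral being estimated through its real and imaginary parts; as Re w tends
    to - oo it tends to 2 pi F'(a). *)
Theorem cauchy_estimate F (a d : R[i]) (rho M s : R) :
  (forall z, nc (z - a) < rho -> cdiff_at F z) ->
  (forall z, nc (z - a) < rho -> nc (F z) <= M) ->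
  cderiv_at F a d -> 0 < s -> s < rho -> nc d <= 4 * M / s.
Proof.
move=> Fd FM Fa s0 srho.
have rho0 : 0 < rho by exact: lt_trans srho.
pose Phi w := (F (a + cexp w) - F a) * cexp (- w).
have inball w : expR (Re w) < rho -> nc (a + cexp w - a) < rho.
  by rewrite addrC addKr nc_cexp.
have Phid w : expR (Re w) < rho -> cdiff_at Phi w.
  move=> hw; have [d1 h1] := Fd _ (inball w hw).
  have h2 : cderiv_at (fun w => a + cexp w) w (cexp w).
    have := cderiv_addc a (@cderiv_cexp R w).
    by congr (cderiv_at _ _ _); apply/funext => v; rewrite addrC.
  have h3 := cderiv_addc (- F a) (cderiv_comp h2 h1).
  have h4 := cderiv_comp (@cderiv_opp R w) (@cderiv_cexp R (- w)).
  by eexists; exact: cderivM h3 h4.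
pose J (x : R) := cintegral `[0, twopi] (fun t => Phi (x +i* t)).
have Jint (x : R) : expR x < rho -> cintegrable `[0, twopi] (fun t => Phi (x +i* t)).
  by move=> hx; apply: lip_cintegrable => t _; apply: lip_vertical; exact: Phid.
have Jcst (x y : R) : x <= y -> expR y < rho -> J x = J y.
  move=> xy hy; have yx0 : 0 <= y - x by rewrite subr_ge0.
  have cr : cdiff_rect Phi x 0 (y - x) twopi.
    move=> u v /andP[_ uy] _; apply: Phid; apply: le_lt_trans hy.
    by rewrite ler_expR; move: uy; rewrite addrC subrK.
  have := goursat_rectangle yx0 (ltW twopi_gt0) cr; rewrite /rect_int.
  have xy' : x + (y - x) = y by rewrite addrC subrK.
  rewrite xy' !add0r.
  have -> : cintegral `[x, y] (fun t => Phi (t +i* 0) - Phi (t +i* twopi)) =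
      cintegral `[x, y] (fun=> 0).
    apply: eq_cintegral => t _; rewrite /Phi cexp_periodic.
    have -> : cexp (- (t +i* twopi)) = cexp (- (t +i* 0)).
      have e1 := cexpN (t +i* twopi); have e2 := cexpN (t +i* 0).
      rewrite cexp_periodic in e1.
      have e0 : cexp (t +i* 0) != 0.
        by apply: contraTneq isT => e0; move: e2; rewrite e0 mul0r => /eqP;
          rewrite eq_sym oner_eq0.
      by apply: (mulfI e0); rewrite e1 e2.
    by rewrite subrr.
  rewrite (cintegral_cst _ xy) mulr0 add0r.
  have hx : expR x < rho by apply: le_lt_trans hy; rewrite ler_expR.
  rewrite (cintegralB mI (Jint y hy) (Jint x hx)) -/(J x) -/(J y) => /eqP.
  move: (J x) (J y) => Jx Jy; rewrite mulf_eq0 => /orP[/eqP [/eqP]|].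
    by rewrite oner_eq0.
  by rewrite subr_eq0 => /eqP.
have Jbound : nc (J (ln s)) <= 2 * (twopi * (2 * M / s)).
  apply: bounded_integral; first by apply: Jint; rewrite lnK.
  move=> t; rewrite /Phi normcM nc_cexp.
  have -> : expR (Re (- (ln s +i* t))) = s^-1 by rewrite /= expRN lnK.
  rewrite ler_wpM2r ?invr_ge0 ?(ltW s0)//.
  rewrite (le_trans (nc_triangle _ _))// ncN -[2]/(1 + 1) mulrDl mul1r lerD//.
    by apply: FM; apply: inball; rewrite /= lnK.
  by apply: FM; rewrite subrr nc0.
have main e : 0 < e -> nc d <= 4 * M / s + 2 * e.
  move=> e0; have [de de0 hde] := Fa e e0.
  (* so far to the left that a + e^w is de-close to a when Re w = x *)
  pose x := Num.min (ln s) (ln (de / 2)).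
  have de20 : 0 < de / 2 by rewrite divr_gt0.
  have xs : x <= ln s by rewrite ge_min lexx.
  have xd : expR x < de.
    rewrite (@le_lt_trans _ _ (de / 2))//; last by lra.
    by rewrite -[leRHS]lnK ?posrE// ler_expR ge_min lexx orbT.
  have hs : expR (ln s) < rho by rewrite lnK.
  have hx : expR x < rho by apply: le_lt_trans hs; rewrite ler_expR.
  have cd := cintegrable_cst 0 twopi d.
  have near_d : nc (J x - cintegral `[0, twopi] (fun=> d)) <= 2 * (twopi * e).
    rewrite -(cintegralB mI (Jint x hx) cd); apply: bounded_integral.
      have := cintegrableD mI (Jint x hx) (cintegrableZ mI (-1) cd).
      by congr (cintegrable _ _); apply/funext => t; rewrite mulN1r.
    move=> t; pose w : R[i] := x +i* t.
    have nw : nc (cexp w) = expR x by rewrite nc_cexp.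
    have wd : nc (cexp w) < de by rewrite nw.
    have -> : Phi (x +i* t) - d = (F (a + cexp w) - F a - cexp w * d) * cexp (- w).
      rewrite /Phi -/w [RHS]mulrBl; congr (_ - _).
      by rewrite mulrAC cexpN mul1r.
    rewrite normcM (le_trans (ler_wpM2r (nc_ge0 _) (hde _ wd)))//.
    by rewrite -mulrA -normcM cexpN -[1]/(1%:C) nc_real normr1 mulr1.
  have Id : cintegral `[0, twopi] (fun=> d) = twopi%:C * d.
    by rewrite cintegral_cst ?subr0// ltW.
  rewrite Id (Jcst x (ln s) xs hs) in near_d.
  have T := nc_triangle (J (ln s)) (- (J (ln s) - twopi%:C * d)).
  rewrite ncN in T.
  have Jd : J (ln s) + - (J (ln s) - twopi%:C * d) = twopi%:C * d by ring.
  rewrite Jd normcM nc_real (gtr0_norm twopi_gt0) in T.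
  have : twopi * nc d <= twopi * (4 * M / s + 2 * e).
    rewrite (le_trans T)// (le_trans (lerD Jbound near_d))//.
    by rewrite le_eqVlt; apply/orP; left; apply/eqP; field; rewrite gt_eqF.
  by rewrite ler_pM2l.
apply/ler_addgt0Pr => e e0; have := main (e / 2).
have -> : 2 * (e / 2) = e by field.
by rewrite divr_gt0// => /(_ isT).
Qed.

(** P stands for the real and the imaginary part. *)
Lemma is_derive_of_cderiv G z (t : R) d (P : R[i] -> R) :
  (forall u v, P (u - v) = P u - P v) -> (forall u, `|P u| <= nc u) ->
  (forall (h : R) u, P (h%:C * u) = h * P u) ->
  cderiv_at G (z + t%:C) d ->
  is_derive t 1 (fun s : R => P (G (z + s%:C))) (P d).
Proof.
move=> PB Pb PZ H.
have lim : h^-1 *: (P (G (z + (h *: (1 : R) + t)%:C)) - P (G (z + t%:C)))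
    @[h --> (0 : R)^'] --> P d.
  apply/cvgrPdist_le => e e0; have [r r0 hr] := H e e0.
  rewrite near_withinE; apply/nbhs_ballP; exists r => // h.
  rewrite -ball_normE /= sub0r normrN => hh h0.
  have hn : 0 < `|h| by rewrite normr_gt0.
  have := hr h%:C; rewrite nc_real => /(_ hh).
  have -> : z + t%:C + h%:C = z + (h *: (1 : R) + t)%:C.
    by rewrite /GRing.scale/= mulr1 rmorphD addrA addrAC.
  move=> hb; rewrite -(ler_pM2r hn) -normrM mulrBl /GRing.scale/=.
  rewrite mulrAC mulVf// mul1r -PB [P d * h]mulrC -PZ distrC -PB.
  by rewrite (le_trans (Pb _)).
by apply: DeriveDef; [exact: (cvgP _ lim)|exact: cvg_lim lim].
Qed.

Lemma mean_value_bound (f : R -> R) (h B : R) : 0 < h ->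
  (forall t, 0 <= t <= h -> exists2 d : R, `|d| <= B & is_derive t 1 f d) ->
  `|f h - f 0| <= h * B.
Proof.
move=> h0 H.
have D (t : R) : 0 <= t <= h -> is_derive t 1 f (derive1 f t) /\ `|derive1 f t| <= B.
  move=> /H[d dB hd]; have -> : derive1 f t = d by rewrite derive1E derive_val.
  by split.
have cf : {within `[0, h], continuous f}.
  apply: continuous_in_subspaceT => t; rewrite inE/= in_itv/= => ht.
  by apply/differentiable_continuous/derivable1_diffP; have [[]] := D t ht.
have [|t] := @MVT R f (derive1 f) 0 h h0 _ cf.
  move=> t; rewrite in_itv/= => /andP[t0 th].
  by have [] := D t; rewrite ?(ltW t0) ?(ltW th).
rewrite in_itv/= => /andP[t0 th] ->; rewrite subr0 normrM mulrC (gtr0_norm h0).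
by rewrite ler_pM2l//; have [] := D t; rewrite ?(ltW t0) ?(ltW th).
Qed.

Definition fdiff (h : R) G z : R[i] := G (z + h%:C) - G z.

Definition disc_bounded G (rho M : R) : Prop := forall z, nc z < rho ->
  cdiff_at G z /\ nc (G z) <= M.

(** The mean value theorem on the segment from z to z + h, where Cauchy's
    estimate on discs of radius s bounds the derivative. The disc loses s for
    the estimate and h for the segment. *)
Lemma fdiff_bound G (rho M h s : R) : 0 < h -> 0 < s ->
  disc_bounded G rho M ->
  disc_bounded (fdiff h G) (rho - (s + h)) (16 * h / s * M).
Proof.
move=> h0 s0 H z hz.
have shift_lt t : 0 <= t <= h -> nc (z + t%:C) < rho - s.
  move=> /andP[t0 th]; rewrite (le_lt_trans (nc_triangle _ _))// nc_real ger0_norm//.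
  by lra.
have z1 : nc (z + h%:C) < rho.
  by rewrite (lt_trans (shift_lt h _)) ?lexx ?(ltW h0)//; lra.
have z0 : nc z < rho by rewrite (lt_trans hz)//; lra.
split.
  have [d1 h1] := (H _ z0).1; have [d2 h2] := (H _ z1).1.
  by exists (d2 - d1); apply: cderivB => //; exact: cderiv_shift.
have Dt (t : R) : 0 <= t <= h -> exists2 d, nc d <= 8 * M / s &
    cderiv_at G (z + t%:C) d.
  move=> ht; have zt := shift_lt t ht.
  have zt' : nc (z + t%:C) < rho by rewrite (lt_trans zt)//; lra.
  have [d hd] := (H _ zt').1; exists d => //.
  have inside u : nc (u - (z + t%:C)) < s -> nc u < rho.
    move=> hu; have -> : u = (u - (z + t%:C)) + (z + t%:C) by rewrite subrK.
    by rewrite (le_lt_trans (nc_triangle _ _))//; lra.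
  have s20 : 0 < s / 2 by rewrite divr_gt0.
  have s2s : s / 2 < s by lra.
  have := cauchy_estimate (fun u hu => (H u (inside u hu)).1)
    (fun u hu => (H u (inside u hu)).2) hd s20 s2s.
  congr (_ <= _); by field; rewrite gt_eqF.
have comp (P : R[i] -> R) : (forall u v, P (u - v) = P u - P v) ->
    (forall u, `|P u| <= nc u) -> (forall (h : R) u, P (h%:C * u) = h * P u) ->
    `|P (fdiff h G z)| <= h * (8 * M / s).
  move=> PB Pb PZ; rewrite /fdiff PB.
  have := @mean_value_bound (fun t => P (G (z + t%:C))) h (8 * M / s) h0.
  rewrite addr0; apply => t /Dt[d hd Gd]; exists (P d).
    by rewrite (le_trans (Pb _)).
  exact: is_derive_of_cderiv PB Pb PZ Gd.
have ReZ (r : R) u : Re (r%:C * u) = r * Re u.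
  by case: u => x y /=; rewrite mul0r subr0.
have ImZ (r : R) u : Im (r%:C * u) = r * Im u.
  by case: u => x y /=; rewrite mul0r addr0.
have := nc_le_bound (comp Re (@ReB R) (@Re_le_nc R) ReZ) (comp Im (@ImB R) (@Im_le_nc R) ImZ).
by congr (_ <= _); field; rewrite gt_eqF.
Qed.

Lemma iter_fdiff_bound G (rho M h s : R) (n : nat) : 0 < h -> 0 < s ->
  disc_bounded G rho M ->
  disc_bounded (iter n (fdiff h) G) (rho - n%:R * (s + h)) ((16 * h / s) ^+ n * M).
Proof.
move=> h0 s0 H; elim: n => [|n IH]; first by rewrite mul0r subr0 expr0 mul1r.
have := fdiff_bound h0 s0 IH; rewrite iterS exprS mulrA.
by congr (disc_bounded _ _ _); rewrite -natr1; ring.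
Qed.

End CauchyEstimate.

(** * Moments of a weight whose transform is analytic at the origin *)

Section SingularOrigin.
Variable R : realType.
Notation pos := (`](0:R), +oo[%classic).
Implicit Types (F G : R[i] -> R[i]).

Lemma cexp_real (r : R) : cexp r%:C = (expR r)%:C.
Proof.
by rewrite /cexp [complex.Re _]/= [complex.Im _]/= cos0 sin0 -[1 +i* 0]/(1 : R[i]) mulr1.
Qed.

Lemma eq_iter_fdiff F G (h : R) (n : nat) (x : R) : 0 <= h ->
  (forall y : R, x <= y <= x + n%:R * h -> F y%:C = G y%:C) ->
  iter n (fdiff h) F x%:C = iter n (fdiff h) G x%:C.
Proof.
move=> h0; elim: n x => [|n IH] x H; first by apply: H; rewrite mul0r addr0 lexx.
rewrite !iterS /fdiff -rmorphD/= !IH// => y /andP[y1 y2]; apply: H.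
  by rewrite y1 (le_trans y2)// lerD2l ler_wpM2r// ler_nat.
by rewrite (le_trans _ y1) ?lerDl// (le_trans y2)// -natr1 mulrDl mul1r addrA addrAC.
Qed.

Lemma disc_bounded_of_holomorphic (U : set R[i]) F : U 0 -> holomorphic_on U F ->
  exists2 rho : R, 0 < rho & exists M : R, disc_bounded F rho M.
Proof.
move=> U0 [oU hF].
have [r r0 hr] : exists2 r : R, 0 < r & forall z : R[i], nc z < r -> U z.
  have := open_nbhs_nbhs (conj oU U0) => /nbhs_ballP[e e0 he].
  have [r r0 re] : exists2 r : R, 0 < r & r%:C <= e.
    move: e0; rewrite /= ltcE/= => /andP[/eqP ei e0]; exists (Re e) => //.
    by case: (e) ei e0 => a b /= -> _; rewrite lexx.
  exists r => // z zr; apply: he.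
  by rewrite -ball_normE /= sub0r normrN normcE_real (lt_le_trans _ re)// ltcR.
have [d /cderiv_lip[de de0 hd]] := cderiv_of_derivable (hF 0 U0).
exists (Num.min (Num.min r de) 1); first by rewrite !lt_min r0 de0 ltr01.
exists (nc (F 0) + (nc d + 1)) => z; rewrite !lt_min => /andP[/andP[zr zd] z1].
split; first exact: cderiv_of_derivable (hF z (hr z zr)).
have := hd z zd; rewrite add0r => H.
have -> : F z = F 0 + (F z - F 0) by rewrite addrC subrK.
rewrite (le_trans (nc_triangle _ _))// lerD2l (le_trans H)//.
by rewrite ler_piMr ?(ltW z1)// addr_ge0 ?nc_ge0.
Qed.

(** The inequality 1 + y <= e^y at y = - h u and at y = h u. *)
Lemma exp_quotient_bounds (h u : R) : 0 < h -> 0 < u ->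
  - u <= (expR (- (h * u)) - 1) / h <= - u + h * u ^+ 2 /\
  (expR (- (h * u)) - 1) / h <= 0.
Proof.
move=> h0 u0; have hu : 0 < h * u by rewrite mulr_gt0.
have e1 : 1 - h * u <= expR (- (h * u)) by exact: expR_ge1Dx.
have e2 : expR (- (h * u)) * (1 + h * u) <= 1.
  rewrite -[leRHS]expR0 -(subrr (h * u)) expRD mulrC ler_wpM2r ?expR_ge0//.
  exact: expR_ge1Dx.
have e3 : expR (- (h * u)) <= 1 by rewrite -[leRHS]expR0 ler_expR oppr_le0 ltW.
split; last by rewrite pmulr_lle0 ?invr_gt0// subr_le0.
rewrite ler_pdivlMr// ler_pdivrMr//; apply/andP; split; first by lra.
have : expR (- (h * u)) <= 1 - h * u + (h * u) ^+ 2.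
  rewrite -(@ler_pM2r _ (1 + h * u)); last by rewrite addr_gt0.
  rewrite (le_trans e2)//; move: hu; move: (h * u) => a a0.
  have -> : (1 - a + a ^+ 2) * (1 + a) = 1 + a ^+ 3 by ring.
  by rewrite lerDl exprn_ge0// ltW.
by move: (expR _) => e; rewrite exprMn; lra.
Qed.

Variable k : R -> R.
Hypothesis mk : measurable_fun pos k.
Hypothesis wk : laplace_weight k 0.

Let diff_weight (n : nat) (x h u : R) : R :=
  expR (- (x * u)) * (expR (- (h * u)) - 1) ^+ n * k u.

Let k_integrable : mu.-integrable pos (fun u => (k u)%:E).
Proof.
apply: eq_integrable (wk 0) => // u _ /=.
by rewrite expr0 mul1r mul0r expR0 mulr1.
Qed.

Let expR_measurable (a : R) : measurable_fun pos (fun u : R => expR (- (a * u))).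
Proof.
by apply: measurableT_comp => //; apply: measurableT_comp => //; exact: measurable_funM.
Qed.

Let diff_weight_measurable n x h : measurable_fun pos (diff_weight n x h).
Proof.
apply: measurable_funM => //; apply: measurable_funM; first exact: expR_measurable.
by apply: measurable_funX; apply: measurable_funB => //; exact: expR_measurable.
Qed.

Let diff_weight_integrable n x h : 0 <= x -> 0 <= h ->
  mu.-integrable pos (fun u => (diff_weight n x h u)%:E).
Proof.
move=> x0 h0; apply: le_integrable k_integrable => //.
  by apply/measurable_EFinP; exact: diff_weight_measurable.
move=> u /posP u0; rewrite !abse_EFin lee_fin normrM ler_piMl// normrM mulr_ile1//.
  by rewrite ger0_norm ?expR_ge0// -[leRHS]expR0 ler_expR oppr_le0 mulr_ge0// ltW.
rewrite normrX exprn_ile1// ler_norml.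
have e1 : expR (- (h * u)) <= 1.
  by rewrite -[leRHS]expR0 ler_expR oppr_le0 mulr_ge0// ltW.
by have := expR_ge0 (- (h * u)); lra.
Qed.

(** Each forward difference multiplies the integrand by e^(- h u) - 1. *)
Lemma iter_fdiff_laplace (n : nat) (h x : R) : 0 <= h -> 0 <= x ->
  iter n (fdiff h) (laplace k 0) x%:C =
  (Rintegral mu pos (fun u => expR (- (x * u)) * (expR (- (h * u)) - 1) ^+ n * k u))%:C.
Proof.
move=> h0; elim: n x => [|n IH] x x0.
  rewrite /= /laplace -cintegralR//; apply: eq_cintegral => u _.
  by rewrite /laplace_fun -rmorphM -rmorphN cexp_real -rmorphM/= !expr0 mul1r mulr1.
rewrite iterS /fdiff -rmorphD/= !IH ?addr_ge0// -rmorphB/= -RintegralB//;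
  try exact: diff_weight_integrable (addr_ge0 x0 h0) h0;
  try exact: diff_weight_integrable.
congr (_%:C); apply: eq_Rintegral => u _.
rewrite mulrDl opprD expRD exprS.
by move: (expR _) (expR _) => a b; ring.
Qed.

(** The quotient (e^(- h u) - 1) / h tends to - u and is bounded by u, so u^n |k
    u| dominates. *)
Lemma diff_quotient_moment (n : nat) :
  (harmonic j) ^- n * Rintegral mu pos (fun u => (expR (- (harmonic j * u)) - 1) ^+ n * k u)
    @[j --> \oo] --> (-1) ^+ n * laplace_moment k n.
Proof.
have H0 j : 0 < harmonic j :> R by rewrite /harmonic invr_gt0.
pose f j u : R := ((expR (- (harmonic j * u)) - 1) / harmonic j) ^+ n * k u.
have fE j u : f j u = (harmonic j) ^- n * diff_weight n 0 (harmonic j) u.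
  by rewrite /f /diff_weight mul0r oppr0 expR0 mul1r exprMn exprVn mulrA [_ * _^-1]mulrC.
have fi j : mu.-integrable pos (fun u => (f j u)%:E).
  apply: eq_integrable (integrableZl (@measurable_pos R) ((harmonic j) ^- n)
    (diff_weight_integrable n (lexx 0) (ltW (H0 j)))) => // u _.
  by rewrite fE EFinM.
have mi := laplace_weight0_moment mk n wk (lexx 0).
have gi := integrableZl (@measurable_pos R) ((-1) ^+ n) mi.
have -> : (fun j => (harmonic j) ^- n * Rintegral mu pos
    (fun u => (expR (- (harmonic j * u)) - 1) ^+ n * k u)) =
    (fun j => Rintegral mu pos (f j)).
  apply/funext => j; rewrite -RintegralZl//.
    by apply: eq_Rintegral => u _; rewrite -/(f j u) fE /diff_weight mul0r oppr0 expR0 mul1r.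
  apply: eq_integrable (diff_weight_integrable n (lexx 0) (ltW (H0 j))) => // u _.
  by rewrite /diff_weight mul0r oppr0 expR0 mul1r.
rewrite /laplace_moment -RintegralZl//.
have := @dominated_convergence _ _ R mu pos (@measurable_pos R)
  (fun j u => (f j u)%:E) (fun u => ((-1) ^+ n * (u ^+ n * k u))%:E)
  (fun u => (u ^+ n * `|k u|)%:E).
case.
- by move=> j; exact: (measurable_int _ (fi j)).
- exact: (measurable_int _ gi).
- apply: aeW => u /posP u0.
  apply: cvg_EFin; first exact: nearW.
  rewrite mulrA -exprMn mulN1r.
  have q : (expR (- (harmonic j * u)) - 1) / harmonic j @[j --> \oo] --> - u.
    have up : - u + harmonic j * u ^+ 2 @[j --> \oo] --> - u.
      rewrite -[X in _ --> X](addr0 (- u)); apply: cvgD; first exact: cvg_cst.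
      rewrite -[X in _ --> X](mul0r (u ^+ 2)); apply: cvgM; last exact: cvg_cst.
      exact: cvg_harmonic.
    apply: (squeeze_cvgr _ (cvg_cst (- u)) up); apply: nearW => j.
    by have [] := exp_quotient_bounds (H0 j) u0.
  have qn : ((expR (- (harmonic j * u)) - 1) / harmonic j) ^+ n @[j --> \oo] --> (- u) ^+ n.
    exact: (cvg_comp _ _ q (@exprn_continuous R n (- u))).
  exact: cvgM qn (cvg_cst (k u)).
- apply: eq_integrable (integrable_norm mi) => // u.
  rewrite inE/= in_itv/= andbT => u0.
  by rewrite normrM normrX (gtr0_norm u0).
- apply: aeW => u j /posP u0; rewrite abse_EFin lee_fin normrM ler_wpM2r// normrX.
  have [/andP[b1 b2] b3] := exp_quotient_bounds (H0 j) u0.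
  by rewrite lerXn2r ?nnegrE ?(ltW u0)// ler0_norm// lerNl.
- move=> iP _ h; rewrite /Rintegral; apply: fine_cvg.
  rewrite fineK; last exact: integrable_fin_num gi.
  exact: h.
Qed.

(** The n-th difference quotients at 0 only see the points j h with j <= n, all
    in [0, eps[ for small h, where F is the transform. For F they are bounded by
    (16 / s)^n M with s = rho / (4 n), and n^n <= n! e^n. *)
Theorem analytic_moment_growth :
  analytic_at0 (fun x : R => laplace k 0 x%:C) ->
  exists C K : R, [/\ 0 < C, 0 < K & forall n : nat, (0 < n)%N ->
    `|laplace_moment k n| <= C * K ^+ n * n`!%:R].
Proof.
move=> [U [F [U0 hF [eps eps0 FE]]]].
have [rho rho0 [M HM]] := disc_bounded_of_holomorphic U0 hF.
have M0 : 0 <= M by have [_] := HM 0 (eq_ind_r (fun r => r < rho) rho0 (@nc0 R));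
  apply: le_trans; exact: nc_ge0.
exists (M + 1), (64 / rho * expR 1); split => [||n n0].
- by rewrite ltr_wpDl.
- by rewrite mulr_gt0 ?expR_gt0// divr_gt0.
have nR : 0 < n%:R :> R by rewrite ltr0n.
(* n steps of size s + h <= 2 s use up at most half of the disc *)
pose s := rho / (4 * n%:R).
have s0 : 0 < s by rewrite divr_gt0// mulr_gt0.
have step : `|laplace_moment k n| <= (16 / s) ^+ n * M.
  have -> : `|laplace_moment k n| = `|(-1) ^+ n * laplace_moment k n|.
    by rewrite normrM normrX normrN1 expr1n mul1r.
  have lim : `|(harmonic j) ^- n * Rintegral mu pos
      (fun u => (expR (- (harmonic j * u)) - 1) ^+ n * k u)| @[j --> \oo] -->
      `|(-1) ^+ n * laplace_moment k n|.
    by apply: cvg_norm; exact: diff_quotient_moment.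
  apply: (cvgr_to_le lim); near=> j.
  have h0 : 0 < harmonic j :> R by rewrite /harmonic invr_gt0.
  have hs : harmonic j <= s.
    by near: j; apply: (cvgr_le (0 : R)) => //; exact: cvg_harmonic.
  have he : harmonic j < eps / n%:R.
    by near: j; apply: (cvgr_lt (0 : R)); [exact: cvg_harmonic|rewrite divr_gt0].
  move: (harmonic j) h0 hs he => h h0 hs he.
  have E : iter n (fdiff h) F 0%:C =
      (Rintegral mu pos (fun u => (expR (- (h * u)) - 1) ^+ n * k u))%:C.
    rewrite (@eq_iter_fdiff F (laplace k 0) h n 0 (ltW h0)).
      rewrite iter_fdiff_laplace ?(ltW h0)//; congr (_%:C).
      by apply: eq_Rintegral => u _; rewrite mul0r oppr0 expR0 mul1r.
    move=> y /andP[y0]; rewrite add0r => y1.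
    have ye : 0 <= y < eps.
      by rewrite y0 (le_lt_trans y1)// mulrC -ltr_pdivlMr.
    by have [_ ->] := FE y ye.
  have B : nc (iter n (fdiff h) F 0%:C) <= (16 * h / s) ^+ n * M.
    suff zr : nc (0%:C) < rho - n%:R * (s + h).
      by have [_] := @iter_fdiff_bound R F rho M h s n h0 s0 HM 0%:C zr.
    rewrite nc_real normr0 subr_gt0.
    have e : n%:R * (s + s) = rho / 2 by rewrite /s; field; rewrite gt_eqF.
    rewrite (@le_lt_trans _ _ (rho / 2))//; last by lra.
    by rewrite -e ler_wpM2l ?(ltW nR)// lerD2l.
  move: B; rewrite E nc_real normrM => B.
  have hn : 0 < h ^- n by rewrite invr_gt0 exprn_gt0.
  rewrite (gtr0_norm hn) (le_trans (ler_wpM2l (ltW hn) B))//.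
  rewrite mulrA -exprVn -exprMn.
  have -> : h^-1 * (16 * h / s) = 16 / s by field; rewrite !gt_eqF.
  exact: lexx.
rewrite (le_trans step)//.
have -> : 16 / s = 64 / rho * n%:R by rewrite /s; field; rewrite !gt_eqF.
have a0 : 0 <= 64 / rho by rewrite divr_ge0// ltW.
move: (64 / rho) a0 => a a0; rewrite !exprMn.
have fb : n%:R ^+ n <= n`!%:R * expR 1 ^+ n :> R.
  by rewrite -expRM_natl mulr1; exact: exp_fact_le.
have Y0 : 0 <= a ^+ n * (n`!%:R * expR 1 ^+ n).
  by rewrite !mulr_ge0 ?exprn_ge0 ?expR_ge0.
apply: (@le_trans _ _ (a ^+ n * (n`!%:R * expR 1 ^+ n) * M)).
  by rewrite ler_wpM2r// ler_wpM2l ?exprn_ge0.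
apply: (@le_trans _ _ (a ^+ n * (n`!%:R * expR 1 ^+ n) * (M + 1))).
  by rewrite ler_wpM2l// lerDl.
by rewrite le_eqVlt; apply/orP; left; apply/eqP; ring.
Unshelve. all: by end_near. Qed.

End SingularOrigin.

(** * The Mittag-Leffler kernel *)

Section RealGamma.
Variable R : realType.

Lemma euler_gamma_real (s : R) : euler_gamma s%:C = (rgamma s)%:C.
Proof.
rewrite /euler_gamma /rgamma -lock -cintegralR; last exact: measurable_itv.
apply: eq_cintegral => t; rewrite inE/= in_itv/= andbT => t0.
by rewrite -(rmorphB _ s 1) -rmorphM cexp_real -rmorphM /gamma_density /powR gt_eqF.
Qed.

(** At the poles both sides are 0. *)
Lemma Gamma_inv_real (s : R) : (Gamma s%:C)^-1 = (rgamma_inv s)%:C.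
Proof.
rewrite /Gamma /rgamma_inv [complex.Re _]/=; set n := Num.truncn _.
rewrite -(rmorph_nat (real_complex R) n) -rmorphD euler_gamma_real.
rewrite invfM invrK rmorphM fmorphV mulrC; congr (_ * _).
rewrite rmorph_prod; apply: eq_bigr => j _.
by rewrite rmorphD rmorph_nat.
Qed.

Lemma Gamma_real (s : R) : 0 < s -> Gamma s%:C = (rgamma s)%:C.
Proof.
by move=> s0; apply: invr_inj; rewrite Gamma_inv_real rgamma_inv_gt0E// fmorphV.
Qed.

Lemma wright_real (rho nu t : R) : 0 < rho < 1 -> 0 <= t ->
  wright (- rho) nu%:C (- t%:C) = (rwright rho nu t)%:C.
Proof.
move=> rho01 t0.
have h : powser (fun n => (n`!%:R)^-1 * (Gamma ((- rho * n%:R)%:C + nu%:C))^-1) (- t%:C)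
    @ \oo --> ((rwright rho nu t)%:C : R[i]^o).
  rewrite [X in X @ _](_ : _ = fun N => (series (wright_term rho nu t) N)%:C).
    by apply: complex_cvgR; exact: cvg_rwright.
  apply/funext => N; rewrite /powser /series/= rmorph_sum/=; apply: eq_bigr => n _.
  rewrite -rmorphD/= Gamma_inv_real -rmorphN -rmorphXn -(rmorph_nat (real_complex R)).
  rewrite -fmorphV -!rmorphM /wright_term; congr (_%:C).
  by rewrite mulNr [_ + nu]addrC mulrC mulrA.
by rewrite /wright; exact: (cvg_lim (@norm_hausdorff _ R[i]^o) h).
Qed.

End RealGamma.

Section MittagLeffler.
Variable R : realType.
Notation pos := (`](0:R), +oo[%classic).
Variables alpha beta gamma kappa : R.
Hypotheses (alpha0 : 0 < alpha) (beta0 : 0 < beta) (gamma0 : 0 < gamma).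
Hypotheses (kappa0 : 0 < kappa) (alpha_kappa : alpha < kappa).

Let rho01 : 0 < alpha / kappa < 1.
Proof. by rewrite divr_gt0// ltr_pdivrMr// mul1r. Qed.

Definition rkernel (u : R) : R := u `^ (gamma / kappa - 1) / (kappa * rgamma gamma) *
  rwright (alpha / kappa) (beta - alpha * gamma / kappa) (u `^ kappa^-1).

Lemma kernelK_real (u : R) : kernelK alpha beta gamma kappa u = (rkernel u)%:C.
Proof.
rewrite /kernelK /rkernel Gamma_real// wright_real ?powR_ge0//.
by rewrite -rmorphM -fmorphV -!rmorphM.
Qed.

Lemma measurable_rkernel : measurable_fun pos rkernel.
Proof.
apply: measurable_funM; last exact: measurable_rwright.
by apply: measurable_funM => //; exact: measurable_rpow.
Qed.

Lemma laplace_integrandE (x : R[i]) :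
  laplace_integrand alpha beta gamma kappa x = laplace_fun rkernel 0 x.
Proof.
by apply/funext => u; rewrite /laplace_integrand /laplace_fun kernelK_real expr0 mul1r.
Qed.

Lemma calE_laplace (x : R[i]) : calE alpha beta gamma kappa x = laplace rkernel 0 x.
Proof. by rewrite /calE laplace_integrandE. Qed.

Let rkernel_mono (n : nat) (u : R) : 0 < u -> u ^+ n * rkernel u =
  (kappa * rgamma gamma)^-1 * (u `^ (gamma / kappa + n%:R - 1) *
  rwright (alpha / kappa) (beta - alpha * gamma / kappa) (u `^ kappa^-1)).
Proof.
move=> u0.
have -> : u `^ (gamma / kappa + n%:R - 1) = u ^+ n * u `^ (gamma / kappa - 1).
  have -> : gamma / kappa + n%:R - 1 = n%:R + (gamma / kappa - 1) by ring.
  by rewrite powRD ?(gt_eqF u0) ?implybT// powR_mulrn// ltW.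
by rewrite /rkernel -!mulrA [RHS]mulrCA; congr (_ * _); rewrite mulrCA.
Qed.

Let pn0 (n : nat) : 0 < gamma / kappa + n%:R.
Proof. by rewrite ltr_wpDr// divr_gt0. Qed.

Lemma rkernel_weight (c : R) : wright_adm (alpha / kappa) kappa c ->
  laplace_weight rkernel c.
Proof.
move=> hc n.
have [/(_ c hc) I _] := wright_moments rho01 kappa0 (beta - alpha * gamma / kappa) (pn0 n).
apply: eq_integrable (integrableZl (@measurable_pos R) (kappa * rgamma gamma)^-1 I) => // u.
by move=> /set_mem/posP u0; rewrite rkernel_mono// -EFinM; congr (_%:E); rewrite mulrA.
Qed.

Lemma rkernel_weight0 : laplace_weight rkernel 0.
Proof. by apply: rkernel_weight; exact: wright_adm0. Qed.

(** This is the moment of order p = gamma / kappa + n; with mu = beta - alpha *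
    gamma / kappa one has mu + alpha * p = beta + alpha * n. *)
Lemma rkernel_moment (n : nat) :
  laplace_moment rkernel n = ml_weight gamma beta alpha kappa n * n`!%:R / rgamma gamma.
Proof.
have [/(_ 0 (wright_adm0 rho01 kappa0)) I E] :=
  wright_moments rho01 kappa0 (beta - alpha * gamma / kappa) (pn0 n).
have I' : mu.-integrable pos (fun u => (u `^ (gamma / kappa + n%:R - 1) *
    rwright (alpha / kappa) (beta - alpha * gamma / kappa) (u `^ kappa^-1))%:E).
  by apply: eq_integrable I => // u _; rewrite mul0r expR0 mulr1.
transitivity (Rintegral mu pos (fun u => (kappa * rgamma gamma)^-1 *
  (u `^ (gamma / kappa + n%:R - 1) *
  rwright (alpha / kappa) (beta - alpha * gamma / kappa) (u `^ kappa^-1)))).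
  by apply: eq_Rintegral => u /set_mem/posP u0; exact: rkernel_mono.
rewrite RintegralZl// E /wright_moment /ml_weight.
have k0 : kappa != 0 by rewrite gt_eqF.
have -> : kappa * (gamma / kappa + n%:R) = gamma + kappa * n%:R by field.
have -> : beta - alpha * gamma / kappa + alpha / kappa * (gamma + kappa * n%:R) =
  beta + alpha * n%:R by field.
have b0 : 0 < beta + alpha * n%:R by rewrite ltr_wpDr// mulr_ge0// ltW.
rewrite rgamma_inv_gt0E//.
have := rgamma_gt0 b0; have := rgamma_gt0 gamma0.
have f0 : n`!%:R != 0 :> R by rewrite pnatr_eq0 -lt0n fact_gt0.
move: (rgamma _) (rgamma _) (rgamma _) (n`!%:R) f0 => a b c f f0 a0 c0.
by field; rewrite k0 f0 !gt_eqF.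
Qed.

Lemma ml_coefE (n : nat) :
  ml_coef alpha beta gamma kappa n = (laplace_moment rkernel n / n`!%:R)%:C.
Proof.
have b0 : 0 < beta + alpha * n%:R by rewrite ltr_wpDr// mulr_ge0// ltW.
have c0 : 0 < gamma + kappa * n%:R by rewrite ltr_wpDr// mulr_ge0// ltW.
rewrite rkernel_moment /ml_coef !Gamma_real// -(rmorph_nat (real_complex R)).
rewrite -!rmorphM -fmorphV -rmorphM /ml_weight; congr (_%:C).
have := rgamma_gt0 b0; have := rgamma_gt0 gamma0.
have f0 : n`!%:R != 0 :> R by rewrite pnatr_eq0 -lt0n fact_gt0.
move: (rgamma _) (rgamma _) (rgamma _) (n`!%:R) f0 => a b c f f0 a0 d0.
by field; rewrite f0 !gt_eqF.
Qed.

Lemma converges_of_weight (c : R) (x : R[i]) : laplace_weight rkernel c ->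
  - c <= Re x -> converges alpha beta gamma kappa x.
Proof.
move=> hc cx; rewrite /converges laplace_integrandE.
exact: (@laplace_integrable R rkernel measurable_rkernel 0 x c hc cx).
Qed.

Lemma calE_cderiv (c : R) (x : R[i]) : laplace_weight rkernel c -> - c < Re x ->
  cderiv_at (calE alpha beta gamma kappa) x (laplace rkernel 1 x).
Proof.
move=> hc cx; have [C C0 H] := laplace_quadratic measurable_rkernel 0 hc.
move=> e e0; exists (Num.min (Re x + c) (e / (C + 1))).
  by rewrite lt_min; apply/andP; split; [lra|rewrite divr_gt0// ltr_wpDl].
move=> h; rewrite lt_min => /andP[h1 h2].
have := Re_le_nc h; rewrite ler_norml => /andP[h3 _].
rewrite !calE_laplace (le_trans (H x h (ltW cx) _))//; first by rewrite ReD; lra.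
rewrite exprS expr1 mulrA ler_wpM2r ?nc_ge0//.
move: h2; rewrite ltr_pdivlMr ?ltr_wpDl// mulrDr mulr1 mulrC => /ltW.
by apply: le_trans; rewrite lerDl nc_ge0.
Qed.

Lemma calE_series (c : R) (x : R[i]) : laplace_weight rkernel c -> nc x <= c ->
  cvgn (powser (ml_coef alpha beta gamma kappa) (- x)) /\
  calE alpha beta gamma kappa x = ml alpha beta gamma kappa (- x).
Proof.
move=> hc xc; have := laplace_series measurable_rkernel hc xc.
have -> : (fun n => (laplace_moment rkernel n / n`!%:R)%:C) = ml_coef alpha beta gamma kappa.
  by apply/funext => n; rewrite ml_coefE.
rewrite -calE_laplace => h; split; first exact: cvgP h.
by rewrite /ml; exact/esym/(cvg_lim (@norm_hausdorff _ R[i]^o) h).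
Qed.

Lemma open_half_plane (c : R) : open ([set x : R[i] | c < Re x] : set R[i]^o).
Proof.
rewrite openE => x /= cx; rewrite /interior; apply/nbhs_ballP.
exists (Re x - c)%:C => /=; first by rewrite ltcR subr_gt0.
move=> y; rewrite -ball_normE /= normcE_real ltcR => h.
have := Re_le_nc (x - y); rewrite ReB ler_norml => /andP[_ h1]; lra.
Qed.

(** The n-th derivative is the transform of (- u)^n k(u), and laplace_quadratic
    on the closed half-plane Re x >= 0 covers the point 0. *)
Lemma calE_right_derivatives :
  has_right_derivatives_at0 (fun x : R => calE alpha beta gamma kappa x%:C).
Proof.
have key n (x : R) : 0 <= x -> exists2 C, 0 <= C & forall h : R, 0 <= x + h ->
    nc (laplace rkernel n (x + h)%:C - laplace rkernel n x%:C -
      h%:C * laplace rkernel n.+1 x%:C) <= C * `|h| ^+ 2.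
  move=> x0; have [C C0 H] := laplace_quadratic measurable_rkernel n rkernel_weight0.
  exists C => // h xh; rewrite -nc_real rmorphD.
  by apply: H; rewrite ?oppr0//= oppr0.
have lim n (x : R) (F : set_system R) : Filter F -> 0 <= x ->
    (\forall h \near F, h != 0) -> (\forall h \near F, 0 <= x + h) ->
    h @[h --> F] --> (0 : R) ->
    ((laplace rkernel n (x + h)%:C - laplace rkernel n x%:C) / h%:C : R[i]^o)
      @[h --> F] --> (laplace rkernel n.+1 x%:C : R[i]^o).
  move=> FF x0 F0 Fx Fh; apply: complex_cvg.
  have [C C0 H] := key n x x0.
  have up : C * `|h| @[h --> F] --> (0 : R).
    rewrite -[X in _ --> X](mulr0 C); apply: cvgM; first exact: cvg_cst.
    by rewrite -[X in _ --> X](@normr0 _ R); exact: cvg_norm.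
  apply: (squeeze_cvgr _ (cvg_cst (0 : R)) up); near=> h.
  apply/andP; split; first exact: nc_ge0.
  have h0 : h != 0 by near: h.
  have xh : 0 <= x + h by near: h.
  have hn : 0 < `|h| by rewrite normr_gt0.
  rewrite -(ler_pM2r hn) -mulrA -expr2; apply: le_trans (H h xh).
  rewrite -(nc_real h) -normcM.
  have hc : h%:C != 0 by rewrite fmorph_eq0.
  rewrite le_eqVlt; apply/orP; left; apply/eqP; congr (nc _).
  by rewrite mulrBl [laplace _ _ _ * _]mulrC divfK.
exists (fun n x => laplace rkernel n x%:C); split.
- by move=> x _; rewrite calE_laplace.
- move=> n x x0; apply: (lim n x _ _ (ltW x0)).
  + exact: nbhs_dnbhs_neq.
  + have /nbhs_ballP[r r0 hr] : nbhs (0 : R) [set h : R | 0 < x + h].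
      apply: open_nbhs_nbhs; split; last by rewrite /= addr0.
      rewrite (_ : [set h : R | 0 < x + h] = [set h | - x < h]); first exact: open_gt.
      by apply/seteqP; split => h /=; lra.
    by rewrite near_withinE; apply/nbhs_ballP; exists r => // h /hr /ltW.
  + exact: cvg_within.
- move=> n; rewrite [X in X @ _](_ : _ = fun h =>
      (laplace rkernel n (0 + h)%:C - laplace rkernel n 0%:C) / h%:C); last first.
    by apply/funext => h; rewrite add0r.
  apply: (lim n 0 _ _ (lexx 0)).
  + by near=> h; rewrite gt_eqF.
  + by near=> h; rewrite add0r ltW.
  + exact: cvg_within.
Unshelve. all: by end_near. Qed.

(** The moments divided by n! are the weights up to a constant; their ratios
    eventually exceed 2 K, against a bound by C K^n. *)
Lemma calE_not_analytic : 1 + alpha - kappa < 0 ->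
  ~ analytic_at0 (fun x : R => calE alpha beta gamma kappa x%:C).
Proof.
move=> D0; under [X in analytic_at0 X]eq_fun do rewrite calE_laplace.
move=> /(analytic_moment_growth measurable_rkernel rkernel_weight0)[C [K [C0 K0 H]]].
pose w := ml_weight gamma beta alpha kappa.
have w0 n : 0 < w n by exact: ml_weight_gt0.
have g0 := rgamma_gt0 gamma0.
have Hw n : (0 < n)%N -> w n <= C * rgamma gamma * K ^+ n.
  move=> n0; have := H n n0; rewrite rkernel_moment -/w.
  have f0 : 0 < n`!%:R :> R by rewrite ltr0n fact_gt0.
  have w00 := ltW (w0 n); rewrite ger0_norm; last first.
    by rewrite divr_ge0 ?(ltW g0)// mulr_ge0 ?(ltW f0).
  rewrite ler_pdivrMr// [leRHS]mulrAC ler_pM2r//.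
  by rewrite mulrAC.
have [N _ HN] : \forall n \near \oo, 2 * K * w n <= w n.+1.
  by apply: ml_weight_growth => //; rewrite mulr_gt0.
pose M := N.+1.
have grow j : (2 * K) ^+ j * w M <= w (M + j)%N.
  elim: j => [|j IH]; first by rewrite expr0 mul1r addn0.
  rewrite exprS -mulrA addnS (le_trans _ (HN (M + j)%N _))//.
    by rewrite ler_wpM2l// mulr_ge0// ltW.
  by rewrite /= (leq_trans (leqnSn N))// leq_addr.
have K20 : 0 < (2 * K : R) by rewrite mulr_gt0.
have B j : 2 ^+ j * w M <= C * rgamma gamma * K ^+ M.
  have := le_trans (grow j) (Hw (M + j)%N isT).
  rewrite exprD exprMn [K ^+ M * _]mulrC [X in _ <= X]mulrCA mulrAC.
  rewrite [X in X <= _]mulrC ler_pM2l ?exprn_gt0//.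
have : \forall j \near \oo, C * rgamma gamma * K ^+ M / w M < j%:R.
  by apply: nbhs_infty_gtr.
move=> [j _ /(_ j (leqnn j))]; rewrite ltr_pdivrMr// => hj.
have : j%:R * w M <= 2 ^+ j * w M.
  rewrite ler_pM2r// -natrX ler_nat ltnW//; exact: ltn_expl.
by move=> /le_trans /(_ (B j)); rewrite leNgt hj.
Qed.

End MittagLeffler.

(** * The three regimes of Delta *)

Theorem proposition2 (R : realType) (alpha beta gamma kappa : R)
    (alpha_gt0 : 0 < alpha) (beta_gt0 : 0 < beta) (gamma_gt0 : 0 < gamma)
    (kappa_gt0 : 0 < kappa) (alpha_lt_kappa : alpha < kappa) :
  let Delta : R := 1 + alpha - kappa in
  let rad : R := (alpha `^ alpha) / (kappa `^ kappa) in
  let E := ml alpha beta gamma kappa in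
  let Eseries := powser (ml_coef alpha beta gamma kappa) in
  let I := calE alpha beta gamma kappa in
  let Iconv := converges alpha beta gamma kappa in
  [/\ forall x : R, 0 <= x -> Iconv x%:C,
      0 < Delta ->
        [/\ forall x : R[i], Iconv x,
            holomorphic_on setT I &
            forall x : R[i], cvgn (Eseries (- x)) /\ I x = E (- x)],
      Delta = 0 ->
        [/\ forall x : R[i], - rad < complex.Re x -> Iconv x,
            holomorphic_on [set x : R[i] | - rad < complex.Re x] I &
            forall x : R[i], `|x| < rad%:C ->
              cvgn (Eseries (- x)) /\ I x = E (- x)] &
      Delta < 0 ->
        [/\ forall x : R[i], 0 < complex.Re x -> Iconv x,
            holomorphic_on [set x : R[i] | 0 < complex.Re x] I,
            has_right_derivatives_at0 (fun x : R => I x%:C) &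
            ~ analytic_at0 (fun x : R => I x%:C)]].
Proof.
move=> Delta rad E Eseries I Iconv.
pose k := rkernel alpha beta gamma kappa.
have k0 : laplace_weight k 0 by exact: rkernel_weight0.
have adm c : 0 <= c -> 0 < Delta \/ (Delta = 0 /\ c < rad) -> laplace_weight k c.
  by move=> c0 hc; apply: rkernel_weight => //; exact: wright_adm_criterion.
have conv c x : laplace_weight k c -> - c <= complex.Re x -> Iconv x.
  exact: converges_of_weight.
have holo c x : laplace_weight k c -> - c < complex.Re x ->
    derivable (I : R[i]^o -> R[i]^o) x 1.
  by move=> hc cx; apply: (@derivable_of_cderiv R I x _ (calE_cderiv _ _ _ _ hc cx)).
have sum c x : laplace_weight k c -> ComplexField.Normc.normc x <= c ->
    cvgn (Eseries (- x)) /\ I x = E (- x).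
  exact: calE_series.
split.
- by move=> x x0; apply: (conv 0 _ k0); rewrite oppr0.
- move=> D0.
  split => [x||x].
  + by apply: (conv `|complex.Re x|); [exact: adm (normr_ge0 _) (or_introl D0)|
      rewrite lerNl -normrN ler_norm].
  + split; first exact: openT.
    move=> x _; apply: (holo (`|complex.Re x| + 1)).
      by apply: adm (or_introl D0); rewrite addr_ge0.
    by have := ler_norm (- complex.Re x); rewrite normrN; lra.
  + apply: (sum (ComplexField.Normc.normc x)) => //.
    exact: adm (nc_ge0 x) (or_introl D0).
- move=> D0.
  have rad0 : 0 < rad by rewrite divr_gt0// powR_gt0.
  (* any exponent strictly between |Re x| and the radius is admissible *)
  have mid (r : R) : r < rad -> exists2 c, laplace_weight k c & r < c.
    move=> hr; exists ((Num.max 0 r + rad) / 2).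
      apply: adm.
        by rewrite divr_ge0// addr_ge0 ?(ltW rad0)// le_max lexx.
      right; split => //; have : Num.max 0 r < rad by rewrite gt_max rad0 hr.
      lra.
    have : r <= Num.max 0 r by rewrite le_max lexx orbT.
    lra.
  split => [x hx||x hx].
  + have [|c hc xc] := mid (- complex.Re x); first by rewrite ltrNl.
    by apply: (conv c _ hc); rewrite lerNl ltW.
  + split; first exact: open_half_plane.
    move=> x /= hx; have [|c hc xc] := mid (- complex.Re x); first by rewrite ltrNl.
    by apply: (holo c _ hc); rewrite ltrNl.
  + have [|c hc xc] := mid (ComplexField.Normc.normc x).
      by rewrite -ltcR -normcE_real.
    by apply: (sum c _ hc); rewrite ltW.
- move=> D0; split => [x x0|||].
  + by apply: (conv 0 _ k0); rewrite oppr0 ltW.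
  + split; first exact: open_half_plane.
    by move=> x /= x0; apply: (holo 0 _ k0); rewrite oppr0.
  + exact: calE_right_derivatives.
  + exact: calE_not_analytic.
Qed.
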